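(* In guarded MTT, at mode $s$, let $A, B : U$ and $f : \mathsf{El}(A)\to\mathsf{El}(A)\to\mathsf{El}(B)$. Then there is a term of type $$\big((x,y:\mathsf{El}(A))\to\mathsf{Eq}_{\mathsf{El}(B)}(f(x,y),f(y,x))\big)\to (s,t:\mathsf{El}(\mathsf{Str}(A)))\to\mathsf{Eq}_{\mathsf{El}(\mathsf{Str}(B))}(\mathsf{zipWith}(f,s,t),\mathsf{zipWith}(f,t,s)).$$
   Context: MTT over a mode theory $\mathcal{M}$ is a dependent type theory with, at each mode, $\Pi$, $\Sigma$, identity types, booleans and a Coquand-style universe $U$ with decoding $\mathsf{El}$; locks $\Gamma.\{\mu\}$ for each modality $\mu:n\to m$ (with $\Gamma.\{1\}=\Gamma$, $\Gamma.\{\mu\}.\{\nu\}=\Gamma.\{\mu\circ\nu\}$), key substitutions for 2-cells, modal types $\langle\mu\mid A\rangle$ with introduction $\mathsf{mod}_\mu$ and eliminator $\mathsf{let}_\nu\ \mathsf{mod}_\mu(x)\leftarrow M_0\ \mathsf{in}\ M_1$ ($\beta$, no $\eta$). For $f : \langle\mu\mid A\to B\rangle$ and $a : \langle\mu\mid A\rangle$, $f\circledast_\mu a := \mathsf{let}_1\ \mathsf{mod}_\mu(f_0)\leftarrow f\ \mathsf{in}\ \mathsf{let}_1\ \mathsf{mod}_\mu(a_0)\leftarrow a\ \mathsf{in}\ \mathsf{mod}_\mu(f_0\,a_0)$. Guarded MTT is MTT over the poset-enriched mode theory $\mathcal{M}_g$ with modes $s,t$, 1-cells $\ell:t\to t$,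 $\gamma:t\to s$, $\delta:s\to t$, equations $\gamma\circ\delta=1_s$, $\gamma\circ\ell=\gamma$, 2-cells $\delta\circ\gamma\le1_t$, $1_t\le\ell$; identity types replaced by extensional identity types $\mathsf{Eq}$ with equality reflection; and at mode $t$ Löb induction $\mathsf{löb}:(\triangleright A\to A)\to A$ with $\mathsf{löb}(M)=M(\mathsf{next}(\mathsf{löb}(M)))$, where $\triangleright A:=\langle\ell\mid A\rangle$, $\mathsf{next}(x):=\mathsf{let}_1\ \mathsf{mod}_1(z)\leftarrow\mathsf{mod}_1(x)\ \mathsf{in}\ \mathsf{mod}_\ell(z^{1\le\ell})$ (key annotations elided). Write $\Delta X:=\langle\delta\mid X\rangle$, $\Gamma X := \langle\gamma\mid X\rangle$ (also on codes). For $A:U$ at mode $s$: $\mathsf{Str}'(A) := \mathsf{löb}(\lambda X.\ \Delta A\times(\mathsf{let}_1\ \mathsf{mod}_\ell(Y)\leftarrow X\ \mathsf{in}\ \triangleright Y)) : U$ at mode $t$ (so $\mathsf{Str}'(A)=\Delta A\times\triangleright\mathsf{Str}'(A)$) and $\mathsf{Str}(A):=\Gamma(\mathsf{Str}'(A))$ at mode $s$. Define at mode $t$, for $f : \Delta(\mathsf{El}A\to\mathsf{El}B\to\mathsf{El}C)$, $\mathsf{zipWith}'(f) := \mathsf{löb}(\lambda r.\lambda x\,y.\ ((f\circledast_\delta\pi_0 x)\circledast_\delta\pi_0 y,\ (r\circledast_\ell\pi_1 x)\circledast_\ell\pi_1 y)) : \mathsf{El}\,\mathsf{Str}'(A)\to\mathsf{El}\,\mathsf{Str}'(B)\to\mathsf{El}\,\mathsf{Str}'(C)$,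 and at mode $s$, for $f:\mathsf{El}A\to\mathsf{El}B\to\mathsf{El}C$, $\mathsf{zipWith}(f,x,y) := (\mathsf{mod}_\gamma(\mathsf{zipWith}'(\mathsf{mod}_\delta(f)))\circledast_\gamma x)\circledast_\gamma y : \mathsf{El}\,\mathsf{Str}(C)$. *)

(* Defs.v *)
(** Guarded MTT as an explicit-substitution calculus with de Bruijn indices:
    raw syntax indexed by modes, and inductively defined judgments. *)

Set Implicit Arguments.
Unset Strict Implicit.
Set Contextual Implicit.
Unset Printing Implicit Defensive.

Inductive mode : Set := ms | mt.

Inductive hom : mode -> mode -> Type :=
| hid (m : mode) : hom m m
| hcomp (o n m : mode) (mu : hom n m) (nu : hom o n) : hom o m
| ell : hom mt mt
| gam : hom mt ms
| del : hom ms mt.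

Arguments hid {m}.
Notation "𝟙" := hid.
Infix "∘" := hcomp (at level 40, left associativity).

(** The poset-enriched category is presented by generators and relations:
    [hle] is the least compatible preorder containing the generating 2-cells
    and the equations (in both directions), and 1-cells are identified when
    they are related both ways. *)
Inductive hle : forall n m : mode, hom n m -> hom n m -> Prop :=
| hle_refl n m (mu : hom n m) : hle mu mu
| hle_trans n m (mu nu rho : hom n m) : hle mu nu -> hle nu rho -> hle mu rho
| hle_comp o n m (mu mu' : hom n m) (nu nu' : hom o n) :
    hle mu mu' -> hle nu nu' -> hle (mu ∘ nu) (mu' ∘ nu')
| hle_id_l n m (mu : hom n m) : hle (𝟙 ∘ mu) mu
| hle_id_l' n m (mu : hom n m) : hle mu (𝟙 ∘ mu)
| hle_id_r n m (mu : hom n m) : hle (mu ∘ 𝟙) mu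
| hle_id_r' n m (mu : hom n m) : hle mu (mu ∘ 𝟙)
| hle_assoc p o n m (mu : hom n m) (nu : hom o n) (rho : hom p o) :
    hle ((mu ∘ nu) ∘ rho) (mu ∘ (nu ∘ rho))
| hle_assoc' p o n m (mu : hom n m) (nu : hom o n) (rho : hom p o) :
    hle (mu ∘ (nu ∘ rho)) ((mu ∘ nu) ∘ rho)
| hle_gam_del : hle (gam ∘ del) 𝟙
| hle_gam_del' : hle 𝟙 (gam ∘ del)
| hle_gam_ell : hle (gam ∘ ell) gam
| hle_gam_ell' : hle gam (gam ∘ ell)
| hle_del_gam : hle (del ∘ gam) 𝟙
| hle_ell : hle 𝟙 ell.

Definition heq (n m : mode) (mu nu : hom n m) : Prop := hle mu nu /\ hle nu mu.

Inductive ty : mode -> Type :=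
| TSub m (A : ty m) (sg : sub m) : ty m
| TBool m : ty m
| TU m : ty m
| TEl m (M : tm m) : ty m
| TPi m (A B : ty m) : ty m
| TSig m (A B : ty m) : ty m
| TEq m (A : ty m) (M N : tm m) : ty m
| TMod n m (mu : hom n m) (A : ty n) : ty m

(** Eliminators carry their type arguments: with equality reflection the types
    of their subterms do not determine them. *)
with tm : mode -> Type :=
| tsub m (M : tm m) (sg : sub m) : tm m
| tvar m : tm m
| ttrue m : tm m
| tfalse m : tm m
| tif m (C : ty m) (M N b : tm m) : tm m
| tlam m (A : ty m) (M : tm m) : tm m
| tapp m (A B : ty m) (M N : tm m) : tm m
| tpair m (A B : ty m) (M N : tm m) : tm m
| tfst m (A B : ty m) (M : tm m) : tm m
| tsnd m (A B : ty m) (M : tm m) : tm m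
| trefl m (M : tm m) : tm m
| tcode m (A : ty m) : tm m
| tmod n m (mu : hom n m) (M : tm n) : tm m
(* [tlet nu mu A C M0 M1] is [let_nu mod_mu(x) <- M0 in M1], with [A] the type
   of [x] and [C] the motive *)
| tlet n m o (nu : hom m o) (mu : hom n m) (A : ty n) (C : ty o)
    (M0 : tm m) (M1 : tm o) : tm o
| tlob (A : ty mt) (M : tm mt) : tm mt

with sub : mode -> Type :=
| sid m : sub m
| scomp m (sg tau : sub m) : sub m
| sbang m : sub m
| swk m : sub m
| sext n m (mu : hom n m) (sg : sub m) (M : tm n) : sub m
| slock n m (sg : sub m) (mu : hom n m) : sub n
(* for [mu <= nu], the substitution from [Γ.{nu}] to [Γ.{mu}] *)
| skey n m (mu nu : hom n m) : sub n.

Inductive ctx : mode -> Type :=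
| cemp m : ctx m
| clock n m (Γ : ctx m) (mu : hom n m) : ctx n
| cext n m (Γ : ctx m) (mu : hom n m) (A : ty n) : ctx m.

Notation "A ⟦ σ ⟧" := (TSub A σ) (at level 8, left associativity, format "A ⟦ σ ⟧").
Notation "M ⟪ σ ⟫" := (tsub M σ) (at level 8, left associativity, format "M ⟪ σ ⟫").
Notation "σ ⊙ τ" := (scomp σ τ) (at level 40, left associativity).
Notation "Γ ,{ μ }" := (clock Γ μ) (at level 50, left associativity, format "Γ ,{ μ }").
Notation "Γ ,[ μ ∣ A ]" := (cext Γ μ A) (at level 50, left associativity, format "Γ ,[ μ  ∣  A ]").
Notation "Γ ,, A" := (cext Γ hid A) (at level 50, left associativity).

(** [slift mu σ : Γ.(mu | A[σ.{mu}]) -> Δ.(mu | A)] for [σ : Γ -> Δ]. *)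
Definition slift n m (mu : hom n m) (sg : sub m) : sub m :=
  sext mu (sg ⊙ swk) tvar.

(** [sone mu M : Γ -> Γ.(mu | A)] for [M : A] in [Γ.{mu}]. *)
Definition sone n m (mu : hom n m) (M : tm n) : sub m := sext mu sid M.

Definition Arrow m (A B : ty m) : ty m := TPi A B⟦swk⟧.

(** From [Γ.{ell}] to [Γ.{1}], which is the context [Γ]. *)
Definition key1l : sub mt := skey 𝟙 ell.

(** [▷ A], for [A] a type in [Γ.{ell}]. *)
Definition Later (A : ty mt) : ty mt := TMod ell A.

(** For [A] a type in [Γ] (not [Γ.{ell}]) and [M : A]; the result has type
    [Later A⟦key1l⟧]. *)
Definition next (A : ty mt) (M : tm mt) : tm mt :=
  tlet 𝟙 𝟙 A (Later A⟦key1l⟧)⟦swk⟧ (tmod 𝟙 M) (tmod ell tvar⟪key1l⟫).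

(** Only small types have codes in [U]; the inclusion of small types into large
    ones is silent ([wf_ty_large]). *)
Inductive size : Set := small | large.

Inductive wf_ctx : forall m, ctx m -> Prop :=
| wf_cemp m : wf_ctx (cemp (m:=m))
| wf_clock n m (Γ : ctx m) (mu : hom n m) : wf_ctx Γ -> wf_ctx (Γ,{mu})
| wf_cext n m (Γ : ctx m) (mu : hom n m) A :
    wf_ctx Γ -> wf_ty (Γ,{mu}) large A -> wf_ctx (Γ,[mu ∣ A])

with eq_ctx : forall m, ctx m -> ctx m -> Prop :=
| eq_ctx_refl m (Γ : ctx m) : wf_ctx Γ -> eq_ctx Γ Γ
| eq_ctx_sym m (Γ Δ : ctx m) : eq_ctx Γ Δ -> eq_ctx Δ Γ
| eq_ctx_trans m (Γ Δ Θ : ctx m) : eq_ctx Γ Δ -> eq_ctx Δ Θ -> eq_ctx Γ Θ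
| eq_clock n m (Γ Δ : ctx m) (mu nu : hom n m) :
    eq_ctx Γ Δ -> heq mu nu -> eq_ctx (Γ,{mu}) (Δ,{nu})
| eq_cext n m (Γ Δ : ctx m) (mu nu : hom n m) A B :
    eq_ctx Γ Δ -> heq mu nu -> wf_ty (Γ,{mu}) large A ->
    eq_ty (Γ,{mu}) large A B -> eq_ctx (Γ,[mu ∣ A]) (Δ,[nu ∣ B])
| eq_clock_id m (Γ : ctx m) : wf_ctx Γ -> eq_ctx (Γ,{𝟙}) Γ
| eq_clock_comp o n m (Γ : ctx m) (mu : hom n m) (nu : hom o n) :
    wf_ctx Γ -> eq_ctx (Γ,{mu ∘ nu}) (Γ,{mu},{nu})

with wf_ty : forall m, ctx m -> size -> ty m -> Prop :=
| wf_ty_ctx m (Γ Δ : ctx m) l A : wf_ty Γ l A -> eq_ctx Γ Δ -> wf_ty Δ l A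
| wf_ty_large m (Γ : ctx m) A : wf_ty Γ small A -> wf_ty Γ large A
| wf_TSub m (Γ Δ : ctx m) l A sg :
    wf_sub Γ sg Δ -> wf_ty Δ l A -> wf_ty Γ l A⟦sg⟧
| wf_TBool m (Γ : ctx m) l : wf_ctx Γ -> wf_ty Γ l TBool
| wf_TU m (Γ : ctx m) : wf_ctx Γ -> wf_ty Γ large TU
| wf_TEl m (Γ : ctx m) l M : wf_tm Γ M TU -> wf_ty Γ l (TEl M)
| wf_TPi m (Γ : ctx m) l A B :
    wf_ty Γ l A -> wf_ty (Γ,,A) l B -> wf_ty Γ l (TPi A B)
| wf_TSig m (Γ : ctx m) l A B :
    wf_ty Γ l A -> wf_ty (Γ,,A) l B -> wf_ty Γ l (TSig A B)
| wf_TEq m (Γ : ctx m) l A M N :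
    wf_ty Γ l A -> wf_tm Γ M A -> wf_tm Γ N A -> wf_ty Γ l (TEq A M N)
| wf_TMod n m (Γ : ctx m) l (mu : hom n m) A :
    wf_ctx Γ -> wf_ty (Γ,{mu}) l A -> wf_ty Γ l (TMod mu A)

with eq_ty : forall m, ctx m -> size -> ty m -> ty m -> Prop :=
| eq_ty_refl m (Γ : ctx m) l A : wf_ty Γ l A -> eq_ty Γ l A A
| eq_ty_sym m (Γ : ctx m) l A B : eq_ty Γ l A B -> eq_ty Γ l B A
| eq_ty_trans m (Γ : ctx m) l A B C :
    eq_ty Γ l A B -> eq_ty Γ l B C -> eq_ty Γ l A C
| eq_ty_ctx m (Γ Δ : ctx m) l A B :
    eq_ty Γ l A B -> eq_ctx Γ Δ -> eq_ty Δ l A B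
| eq_ty_large m (Γ : ctx m) A B : eq_ty Γ small A B -> eq_ty Γ large A B
| eq_TSub m (Γ Δ : ctx m) l A B sg tau :
    eq_sub Γ sg tau Δ -> eq_ty Δ l A B -> eq_ty Γ l A⟦sg⟧ B⟦tau⟧
| eq_TEl m (Γ : ctx m) l M N : eq_tm Γ M N TU -> eq_ty Γ l (TEl M) (TEl N)
| eq_TPi m (Γ : ctx m) l A A' B B' :
    wf_ty Γ l A -> eq_ty Γ l A A' -> eq_ty (Γ,,A) l B B' ->
    eq_ty Γ l (TPi A B) (TPi A' B')
| eq_TSig m (Γ : ctx m) l A A' B B' :
    wf_ty Γ l A -> eq_ty Γ l A A' -> eq_ty (Γ,,A) l B B' ->
    eq_ty Γ l (TSig A B) (TSig A' B')
| eq_TEq m (Γ : ctx m) l A A' M M' N N' :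
    eq_ty Γ l A A' -> eq_tm Γ M M' A -> eq_tm Γ N N' A ->
    eq_ty Γ l (TEq A M N) (TEq A' M' N')
| eq_TMod n m (Γ : ctx m) l (mu nu : hom n m) A A' :
    wf_ctx Γ -> heq mu nu -> eq_ty (Γ,{mu}) l A A' ->
    eq_ty Γ l (TMod mu A) (TMod nu A')
| eq_TEl_code m (Γ : ctx m) A :
    wf_ty Γ small A -> eq_ty Γ small (TEl (tcode A)) A
| eq_TSub_id m (Γ : ctx m) l A : wf_ty Γ l A -> eq_ty Γ l A⟦sid⟧ A
| eq_TSub_comp m (Γ Δ Θ : ctx m) l A sg tau :
    wf_sub Γ tau Δ -> wf_sub Δ sg Θ -> wf_ty Θ l A ->
    eq_ty Γ l A⟦sg ⊙ tau⟧ A⟦sg⟧⟦tau⟧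
| eq_TBool_sub m (Γ Δ : ctx m) l sg :
    wf_sub Γ sg Δ -> eq_ty Γ l TBool⟦sg⟧ TBool
| eq_TU_sub m (Γ Δ : ctx m) sg :
    wf_sub Γ sg Δ -> eq_ty Γ large TU⟦sg⟧ TU
| eq_TEl_sub m (Γ Δ : ctx m) l M sg :
    wf_sub Γ sg Δ -> wf_tm Δ M TU -> eq_ty Γ l (TEl M)⟦sg⟧ (TEl M⟪sg⟫)
| eq_TPi_sub m (Γ Δ : ctx m) l A B sg :
    wf_sub Γ sg Δ -> wf_ty Δ l A -> wf_ty (Δ,,A) l B ->
    eq_ty Γ l (TPi A B)⟦sg⟧ (TPi A⟦sg⟧ B⟦slift 𝟙 sg⟧)
| eq_TSig_sub m (Γ Δ : ctx m) l A B sg :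
    wf_sub Γ sg Δ -> wf_ty Δ l A -> wf_ty (Δ,,A) l B ->
    eq_ty Γ l (TSig A B)⟦sg⟧ (TSig A⟦sg⟧ B⟦slift 𝟙 sg⟧)
| eq_TEq_sub m (Γ Δ : ctx m) l A M N sg :
    wf_sub Γ sg Δ -> wf_ty Δ l A -> wf_tm Δ M A -> wf_tm Δ N A ->
    eq_ty Γ l (TEq A M N)⟦sg⟧ (TEq A⟦sg⟧ M⟪sg⟫ N⟪sg⟫)
| eq_TMod_sub n m (Γ Δ : ctx m) l (mu : hom n m) A sg :
    wf_sub Γ sg Δ -> wf_ty (Δ,{mu}) l A ->
    eq_ty Γ l (TMod mu A)⟦sg⟧ (TMod mu A⟦slock sg mu⟧)

with wf_tm : forall m, ctx m -> tm m -> ty m -> Prop :=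
| wf_tm_ctx m (Γ Δ : ctx m) M A : wf_tm Γ M A -> eq_ctx Γ Δ -> wf_tm Δ M A
| wf_tm_conv m (Γ : ctx m) M A B :
    wf_tm Γ M A -> eq_ty Γ large A B -> wf_tm Γ M B
| wf_tsub m (Γ Δ : ctx m) M A sg :
    wf_sub Γ sg Δ -> wf_tm Δ M A -> wf_tm Γ M⟪sg⟫ A⟦sg⟧
| wf_tvar n m (Γ : ctx m) (mu : hom n m) A :
    wf_ctx Γ -> wf_ty (Γ,{mu}) large A ->
    wf_tm (Γ,[mu ∣ A],{mu}) tvar A⟦slock swk mu⟧
| wf_ttrue m (Γ : ctx m) : wf_ctx Γ -> wf_tm Γ ttrue TBool
| wf_tfalse m (Γ : ctx m) : wf_ctx Γ -> wf_tm Γ tfalse TBool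
| wf_tif m (Γ : ctx m) C M N b :
    wf_ty (Γ,,TBool) large C ->
    wf_tm Γ M C⟦sone 𝟙 ttrue⟧ -> wf_tm Γ N C⟦sone 𝟙 tfalse⟧ ->
    wf_tm Γ b TBool -> wf_tm Γ (tif C M N b) C⟦sone 𝟙 b⟧
| wf_tlam m (Γ : ctx m) A B M :
    wf_ty Γ large A -> wf_ty (Γ,,A) large B -> wf_tm (Γ,,A) M B ->
    wf_tm Γ (tlam A M) (TPi A B)
| wf_tapp m (Γ : ctx m) A B M N :
    wf_ty Γ large A -> wf_ty (Γ,,A) large B ->
    wf_tm Γ M (TPi A B) -> wf_tm Γ N A -> wf_tm Γ (tapp A B M N) B⟦sone 𝟙 N⟧
| wf_tpair m (Γ : ctx m) A B M N :
    wf_ty Γ large A -> wf_ty (Γ,,A) large B ->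
    wf_tm Γ M A -> wf_tm Γ N B⟦sone 𝟙 M⟧ -> wf_tm Γ (tpair A B M N) (TSig A B)
| wf_tfst m (Γ : ctx m) A B M :
    wf_ty Γ large A -> wf_ty (Γ,,A) large B ->
    wf_tm Γ M (TSig A B) -> wf_tm Γ (tfst A B M) A
| wf_tsnd m (Γ : ctx m) A B M :
    wf_ty Γ large A -> wf_ty (Γ,,A) large B ->
    wf_tm Γ M (TSig A B) -> wf_tm Γ (tsnd A B M) B⟦sone 𝟙 (tfst A B M)⟧
| wf_trefl m (Γ : ctx m) A M :
    wf_ty Γ large A -> wf_tm Γ M A -> wf_tm Γ (trefl M) (TEq A M M)
| wf_tcode m (Γ : ctx m) A : wf_ty Γ small A -> wf_tm Γ (tcode A) TU
| wf_tmod n m (Γ : ctx m) (mu : hom n m) A M :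
    wf_ctx Γ -> wf_ty (Γ,{mu}) large A -> wf_tm (Γ,{mu}) M A ->
    wf_tm Γ (tmod mu M) (TMod mu A)
| wf_tlet n m o (Γ : ctx o) (nu : hom m o) (mu : hom n m) A C M0 M1 :
    wf_ctx Γ -> wf_ty (Γ,{nu},{mu}) large A ->
    wf_ty (Γ,[nu ∣ TMod mu A]) large C ->
    wf_tm (Γ,{nu}) M0 (TMod mu A) ->
    wf_tm (Γ,[nu ∘ mu ∣ A]) M1 C⟦sext nu swk (tmod mu tvar)⟧ ->
    wf_tm Γ (tlet nu mu A C M0 M1) C⟦sone nu M0⟧
| wf_tlob (Γ : ctx mt) A M :
    wf_ty Γ large A -> wf_tm Γ M (Arrow (Later A⟦key1l⟧) A) ->
    wf_tm Γ (tlob A M) A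

with eq_tm : forall m, ctx m -> tm m -> tm m -> ty m -> Prop :=
| eq_tm_refl m (Γ : ctx m) M A : wf_tm Γ M A -> eq_tm Γ M M A
| eq_tm_sym m (Γ : ctx m) M N A : eq_tm Γ M N A -> eq_tm Γ N M A
| eq_tm_trans m (Γ : ctx m) M N P A :
    eq_tm Γ M N A -> eq_tm Γ N P A -> eq_tm Γ M P A
| eq_tm_ctx m (Γ Δ : ctx m) M N A :
    eq_tm Γ M N A -> eq_ctx Γ Δ -> eq_tm Δ M N A
| eq_tm_conv m (Γ : ctx m) M N A B :
    eq_tm Γ M N A -> eq_ty Γ large A B -> eq_tm Γ M N B
| eq_tsub m (Γ Δ : ctx m) M N A sg tau :
    eq_sub Γ sg tau Δ -> eq_tm Δ M N A -> eq_tm Γ M⟪sg⟫ N⟪tau⟫ A⟦sg⟧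
| eq_tif m (Γ : ctx m) C C' M M' N N' b b' :
    wf_ty (Γ,,TBool) large C -> eq_ty (Γ,,TBool) large C C' ->
    eq_tm Γ M M' C⟦sone 𝟙 ttrue⟧ -> eq_tm Γ N N' C⟦sone 𝟙 tfalse⟧ ->
    eq_tm Γ b b' TBool -> eq_tm Γ (tif C M N b) (tif C' M' N' b') C⟦sone 𝟙 b⟧
| eq_tlam m (Γ : ctx m) A A' B M M' :
    wf_ty Γ large A -> eq_ty Γ large A A' -> wf_ty (Γ,,A) large B ->
    eq_tm (Γ,,A) M M' B -> eq_tm Γ (tlam A M) (tlam A' M') (TPi A B)
| eq_tapp m (Γ : ctx m) A A' B B' M M' N N' :
    wf_ty Γ large A -> eq_ty Γ large A A' ->
    wf_ty (Γ,,A) large B -> eq_ty (Γ,,A) large B B' ->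
    eq_tm Γ M M' (TPi A B) -> eq_tm Γ N N' A ->
    eq_tm Γ (tapp A B M N) (tapp A' B' M' N') B⟦sone 𝟙 N⟧
| eq_tpair m (Γ : ctx m) A A' B B' M M' N N' :
    wf_ty Γ large A -> eq_ty Γ large A A' ->
    wf_ty (Γ,,A) large B -> eq_ty (Γ,,A) large B B' ->
    eq_tm Γ M M' A -> eq_tm Γ N N' B⟦sone 𝟙 M⟧ ->
    eq_tm Γ (tpair A B M N) (tpair A' B' M' N') (TSig A B)
| eq_tfst m (Γ : ctx m) A A' B B' M M' :
    wf_ty Γ large A -> eq_ty Γ large A A' ->
    wf_ty (Γ,,A) large B -> eq_ty (Γ,,A) large B B' ->
    eq_tm Γ M M' (TSig A B) -> eq_tm Γ (tfst A B M) (tfst A' B' M') A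
| eq_tsnd m (Γ : ctx m) A A' B B' M M' :
    wf_ty Γ large A -> eq_ty Γ large A A' ->
    wf_ty (Γ,,A) large B -> eq_ty (Γ,,A) large B B' ->
    eq_tm Γ M M' (TSig A B) ->
    eq_tm Γ (tsnd A B M) (tsnd A' B' M') B⟦sone 𝟙 (tfst A B M)⟧
| eq_trefl m (Γ : ctx m) A M M' :
    wf_ty Γ large A -> eq_tm Γ M M' A ->
    eq_tm Γ (trefl M) (trefl M') (TEq A M M)
| eq_tcode m (Γ : ctx m) A A' :
    eq_ty Γ small A A' -> eq_tm Γ (tcode A) (tcode A') TU
| eq_tmod n m (Γ : ctx m) (mu nu : hom n m) A M M' :
    wf_ctx Γ -> heq mu nu -> wf_ty (Γ,{mu}) large A -> eq_tm (Γ,{mu}) M M' A ->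
    eq_tm Γ (tmod mu M) (tmod nu M') (TMod mu A)
| eq_tlet n m o (Γ : ctx o) (nu nu' : hom m o) (mu mu' : hom n m)
    A A' C C' M0 M0' M1 M1' :
    wf_ctx Γ -> heq nu nu' -> heq mu mu' ->
    wf_ty (Γ,{nu},{mu}) large A -> eq_ty (Γ,{nu},{mu}) large A A' ->
    wf_ty (Γ,[nu ∣ TMod mu A]) large C ->
    eq_ty (Γ,[nu ∣ TMod mu A]) large C C' ->
    eq_tm (Γ,{nu}) M0 M0' (TMod mu A) ->
    eq_tm (Γ,[nu ∘ mu ∣ A]) M1 M1' C⟦sext nu swk (tmod mu tvar)⟧ ->
    eq_tm Γ (tlet nu mu A C M0 M1) (tlet nu' mu' A' C' M0' M1') C⟦sone nu M0⟧
| eq_tlob (Γ : ctx mt) A A' M M' :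
    wf_ty Γ large A -> eq_ty Γ large A A' ->
    eq_tm Γ M M' (Arrow (Later A⟦key1l⟧) A) ->
    eq_tm Γ (tlob A M) (tlob A' M') A
| eq_tif_true m (Γ : ctx m) C M N :
    wf_ty (Γ,,TBool) large C ->
    wf_tm Γ M C⟦sone 𝟙 ttrue⟧ -> wf_tm Γ N C⟦sone 𝟙 tfalse⟧ ->
    eq_tm Γ (tif C M N ttrue) M C⟦sone 𝟙 ttrue⟧
| eq_tif_false m (Γ : ctx m) C M N :
    wf_ty (Γ,,TBool) large C ->
    wf_tm Γ M C⟦sone 𝟙 ttrue⟧ -> wf_tm Γ N C⟦sone 𝟙 tfalse⟧ ->
    eq_tm Γ (tif C M N tfalse) N C⟦sone 𝟙 tfalse⟧
| eq_TPi_beta m (Γ : ctx m) A B M N :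
    wf_ty Γ large A -> wf_ty (Γ,,A) large B ->
    wf_tm (Γ,,A) M B -> wf_tm Γ N A ->
    eq_tm Γ (tapp A B (tlam A M) N) M⟪sone 𝟙 N⟫ B⟦sone 𝟙 N⟧
| eq_TPi_eta m (Γ : ctx m) A B M :
    wf_ty Γ large A -> wf_ty (Γ,,A) large B -> wf_tm Γ M (TPi A B) ->
    eq_tm Γ M (tlam A (tapp A⟦swk⟧ B⟦slift 𝟙 swk⟧ M⟪swk⟫ tvar)) (TPi A B)
| eq_TSig_beta1 m (Γ : ctx m) A B M N :
    wf_ty Γ large A -> wf_ty (Γ,,A) large B ->
    wf_tm Γ M A -> wf_tm Γ N B⟦sone 𝟙 M⟧ ->
    eq_tm Γ (tfst A B (tpair A B M N)) M A
| eq_TSig_beta2 m (Γ : ctx m) A B M N :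
    wf_ty Γ large A -> wf_ty (Γ,,A) large B ->
    wf_tm Γ M A -> wf_tm Γ N B⟦sone 𝟙 M⟧ ->
    eq_tm Γ (tsnd A B (tpair A B M N)) N B⟦sone 𝟙 M⟧
| eq_TSig_eta m (Γ : ctx m) A B M :
    wf_ty Γ large A -> wf_ty (Γ,,A) large B -> wf_tm Γ M (TSig A B) ->
    eq_tm Γ M (tpair A B (tfst A B M) (tsnd A B M)) (TSig A B)
| eq_reflection m (Γ : ctx m) A M N P :
    wf_ty Γ large A -> wf_tm Γ M A -> wf_tm Γ N A ->
    wf_tm Γ P (TEq A M N) -> eq_tm Γ M N A
| eq_TEq_unique m (Γ : ctx m) A M N P :
    wf_ty Γ large A -> wf_tm Γ M A -> wf_tm Γ N A ->
    wf_tm Γ P (TEq A M N) -> eq_tm Γ P (trefl M) (TEq A M N)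
| eq_tcode_El m (Γ : ctx m) M : wf_tm Γ M TU -> eq_tm Γ (tcode (TEl M)) M TU
| eq_TMod_beta n m o (Γ : ctx o) (nu : hom m o) (mu : hom n m) A C M0 M1 :
    wf_ctx Γ -> wf_ty (Γ,{nu},{mu}) large A ->
    wf_ty (Γ,[nu ∣ TMod mu A]) large C ->
    wf_tm (Γ,{nu},{mu}) M0 A ->
    wf_tm (Γ,[nu ∘ mu ∣ A]) M1 C⟦sext nu swk (tmod mu tvar)⟧ ->
    eq_tm Γ (tlet nu mu A C (tmod mu M0) M1) M1⟪sone (nu ∘ mu) M0⟫
      C⟦sone nu (tmod mu M0)⟧
| eq_tlob_unfold (Γ : ctx mt) A M :
    wf_ty Γ large A -> wf_tm Γ M (Arrow (Later A⟦key1l⟧) A) ->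
    eq_tm Γ (tlob A M)
      (tapp (Later A⟦key1l⟧) A⟦swk⟧ M (next A (tlob A M))) A
| eq_tsub_id m (Γ : ctx m) M A : wf_tm Γ M A -> eq_tm Γ M⟪sid⟫ M A
| eq_tsub_comp m (Γ Δ Θ : ctx m) M A sg tau :
    wf_sub Γ tau Δ -> wf_sub Δ sg Θ -> wf_tm Θ M A ->
    eq_tm Γ M⟪sg ⊙ tau⟫ M⟪sg⟫⟪tau⟫ A⟦sg ⊙ tau⟧
| eq_tvar_sub n m (Γ Δ : ctx m) (mu : hom n m) A sg M :
    wf_sub Γ sg Δ -> wf_ty (Δ,{mu}) large A ->
    wf_tm (Γ,{mu}) M A⟦slock sg mu⟧ ->
    eq_tm (Γ,{mu}) tvar⟪slock (sext mu sg M) mu⟫ M A⟦slock sg mu⟧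
| eq_ttrue_sub m (Γ Δ : ctx m) sg :
    wf_sub Γ sg Δ -> eq_tm Γ ttrue⟪sg⟫ ttrue TBool
| eq_tfalse_sub m (Γ Δ : ctx m) sg :
    wf_sub Γ sg Δ -> eq_tm Γ tfalse⟪sg⟫ tfalse TBool
| eq_tif_sub m (Γ Δ : ctx m) C M N b sg :
    wf_sub Γ sg Δ -> wf_ty (Δ,,TBool) large C ->
    wf_tm Δ M C⟦sone 𝟙 ttrue⟧ -> wf_tm Δ N C⟦sone 𝟙 tfalse⟧ ->
    wf_tm Δ b TBool ->
    eq_tm Γ (tif C M N b)⟪sg⟫ (tif C⟦slift 𝟙 sg⟧ M⟪sg⟫ N⟪sg⟫ b⟪sg⟫)
      C⟦sone 𝟙 b⟧⟦sg⟧
| eq_tlam_sub m (Γ Δ : ctx m) A B M sg :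
    wf_sub Γ sg Δ -> wf_ty Δ large A -> wf_ty (Δ,,A) large B ->
    wf_tm (Δ,,A) M B ->
    eq_tm Γ (tlam A M)⟪sg⟫ (tlam A⟦sg⟧ M⟪slift 𝟙 sg⟫) (TPi A B)⟦sg⟧
| eq_tapp_sub m (Γ Δ : ctx m) A B M N sg :
    wf_sub Γ sg Δ -> wf_ty Δ large A -> wf_ty (Δ,,A) large B ->
    wf_tm Δ M (TPi A B) -> wf_tm Δ N A ->
    eq_tm Γ (tapp A B M N)⟪sg⟫ (tapp A⟦sg⟧ B⟦slift 𝟙 sg⟧ M⟪sg⟫ N⟪sg⟫)
      B⟦sone 𝟙 N⟧⟦sg⟧
| eq_tpair_sub m (Γ Δ : ctx m) A B M N sg :
    wf_sub Γ sg Δ -> wf_ty Δ large A -> wf_ty (Δ,,A) large B ->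
    wf_tm Δ M A -> wf_tm Δ N B⟦sone 𝟙 M⟧ ->
    eq_tm Γ (tpair A B M N)⟪sg⟫ (tpair A⟦sg⟧ B⟦slift 𝟙 sg⟧ M⟪sg⟫ N⟪sg⟫)
      (TSig A B)⟦sg⟧
| eq_tfst_sub m (Γ Δ : ctx m) A B M sg :
    wf_sub Γ sg Δ -> wf_ty Δ large A -> wf_ty (Δ,,A) large B ->
    wf_tm Δ M (TSig A B) ->
    eq_tm Γ (tfst A B M)⟪sg⟫ (tfst A⟦sg⟧ B⟦slift 𝟙 sg⟧ M⟪sg⟫) A⟦sg⟧
| eq_tsnd_sub m (Γ Δ : ctx m) A B M sg :
    wf_sub Γ sg Δ -> wf_ty Δ large A -> wf_ty (Δ,,A) large B ->
    wf_tm Δ M (TSig A B) ->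
    eq_tm Γ (tsnd A B M)⟪sg⟫ (tsnd A⟦sg⟧ B⟦slift 𝟙 sg⟧ M⟪sg⟫)
      B⟦sone 𝟙 (tfst A B M)⟧⟦sg⟧
| eq_trefl_sub m (Γ Δ : ctx m) A M sg :
    wf_sub Γ sg Δ -> wf_ty Δ large A -> wf_tm Δ M A ->
    eq_tm Γ (trefl M)⟪sg⟫ (trefl M⟪sg⟫) (TEq A M M)⟦sg⟧
| eq_tcode_sub m (Γ Δ : ctx m) A sg :
    wf_sub Γ sg Δ -> wf_ty Δ small A ->
    eq_tm Γ (tcode A)⟪sg⟫ (tcode A⟦sg⟧) TU
| eq_tmod_sub n m (Γ Δ : ctx m) (mu : hom n m) A M sg :
    wf_sub Γ sg Δ -> wf_ty (Δ,{mu}) large A -> wf_tm (Δ,{mu}) M A ->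
    eq_tm Γ (tmod mu M)⟪sg⟫ (tmod mu M⟪slock sg mu⟫) (TMod mu A)⟦sg⟧
| eq_tlet_sub n m o (Γ Δ : ctx o) (nu : hom m o) (mu : hom n m) A C M0 M1 sg :
    wf_sub Γ sg Δ -> wf_ty (Δ,{nu},{mu}) large A ->
    wf_ty (Δ,[nu ∣ TMod mu A]) large C ->
    wf_tm (Δ,{nu}) M0 (TMod mu A) ->
    wf_tm (Δ,[nu ∘ mu ∣ A]) M1 C⟦sext nu swk (tmod mu tvar)⟧ ->
    eq_tm Γ (tlet nu mu A C M0 M1)⟪sg⟫
      (tlet nu mu A⟦slock (slock sg nu) mu⟧ C⟦slift nu sg⟧
        M0⟪slock sg nu⟫ M1⟪slift (nu ∘ mu) sg⟫)
      C⟦sone nu M0⟧⟦sg⟧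
| eq_tlob_sub (Γ Δ : ctx mt) A M sg :
    wf_sub Γ sg Δ -> wf_ty Δ large A ->
    wf_tm Δ M (Arrow (Later A⟦key1l⟧) A) ->
    eq_tm Γ (tlob A M)⟪sg⟫ (tlob A⟦sg⟧ M⟪sg⟫) A⟦sg⟧

(* [wf_sub Γ sg Δ]: [sg] is a substitution from [Γ] to [Δ] *)
with wf_sub : forall m, ctx m -> sub m -> ctx m -> Prop :=
| wf_sub_ctx m (Γ Γ' Δ Δ' : ctx m) sg :
    wf_sub Γ sg Δ -> eq_ctx Γ Γ' -> eq_ctx Δ Δ' -> wf_sub Γ' sg Δ'
| wf_sid m (Γ : ctx m) : wf_ctx Γ -> wf_sub Γ sid Γ
| wf_scomp m (Γ Δ Θ : ctx m) sg tau :
    wf_sub Γ tau Δ -> wf_sub Δ sg Θ -> wf_sub Γ (sg ⊙ tau) Θ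
| wf_sbang m (Γ : ctx m) : wf_ctx Γ -> wf_sub Γ sbang cemp
| wf_swk n m (Γ : ctx m) (mu : hom n m) A :
    wf_ctx Γ -> wf_ty (Γ,{mu}) large A -> wf_sub (Γ,[mu ∣ A]) swk Γ
| wf_sext n m (Γ Δ : ctx m) (mu : hom n m) A sg M :
    wf_sub Γ sg Δ -> wf_ty (Δ,{mu}) large A ->
    wf_tm (Γ,{mu}) M A⟦slock sg mu⟧ -> wf_sub Γ (sext mu sg M) (Δ,[mu ∣ A])
| wf_slock n m (Γ Δ : ctx m) (mu : hom n m) sg :
    wf_sub Γ sg Δ -> wf_sub (Γ,{mu}) (slock sg mu) (Δ,{mu})
| wf_skey n m (Γ : ctx m) (mu nu : hom n m) :
    wf_ctx Γ -> hle mu nu -> wf_sub (Γ,{nu}) (skey mu nu) (Γ,{mu})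

with eq_sub : forall m, ctx m -> sub m -> sub m -> ctx m -> Prop :=
| eq_sub_refl m (Γ Δ : ctx m) sg : wf_sub Γ sg Δ -> eq_sub Γ sg sg Δ
| eq_sub_sym m (Γ Δ : ctx m) sg tau : eq_sub Γ sg tau Δ -> eq_sub Γ tau sg Δ
| eq_sub_trans m (Γ Δ : ctx m) sg tau rho :
    eq_sub Γ sg tau Δ -> eq_sub Γ tau rho Δ -> eq_sub Γ sg rho Δ
| eq_sub_ctx m (Γ Γ' Δ Δ' : ctx m) sg tau :
    eq_sub Γ sg tau Δ -> eq_ctx Γ Γ' -> eq_ctx Δ Δ' -> eq_sub Γ' sg tau Δ'
| eq_scomp m (Γ Δ Θ : ctx m) sg sg' tau tau' :
    eq_sub Γ tau tau' Δ -> eq_sub Δ sg sg' Θ ->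
    eq_sub Γ (sg ⊙ tau) (sg' ⊙ tau') Θ
| eq_sext n m (Γ Δ : ctx m) (mu nu : hom n m) A sg tau M N :
    heq mu nu -> eq_sub Γ sg tau Δ -> wf_ty (Δ,{mu}) large A ->
    eq_tm (Γ,{mu}) M N A⟦slock sg mu⟧ ->
    eq_sub Γ (sext mu sg M) (sext nu tau N) (Δ,[mu ∣ A])
| eq_slock n m (Γ Δ : ctx m) (mu nu : hom n m) sg tau :
    heq mu nu -> eq_sub Γ sg tau Δ ->
    eq_sub (Γ,{mu}) (slock sg mu) (slock tau nu) (Δ,{mu})
| eq_skey n m (Γ : ctx m) (mu mu' nu nu' : hom n m) :
    wf_ctx Γ -> hle mu nu -> heq mu mu' -> heq nu nu' ->
    eq_sub (Γ,{nu}) (skey mu nu) (skey mu' nu') (Γ,{mu})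
| eq_scomp_id_l m (Γ Δ : ctx m) sg : wf_sub Γ sg Δ -> eq_sub Γ (sid ⊙ sg) sg Δ
| eq_scomp_id_r m (Γ Δ : ctx m) sg : wf_sub Γ sg Δ -> eq_sub Γ (sg ⊙ sid) sg Δ
| eq_scomp_assoc m (Γ Δ Θ Ξ : ctx m) sg tau rho :
    wf_sub Γ rho Δ -> wf_sub Δ tau Θ -> wf_sub Θ sg Ξ ->
    eq_sub Γ ((sg ⊙ tau) ⊙ rho) (sg ⊙ (tau ⊙ rho)) Ξ
| eq_sbang m (Γ : ctx m) sg : wf_sub Γ sg cemp -> eq_sub Γ sg sbang cemp
| eq_swk_sext n m (Γ Δ : ctx m) (mu : hom n m) A sg M :
    wf_sub Γ sg Δ -> wf_ty (Δ,{mu}) large A ->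
    wf_tm (Γ,{mu}) M A⟦slock sg mu⟧ ->
    eq_sub Γ (swk ⊙ sext mu sg M) sg Δ
| eq_sext_comp n m (Γ Δ Θ : ctx m) (mu : hom n m) A sg tau M :
    wf_sub Γ tau Δ -> wf_sub Δ sg Θ -> wf_ty (Θ,{mu}) large A ->
    wf_tm (Δ,{mu}) M A⟦slock sg mu⟧ ->
    eq_sub Γ (sext mu sg M ⊙ tau) (sext mu (sg ⊙ tau) M⟪slock tau mu⟫)
      (Θ,[mu ∣ A])
| eq_sext_eta n m (Γ : ctx m) (mu : hom n m) A :
    wf_ctx Γ -> wf_ty (Γ,{mu}) large A ->
    eq_sub (Γ,[mu ∣ A]) sid (sext mu swk tvar) (Γ,[mu ∣ A])
| eq_slock_sid n m (Γ : ctx m) (mu : hom n m) :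
    wf_ctx Γ -> eq_sub (Γ,{mu}) (slock sid mu) sid (Γ,{mu})
| eq_slock_scomp n m (Γ Δ Θ : ctx m) (mu : hom n m) sg tau :
    wf_sub Γ tau Δ -> wf_sub Δ sg Θ ->
    eq_sub (Γ,{mu}) (slock (sg ⊙ tau) mu) (slock sg mu ⊙ slock tau mu) (Θ,{mu})
| eq_slock_hid m (Γ Δ : ctx m) sg :
    wf_sub Γ sg Δ -> eq_sub Γ (slock sg 𝟙) sg Δ
| eq_slock_hcomp o n m (Γ Δ : ctx m) (mu : hom n m) (nu : hom o n) sg :
    wf_sub Γ sg Δ ->
    eq_sub (Γ,{mu ∘ nu}) (slock sg (mu ∘ nu)) (slock (slock sg mu) nu)
      (Δ,{mu ∘ nu})
| eq_skey_id n m (Γ : ctx m) (mu : hom n m) :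
    wf_ctx Γ -> eq_sub (Γ,{mu}) (skey mu mu) sid (Γ,{mu})
| eq_skey_vcomp n m (Γ : ctx m) (mu nu rho : hom n m) :
    wf_ctx Γ -> hle mu nu -> hle nu rho ->
    eq_sub (Γ,{rho}) (skey mu rho) (skey mu nu ⊙ skey nu rho) (Γ,{mu})
| eq_skey_hcomp o n m (Γ : ctx m) (mu nu : hom n m) (mu' nu' : hom o n) :
    wf_ctx Γ -> hle mu nu -> hle mu' nu' ->
    eq_sub (Γ,{nu ∘ nu'}) (skey (mu ∘ mu') (nu ∘ nu'))
      (slock (skey mu nu) mu' ⊙ skey mu' nu') (Γ,{mu ∘ mu'})
| eq_skey_nat n m (Γ Δ : ctx m) (mu nu : hom n m) sg :
    wf_sub Γ sg Δ -> hle mu nu ->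
    eq_sub (Γ,{nu}) (slock sg mu ⊙ skey mu nu) (skey mu nu ⊙ slock sg nu)
      (Δ,{mu}).

Fixpoint swkn m (k : nat) : sub m :=
  match k with
  | 0 => sid
  | 1 => swk
  | S k' => swkn k' ⊙ swk
  end.

(** The de Bruijn variable [k], when it and all later variables have
    modality [𝟙]. *)
Fixpoint var m (k : nat) : tm m :=
  match k with
  | 0 => tvar
  | S k' => (var k')⟪swk⟫
  end.

(** Non-dependent application, [B] being the result type in the ambient
    context. *)
Definition napp m (A B : ty m) (M N : tm m) : tm m := tapp A B⟦swk⟧ M N.

Definition Prod m (A B : ty m) : ty m := TSig A B⟦swk⟧.
Definition nfst m (A B : ty m) (M : tm m) : tm m := tfst A B⟦swk⟧ M.
Definition nsnd m (A B : ty m) (M : tm m) : tm m := tsnd A B⟦swk⟧ M.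
Definition npair m (A B : ty m) (M N : tm m) : tm m := tpair A B⟦swk⟧ M N.

(** The operation [f ⊛_mu a], for [A], [B] types in [Γ.{mu}],
    [f : ⟨mu | A -> B⟩] and [a : ⟨mu | A⟩]. *)
Definition ast n m (mu : hom n m) (A B : ty n) (f a : tm m) : tm m :=
  let w := slock swk mu in
  tlet 𝟙 mu (Arrow A B) (TMod mu B)⟦swk⟧ f
    (tlet 𝟙 mu A⟦w⟧ (TMod mu B)⟦swk⟧⟦swk⟧ a⟪swk⟫
      (tmod mu (napp A⟦w⟧⟦w⟧ B⟦w⟧⟦w⟧ tvar⟪w⟫ tvar))).

Definition cmod n m (mu : hom n m) (M : tm n) : tm m := tcode (TMod mu (TEl M)).
Definition cprod m (M N : tm m) : tm m := tcode (Prod (TEl M) (TEl N)).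

(** [Str' A] lives in [Γ] at mode [mt], for [A : U] in [Γ.{del}]. *)
Definition Str' (A : tm ms) : tm mt :=
  tlob TU
    (tlam (Later TU)
      (cprod (cmod del A⟪slock swk del⟫)
        (tlet 𝟙 ell TU TU tvar (cmod ell tvar)))).

(** [Str A] lives in [Γ] at mode [ms], for [A : U] in [Γ]; here [A] is used in
    [Γ.{gam}.{del} = Γ]. *)
Definition Str (A : tm ms) : tm ms := cmod gam (Str' A).

(** [El (Str' A)] is judgmentally [Prod (StrHd A) (StrTl A)]. *)
Definition StrHd (A : tm ms) : ty mt := TMod del (TEl A).
Definition StrTl (A : tm ms) : ty mt := Later (TEl (Str' A))⟦key1l⟧.

Definition zipTy (A B C : tm ms) : ty mt :=
  Arrow (TEl (Str' A)) (Arrow (TEl (Str' B)) (TEl (Str' C))).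

(** In [Γ] at mode [mt], for [A B C : U] in [Γ.{del}] and
    [f : ⟨del | El A -> El B -> El C⟩] in [Γ]. *)
Definition zipWith' (A B C : tm ms) (f : tm mt) : tm mt :=
  let w := swkn 3 in
  let A3 := A⟪slock w del⟫ in
  let B3 := B⟪slock w del⟫ in
  let C3 := C⟪slock w del⟫ in
  let lA := (TEl (Str' A3))⟦key1l⟧ in
  let lB := (TEl (Str' B3))⟦key1l⟧ in
  let lC := (TEl (Str' C3))⟦key1l⟧ in
  let r := var 2 in
  let x := var 1 in
  let y := var 0 in
  tlob (zipTy A B C)
    (tlam (Later (zipTy A B C)⟦key1l⟧)
      (tlam (TEl (Str' A))⟦swkn 1⟧
        (tlam (TEl (Str' B))⟦swkn 2⟧
          (npair (StrHd C3) (StrTl C3)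
            (ast del (TEl B3) (TEl C3)
              (ast del (TEl A3) (Arrow (TEl B3) (TEl C3)) f⟪w⟫
                (nfst (StrHd A3) (StrTl A3) x))
              (nfst (StrHd B3) (StrTl B3) y))
            (ast ell lB lC
              (ast ell lA (Arrow lB lC) r
                (nsnd (StrHd A3) (StrTl A3) x))
              (nsnd (StrHd B3) (StrTl B3) y)))))).

(** In [Γ] at mode [ms], for [A B C : U], [f : El A -> El B -> El C],
    [x : El (Str A)], [y : El (Str B)]; [A], [B], [C] and [f] are used in
    [Γ.{gam}.{del} = Γ]. *)
Definition zipWith (A B C f x y : tm ms) : tm ms :=
  let SA := TEl (Str' A) in
  let SB := TEl (Str' B) in
  let SC := TEl (Str' C) in
  ast gam SB SC
    (ast gam SA (Arrow SB SC) (tmod gam (zipWith' A B C (tmod del f))) x) y.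

Definition app2 m (A B f x y : tm m) : tm m :=
  napp (TEl A) (TEl B) (napp (TEl A) (Arrow (TEl A) (TEl B)) f x) y.

Definition commTy (A B f : tm ms) : ty ms :=
  let w := swkn 2 in
  TPi (TEl A) (TPi (TEl A)⟦swk⟧
    (TEq (TEl B⟪w⟫)
      (app2 A⟪w⟫ B⟪w⟫ f⟪w⟫ (var 1) (var 0))
      (app2 A⟪w⟫ B⟪w⟫ f⟪w⟫ (var 0) (var 1)))).

Definition zipCommTy (A B f : tm ms) : ty ms :=
  let w := swkn 2 in
  TPi (TEl (Str A)) (TPi (TEl (Str A))⟦swk⟧
    (TEq (TEl (Str B⟪w⟫))
      (zipWith A⟪w⟫ A⟪w⟫ B⟪w⟫ f⟪w⟫ (var 1) (var 0))
      (zipWith A⟪w⟫ A⟪w⟫ B⟪w⟫ f⟪w⟫ (var 0) (var 1)))).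

(* Main.v *)
(** The modal types have no eta rule, but a term over [⟨μ | A⟩] is still
    determined by its values on [mod_μ]: eliminate into an [Eq] type and use
    equality reflection.  Hence if [F : S -> S -> R] is commutative, so is the map
    sending [x], [y] to [(mod_μ F ⊛ x) ⊛ y].  Löb induction on
    [(x y) -> Eq (zipWith' x y) (zipWith' y x)] then needs one unfolding of
    [zipWith']: heads commute by the case μ = δ, tails by the case μ = ℓ, where the
    induction hypothesis, once opened as a variable of [T] under [ℓ], is available
    behind the lock.  The case μ = γ, with [γ ∘ δ = 1], transfers the result to
    [zipWith]. *)

Require Import Defs.

Set Implicit Arguments.
Unset Strict Implicit.

(** Substitutions are part of the syntax and never compute, so every conversion that is silent on
    paper becomes an equation between explicit substitutions whose two sides must be typed.
    Commutativity therefore occurs in two forms. [commOf] is a type, which is what Löb induction can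
    inhabit. [commutes] is a judgmental statement closed under all substitutions, which is what can
    be carried past binders, behind locks and through ⊛. Equality reflection leads from the first to
    the second; closure under substitution, used at the weakening by two variables, leads back. The
    delicate point is the hypothesis of the Löb induction. The recursive calls are compared behind
    the lock ℓ, and there a term of ▷T yields no term of T, whereas a variable annotated with ℓ
    does. As the goal is a judgmental equation, it can be read over a dummy variable of type ▷T, and
    extensionality of modal types replaces that variable by mod_ℓ of a variable annotated with ℓ. *)

(** * Equality of modalities, and proof search for the typing judgments *)

Lemma heq_refl n m (mu : hom n m) : heq mu mu.
Proof. split; apply hle_refl. Qed.

Lemma heq_sym n m (mu nu : hom n m) : heq mu nu -> heq nu mu.
Proof. intros [H K]; split; assumption. Qed.

Lemma heq_comp o n m (mu mu' : hom n m) (nu nu' : hom o n) :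
  heq mu mu' -> heq nu nu' -> heq (mu ∘ nu) (mu' ∘ nu').
Proof. intros [H K] [H' K']; split; apply hle_comp; assumption. Qed.

Lemma heq_id_l n m (mu : hom n m) : heq (𝟙 ∘ mu) mu.
Proof. split; [apply hle_id_l | apply hle_id_l']. Qed.

Lemma eq_clock_id' m (Γ : ctx m) : wf_ctx Γ -> eq_ctx Γ (Γ,{𝟙}).
Proof. intros; apply eq_ctx_sym, eq_clock_id; auto. Qed.

Lemma eq_clock_comp' o n m (Γ : ctx m) (mu : hom n m) (nu : hom o n) :
  wf_ctx Γ -> eq_ctx (Γ,{mu},{nu}) (Γ,{mu ∘ nu}).
Proof. intros; apply eq_ctx_sym, eq_clock_comp; auto. Qed.

Lemma wf_ty_to_large m (Γ : ctx m) l A : wf_ty Γ l A -> wf_ty Γ large A.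
Proof. destruct l; auto using wf_ty_large. Qed.

Lemma eq_ty_to_large m (Γ : ctx m) l A B : eq_ty Γ l A B -> eq_ty Γ large A B.
Proof. destruct l; auto using eq_ty_large. Qed.

Create HintDb mtt discriminated.
#[local] Hint Resolve heq_refl heq_comp heq_id_l hle_refl hle_ell : mtt.
#[local] Hint Immediate heq_sym : mtt.
#[local] Hint Resolve eq_ctx_refl eq_clock_id eq_clock_comp eq_clock_id' eq_clock_comp' : mtt.
#[local] Hint Immediate eq_ctx_sym : mtt.

(** [Γ,,A] is an extension with modality [𝟙], so its formation asks for [A] in [Γ,{𝟙}], which equals
    [Γ] only judgmentally. This transport recurs at every ordinary binder and is the reason for the
    [_hid] variants of later lemmas. *)
Lemma wf_Arrow m (Γ : ctx m) l A B :
  wf_ctx Γ -> wf_ty Γ l A -> wf_ty Γ l B -> wf_ty Γ l (Arrow A B).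
Proof.
  intros. assert (wf_ty (Γ,{𝟙}) large A).
  { eapply wf_ty_ctx; [eapply wf_ty_to_large; eauto|apply eq_clock_id'; auto]. }
  apply wf_TPi; auto. eapply wf_TSub; [apply wf_swk|]; auto.
Qed.

Lemma wf_Prod m (Γ : ctx m) l A B :
  wf_ctx Γ -> wf_ty Γ l A -> wf_ty Γ l B -> wf_ty Γ l (Prod A B).
Proof.
  intros. assert (wf_ty (Γ,{𝟙}) large A).
  { eapply wf_ty_ctx; [eapply wf_ty_to_large; eauto|apply eq_clock_id'; auto]. }
  apply wf_TSig; auto. eapply wf_TSub; [apply wf_swk|]; auto.
Qed.

(* The search never guesses a context or a type that is not determined by the
   subject.  The hooks are redefined as soon as further typing lemmas are proved. *)
Ltac mtt_ctx_hook := fail.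
Ltac mtt_sub_hook := fail.
Ltac mtt_ty_hook := fail.
Ltac mtt_tm_hook := fail.
Ltac mtt_ctx :=
  lazymatch goal with
  | |- wf_ctx ?Γ => tryif is_evar Γ then fail else idtac
  end;
  match goal with
  | H : wf_ctx ?Γ |- wf_ctx ?Γ => exact H
  | |- wf_ctx (clock _ _) => apply wf_clock; mtt_ctx
  | |- wf_ctx (cext _ _ _) => apply wf_cext; [mtt_ctx | mtt_ty]
  | |- wf_ctx cemp => apply wf_cemp
  | |- _ => mtt_ctx_hook
  end
with mtt_ty :=
  match goal with
  | |- wf_ty _ _ ?A => is_evar A; fail 1
  | |- _ => eassumption
  | |- _ => apply wf_ty_large; assumption
  | H : wf_ty ?Γ ?l ?A |- wf_ty ?Γ large ?A => exact (wf_ty_to_large H)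
  | |- wf_ty _ _ (TSub ?A ?s) => eapply (@wf_TSub _ _ _ _ A s); [mtt_sub | mtt_ty]
  | |- wf_ty _ _ (TSub ?A ?s) => eapply (@wf_TSub _ _ _ _ A s); [ | eassumption]; mtt_sub
  | |- wf_ty _ _ (TMod _ _) => apply wf_TMod; [mtt_ctx | mtt_ty]
  | |- wf_ty _ _ (Later _) => apply wf_TMod; [mtt_ctx | mtt_ty]
  | |- wf_ty _ _ (Arrow _ _) => apply wf_Arrow; [mtt_ctx | mtt_ty | mtt_ty]
  | |- wf_ty _ _ (Prod _ _) => apply wf_Prod; [mtt_ctx | mtt_ty | mtt_ty]
  | |- wf_ty _ _ (TPi _ _) => apply wf_TPi; mtt_ty
  | |- wf_ty _ _ (TSig _ _) => apply wf_TSig; mtt_ty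
  | |- wf_ty _ _ (TEl _) => apply wf_TEl; mtt_tm
  | |- wf_ty _ _ (TEq _ _ _) => apply wf_TEq; [mtt_ty | mtt_tm | mtt_tm]
  | |- wf_ty _ _ TBool => apply wf_TBool; mtt_ctx
  | |- wf_ty _ _ TU => apply wf_TU; mtt_ctx
  | |- _ => mtt_ty_hook
  | |- wf_ty (clock ?Γ hid) _ ?A =>
      apply (@wf_ty_ctx _ Γ); [mtt_ty | apply eq_clock_id'; mtt_ctx]
  | |- wf_ty (clock ?Γ (hcomp ?mu ?nu)) _ ?A =>
      apply (@wf_ty_ctx _ (Γ,{mu},{nu})); [mtt_ty | apply eq_clock_comp'; mtt_ctx]
  end
with mtt_tm :=
  match goal with
  | |- _ => eassumption
  | |- wf_tm _ (tsub ?M ?s) (TSub ?A ?s) => eapply (@wf_tsub _ _ _ M A s); [mtt_sub | mtt_tm]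
  | |- wf_tm _ (tsub ?M ?s) (TSub ?A ?s) =>
      eapply (@wf_tsub _ _ _ M A s); [ | eassumption]; mtt_sub
  | |- wf_tm _ (tlam _ _) (TPi _ _) => apply wf_tlam; [mtt_ty | mtt_ty | mtt_tm]
  | |- wf_tm _ (tapp _ _ _ _) _ => apply wf_tapp; [mtt_ty | mtt_ty | mtt_tm | mtt_tm]
  | |- wf_tm _ (tpair _ _ _ _) (TSig _ _) =>
      apply wf_tpair; [mtt_ty | mtt_ty | mtt_tm | mtt_tm]
  | |- wf_tm _ (tfst _ _ _) _ => eapply wf_tfst; [mtt_ty | mtt_ty | mtt_tm]
  | |- wf_tm _ (tsnd _ _ _) _ => eapply wf_tsnd; [mtt_ty | mtt_ty | mtt_tm]
  | |- wf_tm _ (tmod _ _) (TMod _ _) => apply wf_tmod; [mtt_ctx | mtt_ty | mtt_tm]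
  | |- wf_tm _ (tcode _) TU => apply wf_tcode; mtt_ty
  | |- wf_tm _ (trefl _) (TEq _ _ _) => apply wf_trefl; [mtt_ty | mtt_tm]
  | |- wf_tm _ (tlet _ _ _ _ _ _) _ =>
      apply wf_tlet; [mtt_ctx | mtt_ty | mtt_ty | mtt_tm | mtt_tm]
  | |- wf_tm _ (tlob _ _) _ => apply wf_tlob; [mtt_ty | mtt_tm]
  | |- wf_tm _ (tif _ _ _ _) _ => apply wf_tif; [mtt_ty | mtt_tm | mtt_tm | mtt_tm]
  | |- wf_tm _ ttrue TBool => apply wf_ttrue; mtt_ctx
  | |- wf_tm _ tfalse TBool => apply wf_tfalse; mtt_ctx
  | |- _ => mtt_tm_hook
  | |- wf_tm (clock ?Γ hid) ?M ?A =>
      apply (@wf_tm_ctx _ Γ); [mtt_tm | apply eq_clock_id'; mtt_ctx]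
  end
with mtt_sub :=
  match goal with
  | H : wf_sub ?Γ ?s _ |- wf_sub ?Γ ?s _ => exact H
  | |- wf_sub _ (scomp _ _) _ => eapply wf_scomp; [mtt_sub | mtt_sub]
  | |- wf_sub _ (slock _ ?mu) _ => eapply (@wf_slock _ _ _ _ mu); mtt_sub
  | |- wf_sub (cext ?Γ _ ?A) swk _ => eapply (@wf_swk _ _ Γ _ A); [mtt_ctx | mtt_ty]
  | |- wf_sub _ sid _ => apply wf_sid; mtt_ctx
  | |- wf_sub _ (skey _ _) _ => eapply wf_skey; [mtt_ctx | solve [eauto with mtt]]
  | |- wf_sub _ _ _ => mtt_sub_hook
  end.

Ltac mtt_go :=
  lazymatch goal with
  | |- wf_ctx _ => mtt_ctx
  | |- wf_ty _ _ _ => mtt_ty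
  | |- wf_tm _ _ _ => mtt_tm
  | |- wf_sub _ _ _ => first [mtt_sub | eassumption]
  | |- heq _ _ => solve [eauto with mtt]
  | |- hle _ _ => solve [eauto with mtt]
  | |- eq_ctx _ _ => solve [eauto with mtt | apply eq_ctx_refl; mtt_ctx | apply eq_clock_id; mtt_ctx
      | apply eq_clock_id'; mtt_ctx | apply eq_clock_comp; mtt_ctx | apply eq_clock_comp'; mtt_ctx
      | apply eq_clock; [mtt_go | solve [eauto with mtt]] ]
  | |- _ => first [eassumption | mtt_eq]
  end
with mtt_eq :=
  match goal with
  | |- eq_ty _ _ _ _ => first [apply eq_ty_refl; mtt_ty | apply eq_ty_sym; assumption
      | apply eq_ty_large; assumption ]
  | |- eq_tm _ _ _ _ => first [apply eq_tm_refl; mtt_tm | apply eq_tm_sym; assumption]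
  | |- eq_tm (clock ?Γ hid) _ _ _ => apply (@eq_tm_ctx _ Γ); [mtt_go | apply eq_clock_id'; mtt_ctx]
  | |- eq_ty (clock ?Γ hid) _ _ _ => apply (@eq_ty_ctx _ Γ); [mtt_go | apply eq_clock_id'; mtt_ctx]
  | |- eq_sub _ _ _ _ => first [apply eq_sub_refl; mtt_sub | apply eq_sub_sym; assumption]
  end.
Ltac mtt := try solve [intros; mtt_go].

(** * Substitution calculus: locks, variables, extensions and liftings *)

Lemma eq_ty_lock_hid m (Γ : ctx m) l A B :
  wf_ctx Γ -> eq_ty Γ l A B -> eq_ty (Γ,{𝟙}) l A B.
Proof. intros; eapply eq_ty_ctx; mtt. Qed.

Lemma wf_tm_lock_hid m (Γ : ctx m) M A : wf_ctx Γ -> wf_tm Γ M A -> wf_tm (Γ,{𝟙}) M A.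
Proof. intros; eapply wf_tm_ctx; mtt. Qed.

Lemma eq_tm_lock_hid m (Γ : ctx m) M N A :
  wf_ctx Γ -> eq_tm Γ M N A -> eq_tm (Γ,{𝟙}) M N A.
Proof. intros; eapply eq_tm_ctx; mtt. Qed.

Lemma wf_swk_hid m (Γ : ctx m) A :
  wf_ctx Γ -> wf_ty Γ large A -> wf_sub (Γ,,A) swk Γ.
Proof. mtt. Qed.

Lemma eq_TSub_sub m (Γ Δ : ctx m) l A sg tau :
  eq_sub Γ sg tau Δ -> wf_ty Δ l A -> eq_ty Γ l A⟦sg⟧ A⟦tau⟧.
Proof. intros; eapply eq_TSub; mtt. Qed.

Lemma eq_TSub_ty m (Γ Δ : ctx m) l A B sg :
  wf_sub Γ sg Δ -> eq_ty Δ l A B -> eq_ty Γ l A⟦sg⟧ B⟦sg⟧.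
Proof. intros; eapply eq_TSub; mtt. Qed.

Lemma TSub_comp_eq m (Γ Δ Θ : ctx m) l A sg tau rho :
  wf_sub Γ tau Δ -> wf_sub Δ sg Θ -> eq_sub Γ (sg ⊙ tau) rho Θ -> wf_ty Θ l A ->
  eq_ty Γ l A⟦sg⟧⟦tau⟧ A⟦rho⟧.
Proof.
  intros; eapply eq_ty_trans; [apply eq_ty_sym; eapply eq_TSub_comp; eauto|].
  eapply eq_TSub_sub; eauto.
Qed.

Lemma TSub_comp_eq2 m (Γ Δ Δ' Θ : ctx m) l A sg tau sg' tau' :
  wf_sub Γ tau Δ -> wf_sub Δ sg Θ -> wf_sub Γ tau' Δ' -> wf_sub Δ' sg' Θ ->
  eq_sub Γ (sg ⊙ tau) (sg' ⊙ tau') Θ -> wf_ty Θ l A ->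
  eq_ty Γ l A⟦sg⟧⟦tau⟧ A⟦sg'⟧⟦tau'⟧.
Proof.
  intros; eapply eq_ty_trans; [eapply TSub_comp_eq; eauto|].
  eapply eq_TSub_comp; eauto.
Qed.

Lemma tsub_comp_eq m (Γ Δ Θ : ctx m) M A sg tau rho :
  wf_sub Γ tau Δ -> wf_sub Δ sg Θ -> eq_sub Γ (sg ⊙ tau) rho Θ ->
  wf_ty Θ large A -> wf_tm Θ M A ->
  eq_tm Γ M⟪sg⟫⟪tau⟫ M⟪rho⟫ A⟦rho⟧.
Proof.
  intros; eapply eq_tm_conv; [|eapply eq_TSub_sub; eauto].
  eapply eq_tm_trans; [apply eq_tm_sym; eapply eq_tsub_comp; eauto|].
  eapply eq_tsub; mtt.
Qed.

Lemma TSub_slock_hid m (Γ Δ : ctx m) l A sg :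
  wf_sub Γ sg Δ -> wf_ty Δ l A -> eq_ty Γ l A⟦slock sg 𝟙⟧ A⟦sg⟧.
Proof. intros; eapply eq_TSub_sub; eauto using eq_slock_hid. Qed.

Lemma TSub_slock_sid n m (Γ : ctx m) l (mu : hom n m) A :
  wf_ctx Γ -> wf_ty (Γ,{mu}) l A -> eq_ty (Γ,{mu}) l A⟦slock sid mu⟧ A.
Proof.
  intros; eapply eq_ty_trans; [eapply eq_TSub_sub; eauto using eq_slock_sid|].
  apply eq_TSub_id; auto.
Qed.

Lemma TSub_slock_comp n m (Γ Δ Θ : ctx m) l (mu : hom n m) A sg tau :
  wf_sub Γ tau Δ -> wf_sub Δ sg Θ -> wf_ty (Θ,{mu}) l A ->
  eq_ty (Γ,{mu}) l A⟦slock (sg ⊙ tau) mu⟧ A⟦slock sg mu⟧⟦slock tau mu⟧.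
Proof.
  intros; apply eq_ty_sym; eapply TSub_comp_eq; mtt.
  apply eq_sub_sym; eapply eq_slock_scomp; eauto.
Qed.

Lemma wf_var0 m (Γ : ctx m) A :
  wf_ctx Γ -> wf_ty Γ large A -> wf_tm (Γ,,A) tvar A⟦swk⟧.
Proof.
  intros; eapply wf_tm_conv; [|eapply TSub_slock_hid; mtt].
  eapply wf_tm_ctx; [eapply wf_tvar; mtt|mtt].
  all: mtt.
Qed.

Lemma wf_sext_hid m (Γ Δ : ctx m) A sg M :
  wf_ctx Γ -> wf_ctx Δ ->
  wf_sub Γ sg Δ -> wf_ty Δ large A -> wf_tm Γ M A⟦sg⟧ ->
  wf_sub Γ (sext 𝟙 sg M) (Δ,,A).
Proof.
  intros; apply wf_sext; auto; mtt.
  apply wf_tm_lock_hid; auto.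
  eapply wf_tm_conv; [eauto|]. apply eq_ty_sym. eapply TSub_slock_hid; eauto.
Qed.

Lemma eq_sext_hid m (Γ Δ : ctx m) A sg tau M N :
  wf_ctx Γ -> wf_ctx Δ -> wf_sub Γ sg Δ ->
  eq_sub Γ sg tau Δ -> wf_ty Δ large A -> eq_tm Γ M N A⟦sg⟧ ->
  eq_sub Γ (sext 𝟙 sg M) (sext 𝟙 tau N) (Δ,,A).
Proof.
  intros; apply eq_sext; auto; mtt.
  apply eq_tm_lock_hid; auto.
  eapply eq_tm_conv; [eauto|]. apply eq_ty_sym. eapply TSub_slock_hid; eauto.
Qed.

(** [eq_tvar_sub] computes the variable only under a lock. For modality [𝟙] the lock can be erased
    by [eq_slock_hid], on the substitution as well as in the type, and the unlocked form results. *)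
Lemma var0_sext m (Γ Δ : ctx m) A sg M :
  wf_ctx Γ -> wf_ctx Δ ->
  wf_sub Γ sg Δ -> wf_ty Δ large A -> wf_tm Γ M A⟦sg⟧ ->
  eq_tm Γ tvar⟪sext 𝟙 sg M⟫ M A⟦sg⟧.
Proof.
  intros. assert (wf_sub Γ (sext 𝟙 sg M) (Δ,,A)) by (apply wf_sext_hid; auto).
  eapply eq_tm_trans.
  - eapply eq_tm_conv; [eapply eq_tsub; [apply eq_sub_sym; eapply eq_slock_hid; eauto
      |apply eq_tm_refl, wf_var0; auto]|].
    eapply TSub_comp_eq; [|eapply wf_swk_hid| |]; mtt.
    eapply eq_swk_sext with (A := A); auto; mtt.
      apply wf_tm_lock_hid; auto.
      eapply wf_tm_conv; [eauto|]. apply eq_ty_sym. eapply TSub_slock_hid; eauto.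
  - eapply eq_tm_conv; [|eapply TSub_slock_hid; eauto].
    eapply eq_tm_ctx; [eapply eq_tvar_sub|]; mtt.
    apply wf_tm_lock_hid; auto.
    eapply wf_tm_conv; [eauto|]. apply eq_ty_sym. eapply TSub_slock_hid; eauto.
Qed.

Lemma swk_sext_hid m (Γ Δ : ctx m) A sg M :
  wf_ctx Γ -> wf_ctx Δ ->
  wf_sub Γ sg Δ -> wf_ty Δ large A -> wf_tm Γ M A⟦sg⟧ ->
  eq_sub Γ (swk ⊙ sext 𝟙 sg M) sg Δ.
Proof.
  intros; eapply eq_swk_sext with (A := A); auto; mtt.
  apply wf_tm_lock_hid; auto.
  eapply wf_tm_conv; [eauto|]. apply eq_ty_sym. eapply TSub_slock_hid; eauto.
Qed.

Lemma wf_sone n m (Γ : ctx m) (mu : hom n m) A M :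
  wf_ctx Γ -> wf_ty (Γ,{mu}) large A -> wf_tm (Γ,{mu}) M A ->
  wf_sub Γ (sone mu M) (Γ,[mu ∣ A]).
Proof.
  intros; apply wf_sext; mtt. eapply wf_tm_conv; [eauto|].
  apply eq_ty_sym, TSub_slock_sid; auto.
Qed.

Lemma eq_sone n m (Γ : ctx m) (mu mu' : hom n m) A M M' :
  wf_ctx Γ -> heq mu mu' -> wf_ty (Γ,{mu}) large A -> eq_tm (Γ,{mu}) M M' A ->
  eq_sub Γ (sone mu M) (sone mu' M') (Γ,[mu ∣ A]).
Proof.
  intros; apply eq_sext; mtt. eapply eq_tm_conv; [eauto|].
  apply eq_ty_sym, TSub_slock_sid; auto.
Qed.

Lemma wf_sone_hid m (Γ : ctx m) A M :
  wf_ctx Γ -> wf_ty Γ large A -> wf_tm Γ M A -> wf_sub Γ (sone 𝟙 M) (Γ,,A).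
Proof. intros; apply wf_sone; auto; mtt. Qed.

Lemma eq_sone_hid m (Γ : ctx m) A M M' :
  wf_ctx Γ -> wf_ty Γ large A -> eq_tm Γ M M' A ->
  eq_sub Γ (sone 𝟙 M) (sone 𝟙 M') (Γ,,A).
Proof. intros; apply eq_sone; auto; mtt. Qed.

Ltac mtt_sub_hook ::=
  match goal with
  | |- wf_sub _ (sone hid _) (cext ?Γ hid ?A) =>
      apply (@wf_sone_hid _ Γ A); [mtt_ctx | mtt_ty | mtt_tm]
  | |- wf_sub _ (sone ?mu _) (cext ?Γ _ ?A) =>
      apply (@wf_sone _ _ Γ mu A); [mtt_ctx | mtt_ty | mtt_tm]
  | |- wf_sub _ (sext hid ?s ?M) (cext ?Δ hid ?A) =>
      apply (@wf_sext_hid _ _ Δ A s M); [mtt_ctx | mtt_ctx | mtt_sub | mtt_ty | mtt_tm]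
  end.

Lemma wf_slift n m (Γ Δ : ctx m) (mu : hom n m) A sg :
  wf_ctx Γ -> wf_ctx Δ -> wf_sub Γ sg Δ -> wf_ty (Δ,{mu}) large A ->
  wf_sub (Γ,[mu ∣ A⟦slock sg mu⟧]) (slift mu sg) (Δ,[mu ∣ A]).
Proof.
  intros; apply wf_sext; mtt. eapply wf_tm_conv; [eapply wf_tvar; mtt|].
  apply eq_ty_sym; eapply TSub_slock_comp; mtt.
Qed.

Lemma wf_slift_hid m (Γ Δ : ctx m) A sg :
  wf_ctx Γ -> wf_ctx Δ -> wf_sub Γ sg Δ -> wf_ty Δ large A ->
  wf_sub (Γ,,A⟦sg⟧) (slift 𝟙 sg) (Δ,,A).
Proof.
  intros; eapply wf_sub_ctx; [eapply wf_slift with (Γ := Γ) (Δ := Δ) (A := A); mtt| |mtt].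
  apply eq_cext; mtt. apply eq_ty_lock_hid; auto. eapply TSub_slock_hid; eauto.
Qed.

Ltac mtt_sub_hook ::=
  match goal with
  | |- wf_sub _ (sone hid _) (cext ?Γ hid ?A) =>
      apply (@wf_sone_hid _ Γ A); [mtt_ctx | mtt_ty | mtt_tm]
  | |- wf_sub _ (sone ?mu _) (cext ?Γ _ ?A) =>
      apply (@wf_sone _ _ Γ mu A); [mtt_ctx | mtt_ty | mtt_tm]
  | |- wf_sub (cext _ _ (TSub ?A ?s)) (slift hid ?s) _ =>
      eapply (@wf_slift_hid _ _ _ A s); [mtt_ctx | | mtt_sub | mtt_ty]; mtt_ctx
  | |- wf_sub (cext _ _ (TSub ?A (slock ?s ?mu))) (slift ?mu ?s) _ =>
      eapply (@wf_slift _ _ _ _ mu A s); [mtt_ctx | | mtt_sub | mtt_ty]; mtt_ctx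
  | |- wf_sub _ (sext hid ?s ?M) (cext ?Δ hid ?A) =>
      apply (@wf_sext_hid _ _ Δ A s M); [mtt_ctx | mtt_ctx | mtt_sub | mtt_ty | mtt_tm]
  end.

Lemma sone_comp n m (Γ Δ : ctx m) (mu : hom n m) A M sg :
  wf_ctx Γ -> wf_ctx Δ -> wf_sub Γ sg Δ -> wf_ty (Δ,{mu}) large A ->
  wf_tm (Δ,{mu}) M A ->
  eq_sub Γ (sone mu M ⊙ sg) (sext mu sg M⟪slock sg mu⟫) (Δ,[mu ∣ A]).
Proof.
  intros. assert (wf_tm (Δ,{mu}) M A⟦slock sid mu⟧).
  { eapply wf_tm_conv; [eauto|]. apply eq_ty_sym, TSub_slock_sid; auto. }
  eapply eq_sub_trans; [eapply eq_sext_comp; mtt|].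
  eapply eq_sext; mtt. { eapply eq_scomp_id_l; auto. }
  apply eq_tm_refl. eapply wf_tm_conv; [eapply wf_tsub; mtt|].
  apply eq_ty_sym. eapply TSub_slock_comp; mtt.
Qed.

(** Every instantiation of a lifted substitution is a case of this composite: [tau = sid] gives
    [slift_sone], and [tau = swk] gives the naturality of [smodv]. *)
Lemma slift_sext n m (Γ Δ Θ : ctx m) (mu : hom n m) A M sg tau :
  wf_ctx Γ -> wf_ctx Δ -> wf_ctx Θ ->
  wf_sub Γ tau Δ -> wf_sub Δ sg Θ -> wf_ty (Θ,{mu}) large A ->
  wf_tm (Γ,{mu}) M A⟦slock sg mu⟧⟦slock tau mu⟧ ->
  eq_sub Γ (slift mu sg ⊙ sext mu tau M) (sext mu (sg ⊙ tau) M) (Θ,[mu ∣ A]).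
Proof.
  intros.
  assert (wf_ty (Δ,{mu}) large A⟦slock sg mu⟧) by mtt.
  assert (wf_sub Γ (sext mu tau M) (Δ,[mu ∣ A⟦slock sg mu⟧])) by (apply wf_sext; auto).
  assert (eq_sub Γ (swk ⊙ sext mu tau M) tau Δ) by (eapply eq_swk_sext; eauto).
  assert (E : eq_sub Γ (sg ⊙ swk ⊙ sext mu tau M) (sg ⊙ tau) Θ).
  { eapply eq_sub_trans; [eapply eq_scomp_assoc; mtt|]. eapply eq_scomp; mtt. }
  eapply eq_sub_trans; [eapply eq_sext_comp; mtt|].
  - eapply wf_tm_conv; [eapply wf_tvar; mtt|].
    apply eq_ty_sym; eapply TSub_slock_comp; mtt.
  - eapply eq_sext; mtt. eapply eq_tm_conv; [eapply eq_tvar_sub; mtt; mtt|].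
    eapply eq_ty_trans; [apply eq_ty_sym; eapply TSub_slock_comp; mtt|].
    eapply eq_TSub_sub; mtt. eapply eq_slock; mtt.
Qed.

Lemma slift_sone n m (Γ Δ : ctx m) (mu : hom n m) A M sg :
  wf_ctx Γ -> wf_ctx Δ -> wf_sub Γ sg Δ -> wf_ty (Δ,{mu}) large A ->
  wf_tm (Γ,{mu}) M A⟦slock sg mu⟧ ->
  eq_sub Γ (slift mu sg ⊙ sone mu M) (sext mu sg M) (Δ,[mu ∣ A]).
Proof.
  intros. assert (wf_ty (Γ,{mu}) large A⟦slock sg mu⟧) by mtt.
  eapply eq_sub_trans; [eapply slift_sext with (Δ := Γ); mtt|].
  - eapply wf_tm_conv; [eauto|]. apply eq_ty_sym, TSub_slock_sid; auto.
  - apply eq_sub_sym. eapply eq_sext; mtt. apply eq_sub_sym, eq_scomp_id_r; auto.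
Qed.

(** Both sides equal [sext mu sg M⟪slock sg mu⟫]. This is the equation behind substitution into an
    instantiated codomain or motive. *)
Lemma sone_slift n m (Γ Δ : ctx m) (mu : hom n m) A M sg :
  wf_ctx Γ -> wf_ctx Δ -> wf_sub Γ sg Δ -> wf_ty (Δ,{mu}) large A ->
  wf_tm (Δ,{mu}) M A ->
  eq_sub Γ (slift mu sg ⊙ sone mu M⟪slock sg mu⟫) (sone mu M ⊙ sg) (Δ,[mu ∣ A]).
Proof.
  intros. eapply eq_sub_trans; [eapply slift_sone; mtt|].
  apply eq_sub_sym, sone_comp; auto.
Qed.

Lemma tm_slock_hid m (Γ Δ : ctx m) A M sg :
  wf_sub Γ sg Δ -> wf_tm Δ M A -> wf_ty Δ large A ->
  eq_tm Γ M⟪slock sg 𝟙⟫ M⟪sg⟫ A⟦sg⟧.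
Proof.
  intros; eapply eq_tm_conv; [|eapply TSub_slock_hid; eauto].
  eapply eq_tsub; mtt. eapply eq_slock_hid; auto.
Qed.

Lemma sone_slift_hid m (Γ Δ : ctx m) A M sg :
  wf_ctx Γ -> wf_ctx Δ -> wf_sub Γ sg Δ -> wf_ty Δ large A -> wf_tm Δ M A ->
  eq_sub Γ (slift 𝟙 sg ⊙ sone 𝟙 M⟪sg⟫) (sone 𝟙 M ⊙ sg) (Δ,,A).
Proof.
  intros. eapply eq_sub_trans; [|eapply sone_slift; mtt].
  eapply eq_scomp; [|apply eq_sub_refl; mtt]. apply eq_sub_sym.
  eapply eq_sone_hid with (A := A⟦sg⟧); mtt. eapply tm_slock_hid; eauto. all: mtt.
Qed.

Lemma swk_sone n m (Γ : ctx m) (mu : hom n m) A M :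
  wf_ctx Γ -> wf_ty (Γ,{mu}) large A -> wf_tm (Γ,{mu}) M A ->
  eq_sub Γ (swk ⊙ sone mu M) sid Γ.
Proof.
  intros; eapply eq_swk_sext with (A := A); mtt. eapply wf_tm_conv; [eauto|].
  apply eq_ty_sym, TSub_slock_sid; auto.
Qed.

Lemma TSub_swk_sone m (Γ : ctx m) l A B M :
  wf_ctx Γ -> wf_ty Γ large A -> wf_tm Γ M A -> wf_ty Γ l B ->
  eq_ty Γ l B⟦swk⟧⟦sone 𝟙 M⟧ B.
Proof.
  intros. eapply eq_ty_trans; [eapply TSub_comp_eq with (Δ := Γ,,A); [| |eapply swk_sone with (A := A)| ]; mtt|].
  apply eq_TSub_id; auto.
Qed.

Lemma swk_slift n m (Γ Δ : ctx m) (mu : hom n m) A sg :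
  wf_ctx Γ -> wf_ctx Δ -> wf_sub Γ sg Δ -> wf_ty (Δ,{mu}) large A ->
  eq_sub (Γ,[mu ∣ A⟦slock sg mu⟧]) (swk ⊙ slift mu sg) (sg ⊙ swk) Δ.
Proof.
  intros; eapply eq_swk_sext with (A := A); mtt. eapply wf_tm_conv; [eapply wf_tvar; mtt|].
  apply eq_ty_sym; eapply TSub_slock_comp; mtt.
Qed.

Lemma swk_slift_hid m (Γ Δ : ctx m) A sg :
  wf_ctx Γ -> wf_ctx Δ -> wf_sub Γ sg Δ -> wf_ty Δ large A ->
  eq_sub (Γ,,A⟦sg⟧) (swk ⊙ slift 𝟙 sg) (sg ⊙ swk) Δ.
Proof.
  intros; eapply eq_sub_ctx; [eapply swk_slift with (Γ := Γ) (Δ := Δ) (A := A); mtt| |mtt].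
  apply eq_cext; mtt. apply eq_ty_lock_hid; auto. eapply TSub_slock_hid; eauto.
Qed.

Lemma TSub_swk_slift m (Γ Δ : ctx m) l A B sg :
  wf_ctx Γ -> wf_ctx Δ -> wf_sub Γ sg Δ -> wf_ty Δ large A -> wf_ty Δ l B ->
  eq_ty (Γ,,A⟦sg⟧) l B⟦swk⟧⟦slift 𝟙 sg⟧ B⟦sg⟧⟦swk⟧.
Proof. intros; eapply TSub_comp_eq2; [| | | |eapply swk_slift_hid with (A := A)| ]; mtt. Qed.

(** [slift_sone] turns the composite into [sext 𝟙 swk tvar], which is the identity by [eq_sext_eta].
    Needed to type the η-expansion of a function. *)
Lemma slift_swk_sone_var m (Γ : ctx m) A :
  wf_ctx Γ -> wf_ty Γ large A ->
  eq_sub (Γ,,A) (slift 𝟙 swk ⊙ sone 𝟙 tvar) sid (Γ,,A).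
Proof.
  intros. eapply eq_sub_trans; [eapply slift_sone; mtt|].
  - eapply wf_tvar; mtt.
  - apply eq_sub_sym, eq_sext_eta; mtt.
Qed.

(** * Substitutions into contexts extended by a modal type *)

(** The substitution x ↦ mod_mu(x) from [Γ,[nu ∘ mu ∣ A]] to [Γ,[nu ∣ TMod mu A]], along which the
    motive of [tlet] is pulled back in its branch. *)
Notation smodv nu mu := (sext nu swk (tmod mu tvar)).

Lemma wf_tm_lock_comp o n m (Γ : ctx m) (mu : hom n m) (nu : hom o n) M A :
  wf_ctx Γ -> wf_tm (Γ,{mu},{nu}) M A -> wf_tm (Γ,{mu ∘ nu}) M A.
Proof. intros; eapply wf_tm_ctx; mtt. Qed.

Lemma wf_tm_lock_comp' o n m (Γ : ctx m) (mu : hom n m) (nu : hom o n) M A :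
  wf_ctx Γ -> wf_tm (Γ,{mu ∘ nu}) M A -> wf_tm (Γ,{mu},{nu}) M A.
Proof. intros; eapply wf_tm_ctx; mtt. Qed.

Lemma eq_tm_lock_comp' o n m (Γ : ctx m) (mu : hom n m) (nu : hom o n) M N A :
  wf_ctx Γ -> eq_tm (Γ,{mu ∘ nu}) M N A -> eq_tm (Γ,{mu},{nu}) M N A.
Proof. intros; eapply eq_tm_ctx; mtt. Qed.

Lemma TSub_slock_hcomp o n m (Γ Δ : ctx m) l (mu : hom n m) (nu : hom o n) A sg :
  wf_sub Γ sg Δ -> wf_ctx Γ -> wf_ctx Δ -> wf_ty (Δ,{mu},{nu}) l A ->
  eq_ty (Γ,{mu ∘ nu}) l A⟦slock sg (mu ∘ nu)⟧ A⟦slock (slock sg mu) nu⟧.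
Proof. intros; eapply eq_TSub_sub; [eapply eq_slock_hcomp; eauto|]; mtt. Qed.

Lemma wf_tmod_slock o n m (Γ Δ : ctx m) (nu : hom n m) (mu : hom o n) A sg M :
  wf_sub Γ sg Δ -> wf_ctx Γ -> wf_ctx Δ -> wf_ty (Δ,{nu},{mu}) large A ->
  wf_tm (Γ,{nu ∘ mu}) M A⟦slock sg (nu ∘ mu)⟧ ->
  wf_tm (Γ,{nu}) (tmod mu M) (TMod mu A)⟦slock sg nu⟧.
Proof.
  intros. eapply wf_tm_conv; [|apply eq_ty_sym; eapply eq_TMod_sub; mtt].
  apply wf_tmod; mtt. apply wf_tm_lock_comp'; auto.
  eapply wf_tm_conv; [eauto|]. eapply TSub_slock_hcomp; eauto.
Qed.

Lemma wf_smodv o n m (Γ : ctx m) (nu : hom n m) (mu : hom o n) A :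
  wf_ctx Γ -> wf_ty (Γ,{nu},{mu}) large A ->
  wf_sub (Γ,[nu ∘ mu ∣ A]) (smodv nu mu) (Γ,[nu ∣ TMod mu A]).
Proof.
  intros. apply wf_sext; mtt.
  eapply wf_tmod_slock; mtt. eapply wf_tvar; mtt.
Qed.

(** [smodv_sone] and [TSub_slift_smodv], which type the β and substitution rules of [tlet], both
    rest on this composite. Its last entry is computed by the substitution law of [tmod] followed by
    that of the variable, with the lock of [nu ∘ mu] repeatedly traded for two successive locks. *)
Lemma smodv_sext o n m (Γ Δ : ctx m) (nu : hom n m) (mu : hom o n) A sg M :
  wf_sub Γ sg Δ -> wf_ctx Γ -> wf_ctx Δ -> wf_ty (Δ,{nu},{mu}) large A ->
  wf_tm (Γ,{nu ∘ mu}) M A⟦slock sg (nu ∘ mu)⟧ ->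
  eq_sub Γ (smodv nu mu ⊙ sext (nu ∘ mu) sg M) (sext nu sg (tmod mu M))
    (Δ,[nu ∣ TMod mu A]).
Proof.
  intros.
  assert (W : wf_sub Γ (sext (nu ∘ mu) sg M) (Δ,[nu ∘ mu ∣ A])) by (apply wf_sext; mtt).
  assert (Wm : wf_tm (Δ,[nu ∘ mu ∣ A],{nu}) (tmod mu tvar) (TMod mu A)⟦slock swk nu⟧).
  { eapply wf_tmod_slock; mtt. eapply wf_tvar; mtt. }
  assert (Wt : wf_ty (Δ,{nu ∘ mu}) large A) by mtt.
  assert (E : eq_sub Γ (swk ⊙ sext (nu ∘ mu) sg M) sg Δ) by (eapply eq_swk_sext; eauto).
  assert (Wv : wf_tm (Δ,[nu ∘ mu ∣ A],{nu ∘ mu}) tvar A⟦slock swk (nu ∘ mu)⟧).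
  { eapply wf_tvar; auto. }
  assert (wf_sub (Δ,[nu ∘ mu ∣ A]) swk Δ) by (eapply wf_swk; mtt).
  assert (Wv' : wf_tm (Δ,[nu ∘ mu ∣ A],{nu},{mu}) tvar A⟦slock (slock swk nu) mu⟧).
  { apply wf_tm_lock_comp'; mtt. eapply wf_tm_conv; [eauto|].
    eapply TSub_slock_hcomp; mtt. }
  eapply eq_sub_trans; [eapply eq_sext_comp; mtt|].
  eapply eq_sext; mtt.
  assert (T : eq_ty (Γ,{nu}) large (TMod mu A)⟦slock swk nu⟧⟦slock (sext (nu ∘ mu) sg M) nu⟧
    (TMod mu A)⟦slock (swk ⊙ sext (nu ∘ mu) sg M) nu⟧).
  { apply eq_ty_sym; eapply TSub_slock_comp; mtt. }
  eapply eq_tm_conv; [|exact T].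
  assert (TM : eq_ty (Δ,[nu ∘ mu ∣ A],{nu}) large (TMod mu A)⟦slock swk nu⟧
     (TMod mu A⟦slock (slock swk nu) mu⟧)) by (eapply eq_TMod_sub; mtt).
  assert (eq_ty (Γ,{nu ∘ mu}) large
     A⟦slock swk (nu ∘ mu)⟧⟦slock (sext (nu ∘ mu) sg M) (nu ∘ mu)⟧ A⟦slock sg (nu ∘ mu)⟧).
  { eapply TSub_comp_eq; mtt.
    eapply eq_sub_trans; [apply eq_sub_sym; eapply eq_slock_scomp; mtt|].
    eapply eq_slock; mtt. }
  assert (eq_ty (Γ,{nu},{mu}) large A⟦slock (slock swk nu) mu⟧⟦slock (slock (sext (nu ∘ mu) sg M) nu) mu⟧
     A⟦slock (slock sg nu) mu⟧).
  { eapply TSub_comp_eq; mtt.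
    eapply eq_sub_trans; [apply eq_sub_sym; eapply eq_slock_scomp; mtt|].
    eapply eq_slock; mtt.
    eapply eq_sub_trans; [apply eq_sub_sym; eapply eq_slock_scomp; mtt|].
    eapply eq_slock; mtt. }
  eapply eq_tm_conv; [|apply eq_ty_sym; eapply eq_TSub_ty; mtt].
  eapply eq_tm_trans; [eapply eq_tm_conv; [eapply eq_tsub; [apply eq_sub_refl; mtt|]|]|].
  1: { eapply eq_tm_refl, wf_tm_conv; [exact Wm|exact TM]. }
  1: { apply eq_ty_refl; mtt. }
  eapply eq_tm_trans; [eapply eq_tmod_sub; mtt|].
  eapply eq_tm_conv; [|apply eq_ty_sym; eapply eq_TMod_sub; mtt].
  eapply eq_tmod; mtt.
  apply eq_tm_lock_comp'; auto.
  eapply eq_tm_conv with (A := A⟦slock (slock sg nu) mu⟧);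
    [|apply eq_ty_sym; eapply eq_ty_ctx; [exact H6|mtt]].
  (* [eq_tvar_sub] applies only under a single lock, so the nested locks are first fused into the
     lock of [nu ∘ mu]. *)
  eapply eq_tm_trans with (N := tvar⟪slock (sext (nu ∘ mu) sg M) (nu ∘ mu)⟫).
  - apply eq_tm_sym. eapply eq_tm_conv; [|eapply TSub_slock_hcomp with (sg := sg) (Δ := Δ); mtt].
    eapply eq_tm_conv; [|eassumption].
    eapply eq_tsub; [eapply eq_slock_hcomp; eauto|mtt].
  - eapply eq_tm_conv; [eapply eq_tvar_sub; mtt; mtt|].
    eapply TSub_slock_hcomp; mtt.
Qed.

Lemma smodv_sone o n m (Γ : ctx m) (nu : hom n m) (mu : hom o n) A M :
  wf_ctx Γ -> wf_ty (Γ,{nu},{mu}) large A -> wf_tm (Γ,{nu},{mu}) M A ->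
  eq_sub Γ (smodv nu mu ⊙ sone (nu ∘ mu) M) (sone nu (tmod mu M))
    (Γ,[nu ∣ TMod mu A]).
Proof.
  intros; eapply smodv_sext; mtt.
  eapply wf_tm_conv; [apply wf_tm_lock_comp; eauto|].
  apply eq_ty_sym, TSub_slock_sid; mtt.
Qed.

(** * The key for 1 ≤ ℓ and substitution into [Later] *)

Lemma wf_key1l (Γ : ctx mt) : wf_ctx Γ -> wf_sub (Γ,{ell}) key1l Γ.
Proof. intros; eapply wf_sub_ctx; [apply wf_skey| |]; mtt. all: mtt. Qed.

(** Naturality of the 2-cell 1 ≤ ℓ, with the lock by [𝟙] that [eq_skey_nat] puts on [sg] erased. *)
Lemma key1l_nat (Γ Δ : ctx mt) sg :
  wf_sub Γ sg Δ -> wf_ctx Γ -> wf_ctx Δ ->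
  eq_sub (Γ,{ell}) (sg ⊙ key1l) (key1l ⊙ slock sg ell) Δ.
Proof.
  intros. eapply eq_sub_trans with (tau := slock sg 𝟙 ⊙ key1l).
  - eapply eq_scomp; [apply eq_sub_refl, wf_key1l; auto|].
    apply eq_sub_sym, eq_slock_hid; auto.
  - eapply eq_sub_ctx; [apply eq_skey_nat; [eauto|apply hle_ell]| |]; mtt.
Qed.

Lemma TSub_key1l (Γ Δ : ctx mt) l A sg :
  wf_sub Γ sg Δ -> wf_ctx Γ -> wf_ctx Δ -> wf_ty Δ l A ->
  eq_ty (Γ,{ell}) l A⟦sg⟧⟦key1l⟧ A⟦key1l⟧⟦slock sg ell⟧.
Proof.
  intros; eapply TSub_comp_eq2; [apply wf_key1l| | |apply wf_key1l|apply key1l_nat|]; mtt.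
Qed.

Ltac mtt_sub_hook ::=
  match goal with
  | |- wf_sub (clock ?Γ ell) key1l _ => apply wf_key1l; mtt_ctx
  | |- wf_sub _ (sone hid _) (cext ?Γ hid ?A) =>
      apply (@wf_sone_hid _ Γ A); [mtt_ctx | mtt_ty | mtt_tm]
  | |- wf_sub _ (sone ?mu _) (cext ?Γ _ ?A) =>
      apply (@wf_sone _ _ Γ mu A); [mtt_ctx | mtt_ty | mtt_tm]
  | |- wf_sub (cext _ _ (TSub ?A ?s)) (slift hid ?s) _ =>
      eapply (@wf_slift_hid _ _ _ A s); [mtt_ctx | | mtt_sub | mtt_ty]; mtt_ctx
  | |- wf_sub (cext _ _ (TSub ?A (slock ?s ?mu))) (slift ?mu ?s) _ =>
      eapply (@wf_slift _ _ _ _ mu A s); [mtt_ctx | | mtt_sub | mtt_ty]; mtt_ctx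
  | |- wf_sub (cext ?Γ _ ?A) (sext ?nu swk (tmod ?mu tvar)) _ =>
      eapply (@wf_smodv _ _ _ Γ nu mu A); [mtt_ctx | mtt_ty]
  | |- wf_sub _ (sext hid ?s ?M) (cext ?Δ hid ?A) =>
      apply (@wf_sext_hid _ _ Δ A s M); [mtt_ctx | mtt_ctx | mtt_sub | mtt_ty | mtt_tm]
  end.

Lemma eq_ctx_ext n m (Γ : ctx m) l (mu : hom n m) A A' :
  wf_ctx Γ -> wf_ty (Γ,{mu}) large A -> eq_ty (Γ,{mu}) l A A' ->
  eq_ctx (Γ,[mu ∣ A]) (Γ,[mu ∣ A']).
Proof. intros; apply eq_cext; mtt. eapply eq_ty_to_large; eauto. Qed.

Lemma eq_ctx_ext_hid m (Γ : ctx m) l A A' :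
  wf_ctx Γ -> wf_ty Γ large A -> eq_ty Γ l A A' -> eq_ctx (Γ,,A) (Γ,,A').
Proof. intros; eapply eq_ctx_ext; mtt. Qed.

Lemma wf_tsub_TU m (Γ Δ : ctx m) M sg :
  wf_sub Γ sg Δ -> wf_tm Δ M TU -> wf_tm Γ M⟪sg⟫ TU.
Proof. intros; eapply wf_tm_conv; [eapply wf_tsub; mtt|]. eapply eq_TU_sub; eauto. Qed.

Ltac mtt_ty_hook ::=
  match goal with
  | K : eq_ctx ?Γ ?Δ, H : wf_ty ?Γ _ ?A |- wf_ty ?Δ _ ?A => exact (wf_ty_ctx H K)
  | K : eq_ty ?Γ _ ?A ?A', H : wf_ty (cext ?Γ hid ?A) _ ?B |- wf_ty (cext ?Γ hid ?A') _ ?B =>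
      apply (wf_ty_ctx H); apply (fun X Y => eq_ctx_ext_hid X Y K); [mtt_ctx | mtt_ty]
  | K : heq ?mu ?nu, H : wf_ty (clock ?Γ ?mu) _ ?A |- wf_ty (clock ?Γ ?nu) _ ?A =>
      apply (wf_ty_ctx H); apply eq_clock; [apply eq_ctx_refl; mtt_ctx | exact K]
  end.
Ltac mtt_tm_hook ::=
  match goal with
  | |- wf_tm _ (tsub ?M ?s) TU => eapply wf_tsub_TU; [mtt_sub | mtt_tm]
  | K : eq_ctx ?Γ ?Δ, H : wf_tm ?Γ ?M _ |- wf_tm ?Δ ?M _ => exact (wf_tm_ctx H K)
  | K : eq_ty ?Γ _ ?A ?B, H : wf_tm ?Γ ?M ?A |- wf_tm ?Γ ?M ?B =>
      exact (wf_tm_conv H (eq_ty_to_large K))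
  | K : eq_ty ?Γ _ ?B ?A, H : wf_tm ?Γ ?M ?A |- wf_tm ?Γ ?M ?B =>
      exact (wf_tm_conv H (eq_ty_sym (eq_ty_to_large K)))
  | K : eq_ty ?Γ _ ?A ?A', H : wf_tm (cext ?Γ hid ?A) ?M ?B |- wf_tm (cext ?Γ hid ?A') ?M ?B =>
      apply (wf_tm_ctx H); apply (fun X Y => eq_ctx_ext_hid X Y K); [mtt_ctx | mtt_ty]
  | K : heq ?mu ?nu, H : wf_tm (clock ?Γ ?mu) ?M ?A |- wf_tm (clock ?Γ ?nu) ?M ?A =>
      apply (wf_tm_ctx H); apply eq_clock; [apply eq_ctx_refl; mtt_ctx | exact K]
  end.

(** Naturality of the key under the modality. It makes the domain in the premise of [tlob] stable
    under substitution. *)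
Lemma Later_key1l_sub (Γ Δ : ctx mt) l A sg :
  wf_sub Γ sg Δ -> wf_ctx Γ -> wf_ctx Δ -> wf_ty Δ l A ->
  eq_ty Γ l (Later A⟦key1l⟧)⟦sg⟧ (Later A⟦sg⟧⟦key1l⟧).
Proof.
  intros. eapply eq_ty_trans; [eapply eq_TMod_sub; mtt|].
  apply eq_TMod; mtt. apply eq_ty_sym, TSub_key1l with (Δ := Δ); mtt.
Qed.

Lemma wf_Later_key1l (Γ : ctx mt) l A :
  wf_ctx Γ -> wf_ty Γ l A -> wf_ty Γ l (Later A⟦key1l⟧).
Proof. intros; apply wf_TMod; mtt. Qed.

Lemma Arrow_sub m (Γ Δ : ctx m) A B sg :
  wf_sub Γ sg Δ -> wf_ctx Γ -> wf_ctx Δ -> wf_ty Δ large A -> wf_ty Δ large B ->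
  eq_ty Γ large (Arrow A B)⟦sg⟧ (Arrow A⟦sg⟧ B⟦sg⟧).
Proof.
  intros. eapply eq_ty_trans; [eapply eq_TPi_sub; mtt|].
  apply eq_TPi; mtt. eapply TSub_swk_slift; mtt.
  all: mtt.
Qed.

Lemma Prod_sub m (Γ Δ : ctx m) l A B sg :
  wf_sub Γ sg Δ -> wf_ctx Γ -> wf_ctx Δ -> wf_ty Δ l A -> wf_ty Δ l B ->
  eq_ty Γ l (Prod A B)⟦sg⟧ (Prod A⟦sg⟧ B⟦sg⟧).
Proof.
  intros.
  eapply eq_ty_trans; [eapply eq_TSig_sub; mtt|].
  apply eq_TSig; mtt. eapply TSub_swk_slift; mtt.
  all: mtt.
Qed.

(** The branch of [tlet 𝟙 mu] binds its variable with modality [𝟙 ∘ mu]; through this equality it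
    can be read with modality [mu]. *)
Lemma eq_ctx_ext_id_l n m (Γ : ctx m) (mu : hom n m) A :
  wf_ctx Γ -> wf_ty (Γ,{mu}) large A -> eq_ctx (Γ,[mu ∣ A]) (Γ,[𝟙 ∘ mu ∣ A]).
Proof. intros; apply eq_cext; mtt. Qed.

Lemma wf_ty_lock_id n m (Γ : ctx m) l (mu : hom n m) A :
  wf_ctx Γ -> wf_ty (Γ,{mu}) l A -> wf_ty (Γ,{𝟙},{mu}) l A.
Proof.
  intros; eapply wf_ty_ctx; [eauto|]. apply eq_clock; mtt.
Qed.

Lemma wf_smodv_hid n m (Γ : ctx m) (mu : hom n m) A :
  wf_ctx Γ -> wf_ty (Γ,{mu}) large A ->
  wf_sub (Γ,[mu ∣ A]) (smodv 𝟙 mu) (Γ,,TMod mu A).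
Proof.
  intros. eapply wf_sub_ctx; [apply wf_smodv with (A := A) (Γ := Γ)| |]; mtt.
  - apply wf_ty_lock_id; mtt.
  - apply eq_ctx_sym, eq_ctx_ext_id_l; mtt.
Qed.

Lemma swk_smodv n m (Γ : ctx m) (mu : hom n m) A :
  wf_ctx Γ -> wf_ty (Γ,{mu}) large A ->
  eq_sub (Γ,[mu ∣ A]) (swk ⊙ smodv 𝟙 mu) swk Γ.
Proof.
  intros.
  assert (eq_sub (Γ,[𝟙 ∘ mu ∣ A]) (swk ⊙ smodv 𝟙 mu) swk Γ).
  { assert (wf_ty (Γ,{𝟙},{mu}) large A) by (apply wf_ty_lock_id; mtt).
    eapply eq_swk_sext with (A := TMod mu A); mtt.
    eapply wf_tmod_slock; mtt. eapply wf_tvar; mtt. }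
  eapply eq_sub_ctx; [eauto| |mtt]. apply eq_ctx_sym, eq_ctx_ext_id_l; mtt.
Qed.

Lemma TSub_swk_smodv n m (Γ : ctx m) l (mu : hom n m) A C :
  wf_ctx Γ -> wf_ty (Γ,{mu}) large A -> wf_ty Γ l C ->
  eq_ty (Γ,[mu ∣ A]) l C⟦swk⟧⟦smodv 𝟙 mu⟧ C⟦swk⟧.
Proof.
  intros. eapply TSub_comp_eq; [apply wf_smodv_hid; mtt|mtt|apply swk_smodv; mtt|mtt].
Qed.

Lemma wf_nlet n m (Γ : ctx m) (mu : hom n m) A D C M0 M1 :
  wf_ctx Γ -> wf_ty (Γ,{mu}) large A -> wf_ty Γ large C ->
  wf_ty (Γ,,TMod mu A) large D -> eq_ty (Γ,,TMod mu A) large D C⟦swk⟧ ->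
  wf_tm Γ M0 (TMod mu A) -> wf_tm (Γ,[mu ∣ A]) M1 C⟦swk⟧ ->
  wf_tm Γ (tlet 𝟙 mu A D M0 M1) C.
Proof.
  intros.
  eapply wf_tm_conv; [apply wf_tlet|]; mtt.
  - apply wf_ty_lock_id; mtt.
  - eapply wf_tm_ctx; [|apply eq_ctx_ext_id_l; mtt].
    eapply wf_tm_conv; [eauto|]. apply eq_ty_sym.
    eapply eq_ty_trans; [eapply eq_TSub_ty; [apply wf_smodv_hid; mtt|eauto]|].
    eapply TSub_swk_smodv; mtt.
  - eapply eq_ty_trans; [eapply eq_TSub_ty; [|eauto]; mtt|].
    eapply TSub_swk_sone with (A := TMod mu A); mtt.
Qed.

Lemma wf_next (Γ : ctx mt) A M :
  wf_ctx Γ -> wf_ty Γ large A -> wf_tm Γ M A ->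
  wf_tm Γ (next A M) (Later A⟦key1l⟧).
Proof.
  intros.
  apply wf_nlet; mtt.
  eapply wf_tm_conv; [|apply eq_ty_sym; eapply Later_key1l_sub; mtt].
  apply wf_tmod; mtt.
  eapply wf_tsub; mtt. apply wf_var0; mtt.
Qed.

Lemma eq_Arrow m (Γ : ctx m) l A A' B B' :
  wf_ctx Γ -> wf_ty Γ l A -> eq_ty Γ l A A' -> eq_ty Γ l B B' ->
  eq_ty Γ l (Arrow A B) (Arrow A' B').
Proof. intros; apply eq_TPi; mtt. eapply eq_TSub_ty; [|eassumption]; mtt. Qed.

Lemma eq_Prod m (Γ : ctx m) l A A' B B' :
  wf_ctx Γ -> wf_ty Γ l A -> eq_ty Γ l A A' -> eq_ty Γ l B B' ->
  eq_ty Γ l (Prod A B) (Prod A' B').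
Proof. intros; apply eq_TSig; mtt. eapply eq_TSub_ty; [|eassumption]; mtt. Qed.

Lemma eq_Later_key1l (Γ : ctx mt) l A A' :
  wf_ctx Γ -> eq_ty Γ l A A' -> eq_ty Γ l (Later A⟦key1l⟧) (Later A'⟦key1l⟧).
Proof. intros; apply eq_TMod; mtt. eapply eq_TSub_ty; [|eassumption]; mtt. Qed.

Lemma TSub_sone_sub n m (Γ Δ : ctx m) l (mu : hom n m) A B M sg :
  wf_sub Γ sg Δ -> wf_ctx Γ -> wf_ctx Δ -> wf_ty (Δ,{mu}) large A ->
  wf_tm (Δ,{mu}) M A -> wf_ty (Δ,[mu ∣ A]) l B ->
  eq_ty Γ l B⟦slift mu sg⟧⟦sone mu M⟪slock sg mu⟫⟧ B⟦sone mu M⟧⟦sg⟧.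
Proof.
  intros. eapply TSub_comp_eq2; [|eapply wf_slift with (A := A)| | |eapply sone_slift| ]; mtt.
  all: mtt.
Qed.

Lemma TSub_sone_sub_hid m (Γ Δ : ctx m) l A B M sg :
  wf_sub Γ sg Δ -> wf_ctx Γ -> wf_ctx Δ -> wf_ty Δ large A ->
  wf_tm Δ M A -> wf_ty (Δ,,A) l B ->
  eq_ty Γ l B⟦slift 𝟙 sg⟧⟦sone 𝟙 M⟪sg⟫⟧ B⟦sone 𝟙 M⟧⟦sg⟧.
Proof.
  intros. eapply TSub_comp_eq2; [|eapply wf_slift_hid with (A := A)| | |eapply sone_slift_hid| ]; mtt.
  all: mtt.
Qed.

Lemma wf_slift_TMod o n m (Γ Δ : ctx m) (nu : hom n m) (mu : hom o n) A sg :
  wf_sub Γ sg Δ -> wf_ctx Γ -> wf_ctx Δ -> wf_ty (Δ,{nu},{mu}) large A ->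
  wf_sub (Γ,[nu ∣ TMod mu A⟦slock (slock sg nu) mu⟧]) (slift nu sg) (Δ,[nu ∣ TMod mu A]).
Proof.
  intros. eapply wf_sub_ctx; [eapply wf_slift with (Γ := Γ) (Δ := Δ) (A := TMod mu A)| |]; mtt.
  eapply eq_ctx_ext; mtt. eapply eq_TMod_sub; mtt.
Qed.

Lemma wf_slift_comp o n m (Γ Δ : ctx m) (nu : hom n m) (mu : hom o n) A sg :
  wf_sub Γ sg Δ -> wf_ctx Γ -> wf_ctx Δ -> wf_ty (Δ,{nu},{mu}) large A ->
  wf_sub (Γ,[nu ∘ mu ∣ A⟦slock (slock sg nu) mu⟧]) (slift (nu ∘ mu) sg) (Δ,[nu ∘ mu ∣ A]).
Proof.
  intros. eapply wf_sub_ctx; [eapply wf_slift with (Γ := Γ) (Δ := Δ) (A := A)| |]; mtt.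
  eapply eq_ctx_ext; mtt. eapply TSub_slock_hcomp; mtt.
Qed.

(** Naturality of [smodv]: both composites are [sext nu (sg ⊙ swk) (tmod mu tvar)]. It types the
    branch of a [tlet] after substitution. *)
Lemma TSub_slift_smodv o n m (Γ Δ : ctx m) l (nu : hom n m) (mu : hom o n) A C sg :
  wf_sub Γ sg Δ -> wf_ctx Γ -> wf_ctx Δ -> wf_ty (Δ,{nu},{mu}) large A ->
  wf_ty (Δ,[nu ∣ TMod mu A]) l C ->
  eq_ty (Γ,[nu ∘ mu ∣ A⟦slock (slock sg nu) mu⟧]) l
    C⟦smodv nu mu⟧⟦slift (nu ∘ mu) sg⟧ C⟦slift nu sg⟧⟦smodv nu mu⟧.
Proof.
  intros.
  assert (wf_sub (Γ,[nu ∘ mu ∣ A⟦slock (slock sg nu) mu⟧]) (slift (nu ∘ mu) sg)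
    (Δ,[nu ∘ mu ∣ A])) by (apply wf_slift_comp; mtt).
  assert (wf_sub (Γ,[nu ∣ TMod mu A⟦slock (slock sg nu) mu⟧]) (slift nu sg)
    (Δ,[nu ∣ TMod mu A])) by (apply wf_slift_TMod; mtt).
  set (A' := A⟦slock (slock sg nu) mu⟧) in *.
  assert (wf_ty (Γ,{nu},{mu}) large A') by (unfold A'; mtt).
  assert (wf_tm (Γ,[nu ∘ mu ∣ A'],{nu ∘ mu}) tvar A⟦slock (sg ⊙ swk) (nu ∘ mu)⟧).
  { eapply wf_tm_conv; [eapply wf_tvar; mtt|].
    eapply eq_ty_trans; [|apply eq_ty_sym; eapply TSub_slock_comp; mtt].
    eapply eq_TSub_ty; mtt. apply eq_ty_sym. eapply TSub_slock_hcomp; mtt. }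
  eapply TSub_comp_eq2; mtt.
  eapply eq_sub_trans; [eapply smodv_sext; mtt|]. apply eq_sub_sym.
  eapply slift_sext; mtt; mtt.
  eapply wf_tm_conv; [eapply wf_tmod_slock with (sg := swk) (A := A'); mtt; eapply wf_tvar; mtt|].
  eapply eq_TSub_ty; [mtt|]. apply eq_ty_sym; eapply eq_TMod_sub; mtt.
Qed.

Lemma TSub_sid_sone m (Γ : ctx m) A :
  wf_ctx Γ -> wf_ty Γ large A -> forall l B, wf_ty (Γ,,A) l B ->
  eq_ty (Γ,,A) l B⟦slift 𝟙 swk⟧⟦sone 𝟙 tvar⟧ B.
Proof.
  intros. assert (wf_tm (Γ,,A) tvar A⟦swk⟧) by (apply wf_var0; mtt).
  eapply eq_ty_trans; [eapply TSub_comp_eq|].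
  3: apply slift_swk_sone_var. 2: eapply wf_slift_hid with (A := A). all: mtt.
  apply eq_TSub_id; auto.
Qed.

(** Needed for the right side of [eq_tlet], where both modalities, the annotation and the motive
    change together, and with them the contexts of motive and branch. Presuppositions are not yet
    available here, so the typing of [A'] and [C'] is assumed. *)
Lemma wf_tlet' n m o (Γ : ctx o) (nu nu' : hom m o) (mu mu' : hom n m)
    A A' C C' M0 M1 :
  wf_ctx Γ -> heq nu nu' -> heq mu mu' ->
  wf_ty (Γ,{nu},{mu}) large A -> eq_ty (Γ,{nu},{mu}) large A A' ->
  wf_ty (Γ,{nu},{mu}) large A' ->
  wf_ty (Γ,[nu ∣ TMod mu A]) large C' ->
  eq_ty (Γ,[nu ∣ TMod mu A]) large C C' ->
  wf_tm (Γ,{nu}) M0 (TMod mu A) ->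
  wf_tm (Γ,[nu ∘ mu ∣ A]) M1 C⟦sext nu swk (tmod mu tvar)⟧ ->
  wf_tm Γ (tlet nu' mu' A' C' M0 M1) C'⟦sone nu' M0⟧.
Proof.
  intros.
  assert (L : eq_ctx (Γ,{nu},{mu}) (Γ,{nu'},{mu'})) by (apply eq_clock; [apply eq_clock|]; mtt).
  assert (T : eq_ty (Γ,{nu}) large (TMod mu A) (TMod mu' A')) by (apply eq_TMod; mtt).
  assert (E1 : eq_ctx (Γ,[nu ∣ TMod mu A]) (Γ,[nu' ∣ TMod mu' A'])) by (apply eq_cext; mtt).
  assert (E2 : eq_ctx (Γ,[nu ∘ mu ∣ A]) (Γ,[nu' ∘ mu' ∣ A'])).
  { apply eq_cext; mtt. eapply eq_ty_ctx; mtt. }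
  apply wf_tlet; mtt.
  - apply wf_tm_ctx with (Γ := Γ,{nu}); [|apply eq_clock; mtt].
    eapply wf_tm_conv; eauto.
  - eapply wf_tm_ctx; [|exact E2]. eapply wf_tm_conv; [eauto|].
    eapply eq_TSub; [|eauto].
    apply eq_sext; mtt.
    eapply eq_tm_conv; [apply eq_tmod with (A := A⟦slock (slock swk nu) mu⟧); mtt|].
    + apply eq_tm_refl. apply wf_tm_lock_comp'; mtt.
      eapply wf_tm_conv; [apply wf_tvar; mtt|]. eapply TSub_slock_hcomp; mtt.
    + apply eq_ty_sym; eapply eq_TMod_sub; mtt.
Qed.

(** * Presuppositions *)

Scheme wf_ctx_mut := Minimality for wf_ctx Sort Prop
with eq_ctx_mut := Minimality for eq_ctx Sort Prop
with wf_ty_mut := Minimality for wf_ty Sort Prop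
with eq_ty_mut := Minimality for eq_ty Sort Prop
with wf_tm_mut := Minimality for wf_tm Sort Prop
with eq_tm_mut := Minimality for eq_tm Sort Prop
with wf_sub_mut := Minimality for wf_sub Sort Prop
with eq_sub_mut := Minimality for eq_sub Sort Prop.
Combined Scheme judgment_ind from wf_ctx_mut, eq_ctx_mut, wf_ty_mut, eq_ty_mut,
  wf_tm_mut, eq_tm_mut, wf_sub_mut, eq_sub_mut.

(** One simultaneous induction, since the eight judgments refer to each other through conversion.
    The work lies in the equations whose right side naturally has a type that agrees with the stated
    one only up to a substitution identity from above. *)
Lemma presup :
  (forall m (Γ : ctx m), wf_ctx Γ -> True) /\
  (forall m (Γ Δ : ctx m), eq_ctx Γ Δ -> wf_ctx Γ /\ wf_ctx Δ) /\
  (forall m (Γ : ctx m) l A, wf_ty Γ l A -> wf_ctx Γ) /\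
  (forall m (Γ : ctx m) l A B, eq_ty Γ l A B -> wf_ctx Γ /\ wf_ty Γ l A /\ wf_ty Γ l B) /\
  (forall m (Γ : ctx m) M A, wf_tm Γ M A -> wf_ctx Γ /\ wf_ty Γ large A) /\
  (forall m (Γ : ctx m) M N A, eq_tm Γ M N A ->
    wf_ctx Γ /\ wf_ty Γ large A /\ wf_tm Γ M A /\ wf_tm Γ N A) /\
  (forall m (Γ : ctx m) sg Δ, wf_sub Γ sg Δ -> wf_ctx Γ /\ wf_ctx Δ) /\
  (forall m (Γ : ctx m) sg tau Δ, eq_sub Γ sg tau Δ ->
    wf_ctx Γ /\ wf_ctx Δ /\ wf_sub Γ sg Δ /\ wf_sub Γ tau Δ).
Proof.
  apply judgment_ind; intros;
  repeat match goal with H : _ /\ _ |- _ => destruct H end;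
  repeat match goal with |- _ /\ _ => split end; auto; mtt.

  - apply wf_cext; mtt. eapply wf_ty_ctx; [eassumption|apply eq_clock; mtt].
  - eapply wf_tm_conv; [eapply wf_tsub; mtt|]. apply eq_ty_sym; eapply eq_TSub_sub; mtt.
  - assert (eq_ty Γ large C⟦sone 𝟙 ttrue⟧ C'⟦sone 𝟙 ttrue⟧)
      by (eapply eq_TSub_ty; [|eassumption]; mtt).
    assert (eq_ty Γ large C⟦sone 𝟙 tfalse⟧ C'⟦sone 𝟙 tfalse⟧)
      by (eapply eq_TSub_ty; [|eassumption]; mtt).
    apply wf_tm_conv with (A := C'⟦sone 𝟙 b'⟧); mtt.
    apply eq_ty_sym; eapply eq_TSub; [apply eq_sone_hid with (A := TBool)|]; mtt.
  - apply wf_tm_conv with (A := TPi A' B); mtt. apply eq_ty_sym; eapply eq_TPi; mtt.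
  - assert (eq_ty Γ large (TPi A B) (TPi A' B')) by (apply eq_TPi; mtt).
    apply wf_tm_conv with (A := B'⟦sone 𝟙 N'⟧); mtt.
    apply eq_ty_sym; eapply eq_TSub; [apply eq_sone_hid with (A := A)|]; mtt.
  - assert (eq_ty Γ large B⟦sone 𝟙 M⟧ B'⟦sone 𝟙 M'⟧)
      by (eapply eq_TSub; [apply eq_sone_hid with (A := A)|]; mtt).
    apply wf_tm_conv with (A := TSig A' B'); mtt. apply eq_ty_sym; eapply eq_TSig; mtt.
  - assert (eq_ty Γ large (TSig A B) (TSig A' B')) by (apply eq_TSig; mtt).
    apply wf_tm_conv with (A := A'); mtt.
  - assert (eq_ty Γ large (TSig A B) (TSig A' B')) by (apply eq_TSig; mtt).
    apply wf_tm_conv with (A := B'⟦sone 𝟙 (tfst A' B' M')⟧); mtt.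
    apply eq_ty_sym; eapply eq_TSub; [apply eq_sone_hid with (A := A)|]; mtt. apply eq_tfst; mtt.
  - apply wf_tm_conv with (A := TEq A M' M'); mtt. apply eq_ty_sym; eapply eq_TEq; mtt.
  - apply wf_tm_conv with (A := TMod nu A); mtt. apply eq_ty_sym; eapply eq_TMod; mtt.
  - eapply wf_tm_conv; [apply wf_tlet' with (A := A) (C := C) (nu := nu) (mu := mu); eauto|].
    apply eq_ty_sym; eapply eq_TSub; [apply eq_sone with (A := TMod mu A)|]; mtt.
  - assert (eq_ty Γ large (Arrow (Later A⟦key1l⟧) A) (Arrow (Later A'⟦key1l⟧) A')).
    { apply eq_Arrow; mtt. apply eq_Later_key1l; mtt. }
    apply wf_tm_conv with (A := A'); mtt.
  (* The η-expansion: the type of its body is [B] weakened and then instantiated at the new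
     variable, which is [B] again. *)
  - apply wf_tlam; mtt.
    assert (wf_tm (Γ,,A) tvar A⟦swk⟧) by (apply wf_var0; mtt).
    eapply wf_tm_conv; [apply wf_tapp|apply TSub_sid_sone]; mtt.
    eapply wf_tm_conv; [eapply wf_tsub|eapply eq_TPi_sub]; mtt.
  - eapply wf_tm_conv; [eapply wf_tsnd; mtt|].
    eapply eq_TSub; [apply eq_sone_hid with (A := A)|]; mtt. apply eq_TSig_beta1; mtt.
  (* Uniqueness of equality proofs: [trefl M] inhabits [TEq A M M], and reflection of the given
     proof converts this type to [TEq A M N]. *)
  - eapply wf_tm_conv with (A := TEq A M M); mtt.
    apply eq_TEq; mtt. eapply eq_reflection; mtt.
  - assert (wf_tm (Γ,{nu ∘ mu}) M0 A) by (apply wf_tm_lock_comp; mtt).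
    assert (wf_sub Γ (sone (nu ∘ mu) M0) (Γ,[nu ∘ mu ∣ A])) by (apply wf_sone; mtt).
    eapply wf_tm_conv; [eapply wf_tsub; mtt|].
    eapply TSub_comp_eq; [| |apply smodv_sone|]; mtt.
  - assert (wf_tm Γ (next A (tlob A M)) (Later A⟦key1l⟧)) by (apply wf_next; mtt).
    eapply wf_tm_conv; [apply wf_tapp|eapply TSub_swk_sone with (A := Later A⟦key1l⟧)]; mtt.
  - eapply wf_tm_conv; [eapply wf_tsub|apply eq_TSub_id]; mtt.
  - eapply wf_tm_conv; [eapply wf_tsub; [|eapply wf_tsub]; mtt|].
    apply eq_ty_sym; eapply eq_TSub_comp; mtt.
  - assert (wf_sub Γ (sext mu sg M) (Δ,[mu ∣ A])) by (apply wf_sext; mtt).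
    eapply wf_tm_conv; [eapply wf_tsub; [|apply wf_tvar]; mtt|].
    eapply TSub_comp_eq; mtt.
    eapply eq_sub_trans; [apply eq_sub_sym; eapply eq_slock_scomp; mtt|].
    apply eq_slock; mtt. eapply eq_swk_sext; mtt.
  all: mtt.
  - eapply wf_tm_conv; [eapply wf_tsub; mtt|eapply eq_TBool_sub; mtt].
  all: mtt.
  - eapply wf_tm_conv; [eapply wf_tsub; mtt|eapply eq_TBool_sub; mtt].
  all: mtt.
  - assert (wf_sub (Γ,,TBool) (slift 𝟙 sg) (Δ,,TBool)).
    { apply wf_sub_ctx with (Γ := Γ,,TBool⟦sg⟧) (Δ := Δ,,TBool); mtt.
      eapply eq_ctx_ext_hid with (l := large); mtt. eapply eq_TBool_sub; mtt. }
    (* The branches must be typed at [ttrue] and [tfalse] themselves, not at their substituted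
       forms, so [b1] may be any term equal to [b0⟪sg⟫]. *)
    assert (T : forall b0 b1, wf_tm Δ b0 TBool -> eq_tm Γ b0⟪sg⟫ b1 TBool ->
      eq_ty Γ large C⟦sone 𝟙 b0⟧⟦sg⟧ C⟦slift 𝟙 sg⟧⟦sone 𝟙 b1⟧).
    { intros. eapply eq_ty_trans;
        [apply eq_ty_sym; eapply TSub_sone_sub_hid with (A := TBool); mtt|].
      eapply eq_TSub_sub; [apply eq_sone_hid with (A := TBool)|]; mtt. }
    assert (wf_tm Γ b⟪sg⟫ TBool).
    { eapply wf_tm_conv; [eapply wf_tsub|eapply eq_TBool_sub]; mtt. }
    eapply wf_tm_conv; [|apply eq_ty_sym; apply T; mtt].
    apply wf_tif; mtt.
    + eapply wf_tm_conv; [eapply wf_tsub; mtt|]. apply T; mtt. eapply eq_ttrue_sub; mtt.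
    + eapply wf_tm_conv; [eapply wf_tsub; mtt|]. apply T; mtt. eapply eq_tfalse_sub; mtt.
  - apply wf_tm_conv with (A := TPi A⟦sg⟧ B⟦slift 𝟙 sg⟧); mtt.
    apply eq_ty_sym; eapply eq_TPi_sub; mtt.
  - eapply wf_tm_conv; [|eapply TSub_sone_sub_hid with (A := A)]; mtt.
    apply wf_tapp; mtt. eapply wf_tm_conv; [eapply wf_tsub|eapply eq_TPi_sub]; mtt.
  - apply wf_tm_conv with (A := TSig A⟦sg⟧ B⟦slift 𝟙 sg⟧); mtt; [|apply eq_ty_sym; eapply eq_TSig_sub; mtt].
    apply wf_tpair; mtt. eapply wf_tm_conv; [eapply wf_tsub; mtt|].
    apply eq_ty_sym; eapply TSub_sone_sub_hid with (A := A); mtt.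
  - eapply wf_tfst; mtt. eapply wf_tm_conv; [eapply wf_tsub|eapply eq_TSig_sub]; mtt.
  - assert (wf_tm Γ M⟪sg⟫ (TSig A⟦sg⟧ B⟦slift 𝟙 sg⟧)).
    { eapply wf_tm_conv; [eapply wf_tsub|eapply eq_TSig_sub]; mtt. }
    eapply wf_tm_conv; [|eapply TSub_sone_sub_hid with (A := A)]; mtt.
    eapply wf_tm_conv; [apply wf_tsnd; mtt|].
    eapply eq_TSub_sub; [apply eq_sone_hid with (A := A⟦sg⟧)|]; mtt.
    apply eq_tm_sym; eapply eq_tfst_sub with (Δ := Δ); mtt.
  - apply wf_tm_conv with (A := TEq A⟦sg⟧ M⟪sg⟫ M⟪sg⟫); mtt. apply eq_ty_sym; eapply eq_TEq_sub; mtt.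
  - apply wf_tm_conv with (A := TMod mu A⟦slock sg mu⟧); mtt. apply eq_ty_sym; eapply eq_TMod_sub; mtt.
  - assert (wf_sub (Γ,[nu ∘ mu ∣ A⟦slock (slock sg nu) mu⟧]) (slift (nu ∘ mu) sg)
      (Δ,[nu ∘ mu ∣ A])) by (apply wf_slift_comp; mtt).
    assert (wf_sub (Γ,[nu ∣ TMod mu A⟦slock (slock sg nu) mu⟧]) (slift nu sg)
      (Δ,[nu ∣ TMod mu A])) by (apply wf_slift_TMod; mtt).
    eapply wf_tm_conv; [|eapply TSub_sone_sub with (A := TMod mu A)]; mtt.
    apply wf_tlet; mtt.
    + eapply wf_tm_conv; [eapply wf_tsub|eapply eq_TMod_sub]; mtt.
    + eapply wf_tm_conv; [eapply wf_tsub|eapply TSub_slift_smodv]; mtt.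
  - apply wf_tlob; mtt. eapply wf_tm_conv; [eapply wf_tsub; mtt|].
    eapply eq_ty_trans; [eapply Arrow_sub; mtt|]. apply eq_Arrow; mtt.
    eapply Later_key1l_sub; mtt.
  - eapply wf_sub_ctx; mtt.
  - eapply wf_sub_ctx; mtt.
  - apply wf_sext; mtt.
  - apply wf_sub_ctx with (Γ := Γ) (Δ := Δ,[nu ∣ A]); mtt; [|apply eq_cext; mtt].
    apply wf_sext; mtt. apply wf_tm_ctx with (Γ := Γ,{mu}); [|apply eq_clock; mtt].
    eapply wf_tm_conv; [eassumption|]. eapply eq_TSub_sub; [apply eq_slock|]; mtt.
  - eapply wf_sub_ctx; [apply wf_slock with (mu := nu)| |]; mtt; apply eq_clock; mtt.
  - eapply wf_sub_ctx; [apply wf_skey with (Γ := Γ) (mu := mu') (nu := nu')| |]; mtt;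
      try (apply eq_clock; mtt).
    (* The chain mu' ≤ mu ≤ nu ≤ nu', whose outer links are halves of the two [heq] premises. *)
    eapply hle_trans; [|eapply hle_trans; [eassumption|]]; match goal with H : heq _ _ |- _ => apply H end.
  - apply wf_sbang; mtt.
  - apply wf_scomp with (Δ := Δ,[mu ∣ A]); mtt. apply wf_sext; mtt.
  - apply wf_scomp with (Δ := Δ); mtt. apply wf_sext; mtt.
  - apply wf_sext; mtt. eapply wf_tm_conv; [eapply wf_tsub; mtt|].
    apply eq_ty_sym; eapply TSub_slock_comp; mtt.
  - apply wf_sext; mtt. apply wf_tvar; mtt.
  - eapply wf_sub_ctx; [apply wf_slock with (mu := 𝟙)| |]; mtt.
  - eapply wf_sub_ctx; mtt.
  all: mtt.
  - apply wf_skey; mtt. eapply hle_trans; eauto.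
  - apply wf_skey; mtt. apply hle_comp; mtt.
  -
    eapply wf_sub_ctx with (Γ := Γ,{nu},{nu'}) (Δ := Γ,{mu},{mu'}); mtt.

Qed.

Section Presuppositions.
Variables (m : mode) (Γ Δ : ctx m) (l : size) (A B : ty m) (M N : tm m) (sg tau : sub m).

Lemma wf_ty_wf_ctx : wf_ty Γ l A -> wf_ctx Γ.
Proof. apply presup. Qed.

Lemma wf_tm_wf_ctx : wf_tm Γ M A -> wf_ctx Γ.
Proof. apply presup. Qed.

Lemma wf_tm_wf_ty : wf_tm Γ M A -> wf_ty Γ large A.
Proof. apply presup. Qed.

Lemma wf_sub_wf_ctx_l : wf_sub Γ sg Δ -> wf_ctx Γ.
Proof. apply presup. Qed.

Lemma wf_sub_wf_ctx_r : wf_sub Γ sg Δ -> wf_ctx Δ.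
Proof. apply presup. Qed.

Lemma eq_ty_wf_ctx : eq_ty Γ l A B -> wf_ctx Γ.
Proof. apply presup. Qed.

Lemma eq_ty_wf_l : eq_ty Γ l A B -> wf_ty Γ l A.
Proof. apply presup. Qed.

Lemma eq_ty_wf_r : eq_ty Γ l A B -> wf_ty Γ l B.
Proof. apply presup. Qed.

Lemma eq_tm_wf_ctx : eq_tm Γ M N A -> wf_ctx Γ.
Proof. apply presup. Qed.

Lemma eq_tm_wf_ty : eq_tm Γ M N A -> wf_ty Γ large A.
Proof. apply presup. Qed.

Lemma eq_tm_wf_l : eq_tm Γ M N A -> wf_tm Γ M A.
Proof. apply presup. Qed.

Lemma eq_tm_wf_r : eq_tm Γ M N A -> wf_tm Γ N A.
Proof. apply presup. Qed.

Lemma eq_sub_wf_r : eq_sub Γ sg tau Δ -> wf_sub Γ tau Δ.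
Proof. apply presup. Qed.

End Presuppositions.

Ltac mtt_ctx_hook ::=
  match goal with
  | H : wf_sub ?Γ _ _ |- wf_ctx ?Γ => exact (wf_sub_wf_ctx_l H)
  | H : wf_sub _ _ ?Γ |- wf_ctx ?Γ => exact (wf_sub_wf_ctx_r H)
  | H : wf_ty ?Γ _ _ |- wf_ctx ?Γ => exact (wf_ty_wf_ctx H)
  | H : wf_tm ?Γ _ _ |- wf_ctx ?Γ => exact (wf_tm_wf_ctx H)
  | H : eq_ty ?Γ _ _ _ |- wf_ctx ?Γ => exact (eq_ty_wf_ctx H)
  | H : eq_tm ?Γ _ _ _ |- wf_ctx ?Γ => exact (eq_tm_wf_ctx H)
  end.
Ltac mtt_ty_hook ::=
  match goal with
  | H : wf_tm ?Γ _ ?A |- wf_ty ?Γ large ?A => exact (wf_tm_wf_ty H)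
  | H : eq_ty ?Γ ?l ?A _ |- wf_ty ?Γ ?l ?A => exact (eq_ty_wf_l H)
  | H : eq_ty ?Γ ?l _ ?A |- wf_ty ?Γ ?l ?A => exact (eq_ty_wf_r H)
  | H : eq_ty ?Γ ?l ?A _ |- wf_ty ?Γ large ?A => exact (wf_ty_to_large (eq_ty_wf_l H))
  | H : eq_ty ?Γ ?l _ ?A |- wf_ty ?Γ large ?A => exact (wf_ty_to_large (eq_ty_wf_r H))
  | H : eq_tm ?Γ _ _ ?A |- wf_ty ?Γ large ?A => exact (eq_tm_wf_ty H)
  | K : eq_ctx ?Γ ?Δ, H : wf_ty ?Γ _ ?A |- wf_ty ?Δ _ ?A => exact (wf_ty_ctx H K)
  end.
Ltac mtt_tm_hook ::=
  match goal with
  | H : eq_tm ?Γ ?M _ _ |- wf_tm ?Γ ?M _ => exact (eq_tm_wf_l H)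
  | H : eq_tm ?Γ _ ?M _ |- wf_tm ?Γ ?M _ => exact (eq_tm_wf_r H)
  | |- wf_tm _ (tsub ?M ?s) TU => eapply wf_tsub_TU; [mtt_sub | mtt_tm]
  | |- wf_tm (cext _ hid ?A) tvar (TSub ?A swk) => apply wf_var0; [mtt_ctx | mtt_ty]
  | K : eq_ctx ?Γ ?Δ, H : wf_tm ?Γ ?M _ |- wf_tm ?Δ ?M _ => exact (wf_tm_ctx H K)
  | K : eq_ty ?Γ _ ?A ?B, H : wf_tm ?Γ ?M ?A |- wf_tm ?Γ ?M ?B =>
      exact (wf_tm_conv H (eq_ty_to_large K))
  | K : eq_ty ?Γ _ ?B ?A, H : wf_tm ?Γ ?M ?A |- wf_tm ?Γ ?M ?B =>
      exact (wf_tm_conv H (eq_ty_sym (eq_ty_to_large K)))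
  end.

(** * Pushing substitutions through the non-dependent connectives *)

Lemma eq_tm_conv_sym m (Γ : ctx m) M N A B :
  eq_tm Γ M N B -> eq_ty Γ large A B -> eq_tm Γ M N A.
Proof. intros; eapply eq_tm_conv; mtt. Qed.

Lemma wf_tm_conv_sym m (Γ : ctx m) M A B :
  wf_tm Γ M B -> eq_ty Γ large A B -> wf_tm Γ M A.
Proof. intros; eapply wf_tm_conv; mtt. Qed.

(** Substitution under a binder turns a constant family [B⟦swk⟧] into [B⟦swk⟧⟦slift mu sg⟧]. As
    weakening commutes with lifting, this is again a constant family, and non-dependence survives
    substitution. *)
Lemma TSub_lift_sub n m (Γ Δ : ctx m) l (mu : hom n m) A A' B B' sg :
  wf_sub Γ sg Δ -> eq_ty (Γ,{mu}) large A⟦slock sg mu⟧ A' -> wf_ty (Δ,{mu}) large A ->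
  eq_ty Γ l B⟦sg⟧ B' -> wf_ty Δ l B ->
  eq_ty (Γ,[mu ∣ A']) l B⟦swk⟧⟦slift mu sg⟧ B'⟦swk⟧.
Proof.
  intros. assert (K : eq_ctx (Γ,[mu ∣ A⟦slock sg mu⟧]) (Γ,[mu ∣ A'])).
  { eapply eq_ctx_ext; mtt. }
  eapply eq_ty_ctx; [|exact K].
  eapply eq_ty_trans; [eapply TSub_comp_eq2; [| | | |eapply swk_slift with (A := A)|]; mtt|].
  eapply eq_TSub_ty; [|eassumption]; mtt.
Qed.

Lemma TSub_lift_sub_hid m (Γ Δ : ctx m) l A A' B B' sg :
  wf_sub Γ sg Δ -> eq_ty Γ large A⟦sg⟧ A' -> wf_ty Δ large A ->
  eq_ty Γ l B⟦sg⟧ B' -> wf_ty Δ l B ->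
  eq_ty (Γ,,A') l B⟦swk⟧⟦slift 𝟙 sg⟧ B'⟦swk⟧.
Proof.
  intros. eapply TSub_lift_sub; mtt; mtt.
  apply eq_ty_lock_hid; mtt. eapply eq_ty_trans; [eapply TSub_slock_hid|]; mtt.
  all: mtt.
Qed.

(** In lemmas ending in [_ev], the components come with chosen forms, primed, equal to their
    substituted versions. A substitution thus passes through a compound expression in one step,
    directly to the form wanted next. *)
Lemma Arrow_ev m (Γ Δ : ctx m) A A' B B' sg :
  wf_sub Γ sg Δ -> wf_ty Δ large A -> wf_ty Δ large B ->
  eq_ty Γ large A⟦sg⟧ A' -> eq_ty Γ large B⟦sg⟧ B' ->
  eq_ty Γ large (Arrow A B)⟦sg⟧ (Arrow A' B').
Proof.
  intros. eapply eq_ty_trans; [eapply Arrow_sub; mtt|]. apply eq_Arrow; mtt.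
Qed.

Lemma wf_napp m (Γ : ctx m) A B M N :
  wf_ty Γ large B -> wf_tm Γ M (Arrow A B) -> wf_tm Γ N A ->
  wf_tm Γ (napp A B M N) B.
Proof.
  intros. eapply wf_tm_conv; [apply wf_tapp; mtt|eapply TSub_swk_sone; mtt; mtt].

Qed.

Lemma eq_napp m (Γ : ctx m) A A' B B' M M' N N' :
  eq_ty Γ large A A' -> eq_ty Γ large B B' ->
  eq_tm Γ M M' (Arrow A B) -> eq_tm Γ N N' A ->
  eq_tm Γ (napp A B M N) (napp A' B' M' N') B.
Proof.
  intros. eapply eq_tm_conv; [apply eq_tapp; mtt|eapply TSub_swk_sone; mtt; mtt].
  eapply eq_TSub_ty; [|eassumption]; mtt.

Qed.

Lemma napp_ev m (Γ Δ : ctx m) A A' B B' M M' N N' sg :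
  wf_sub Γ sg Δ -> wf_ty Δ large B -> wf_tm Δ M (Arrow A B) -> wf_tm Δ N A ->
  eq_ty Γ large A⟦sg⟧ A' -> eq_ty Γ large B⟦sg⟧ B' ->
  eq_tm Γ M⟪sg⟫ M' (Arrow A' B') -> eq_tm Γ N⟪sg⟫ N' A' ->
  eq_tm Γ (napp A B M N)⟪sg⟫ (napp A' B' M' N') B'.
Proof.
  intros.
  eapply eq_tm_trans.
  - eapply eq_tm_conv; [eapply eq_tapp_sub; mtt|].
    eapply eq_ty_trans; [eapply eq_TSub_ty; [|eapply TSub_swk_sone with (A := A)]; mtt|]; mtt.
  -
    assert (T : eq_ty (Γ,,A⟦sg⟧) large B⟦swk⟧⟦slift 𝟙 sg⟧ B'⟦swk⟧)
      by (eapply TSub_lift_sub_hid; mtt).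
    eapply eq_tm_conv; [apply eq_tapp with (A' := A') (B' := B'⟦swk⟧)|]; mtt.
    + eapply eq_tm_conv_sym; [eassumption|].
      apply eq_TPi; mtt.
    + eapply eq_tm_conv_sym; mtt.
    + eapply eq_ty_trans; [eapply eq_TSub_ty; [|exact T]; mtt|].
      eapply TSub_swk_sone with (A := A⟦sg⟧); mtt.
Qed.

Lemma wf_nlam m (Γ : ctx m) A B M :
  wf_ty Γ large A -> wf_ty Γ large B -> wf_tm (Γ,,A) M B⟦swk⟧ ->
  wf_tm Γ (tlam A M) (Arrow A B).
Proof. intros; apply wf_tlam; mtt. Qed.

Lemma wf_slift_ev n m (Γ Δ : ctx m) (mu : hom n m) A A' sg :
  wf_sub Γ sg Δ -> eq_ty (Γ,{mu}) large A⟦slock sg mu⟧ A' -> wf_ty (Δ,{mu}) large A ->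
  wf_sub (Γ,[mu ∣ A']) (slift mu sg) (Δ,[mu ∣ A]).
Proof.
  intros. apply wf_sub_ctx with (Γ := Γ,[mu ∣ A⟦slock sg mu⟧]) (Δ := Δ,[mu ∣ A]); mtt.
  eapply eq_ctx_ext; mtt.
Qed.

Lemma wf_slift_ev_hid m (Γ Δ : ctx m) A A' sg :
  wf_sub Γ sg Δ -> eq_ty Γ large A⟦sg⟧ A' -> wf_ty Δ large A ->
  wf_sub (Γ,,A') (slift 𝟙 sg) (Δ,,A).
Proof.
  intros. apply wf_sub_ctx with (Γ := Γ,,A⟦sg⟧) (Δ := Δ,,A); mtt.
  eapply eq_ctx_ext_hid; mtt.
Qed.

Lemma nlam_ev m (Γ Δ : ctx m) A A' B B' M M' sg :
  wf_sub Γ sg Δ -> wf_ty Δ large A -> wf_ty Δ large B -> wf_tm (Δ,,A) M B⟦swk⟧ ->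
  eq_ty Γ large A⟦sg⟧ A' -> eq_ty Γ large B⟦sg⟧ B' ->
  eq_tm (Γ,,A') M⟪slift 𝟙 sg⟫ M' B'⟦swk⟧ ->
  eq_tm Γ (tlam A M)⟪sg⟫ (tlam A' M') (Arrow A' B').
Proof.
  intros. eapply eq_tm_trans.
  - eapply eq_tm_conv; [eapply eq_tlam_sub; mtt; mtt|]. eapply Arrow_ev; mtt.
  - assert (K : eq_ctx (Γ,,A') (Γ,,A⟦sg⟧)) by (apply eq_ctx_sym; eapply eq_ctx_ext_hid; mtt).
    assert (eq_ty Γ large (TPi A⟦sg⟧ B'⟦swk⟧) (Arrow A' B')) by (apply eq_TPi; mtt).
    eapply eq_tm_conv; [apply eq_tlam with (B := B'⟦swk⟧)|]; mtt. eapply eq_tm_ctx; [|exact K]; mtt.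
Qed.

(** β for a closure: a function under a delayed substitution, when applied, runs its body in the
    environment extended by the argument. Iterated, it applies curried functions without any
    composition of lifts. *)
Lemma nlam_sub_app m (Γ Δ : ctx m) A A' B B' M N sg :
  wf_sub Γ sg Δ -> wf_ty Δ large A -> wf_ty Δ large B -> wf_tm (Δ,,A) M B⟦swk⟧ ->
  eq_ty Γ large A⟦sg⟧ A' -> eq_ty Γ large B⟦sg⟧ B' -> wf_tm Γ N A' ->
  eq_tm Γ (napp A' B' (tlam A M)⟪sg⟫ N) M⟪sext 𝟙 sg N⟫ B'.
Proof.
  intros.
  assert (W : wf_sub (Γ,,A') (slift 𝟙 sg) (Δ,,A)) by (apply wf_slift_ev_hid; mtt).
  assert (T : eq_ty (Γ,,A') large B⟦swk⟧⟦slift 𝟙 sg⟧ B'⟦swk⟧) by (eapply TSub_lift_sub_hid; mtt).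
  assert (wf_tm (Γ,,A') M⟪slift 𝟙 sg⟫ B'⟦swk⟧) by (eapply wf_tm_conv; [eapply wf_tsub; mtt|exact T]).
  assert (wf_tm Γ N A⟦sg⟧) by mtt.
  eapply eq_tm_trans; [apply eq_napp; mtt|].
  { eapply nlam_ev; mtt. all: mtt. }
  eapply eq_tm_trans; [eapply eq_tm_conv; [apply eq_TPi_beta; mtt|]|].
  - eapply TSub_swk_sone with (A := A'); mtt.
  - assert (E : eq_sub Γ (slift 𝟙 sg ⊙ sone 𝟙 N) (sext 𝟙 sg N) (Δ,,A)).
    { apply slift_sone; mtt. apply wf_tm_lock_hid; mtt. eapply wf_tm_conv_sym; [eassumption|].
      eapply TSub_slock_hid; mtt. }
    eapply eq_tm_conv; [eapply tsub_comp_eq with (Δ := Γ,,A'); mtt; mtt|].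
    eapply eq_ty_trans; [eapply TSub_comp_eq with (Δ := Δ,,A)|eassumption]; mtt.
    apply swk_sext_hid with (A := A); mtt.
Qed.

Section Products.
Variables (m : mode) (Γ Δ : ctx m) (A A' B B' : ty m) (M M' N N' : tm m) (sg : sub m).

Lemma Prod_ev l :
  wf_sub Γ sg Δ -> wf_ty Δ l A -> wf_ty Δ l B ->
  eq_ty Γ l A⟦sg⟧ A' -> eq_ty Γ l B⟦sg⟧ B' ->
  eq_ty Γ l (Prod A B)⟦sg⟧ (Prod A' B').
Proof.
  intros. eapply eq_ty_trans; [eapply Prod_sub; mtt|]. apply eq_Prod; mtt.
Qed.

Lemma wf_npair :
  wf_tm Γ M A -> wf_tm Γ N B -> wf_tm Γ (npair A B M N) (Prod A B).
Proof.
  intros. apply wf_tpair; mtt. eapply wf_tm_conv_sym; [eassumption|].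
  eapply TSub_swk_sone with (A := A); mtt.
Qed.

Lemma wf_nfst :
  wf_ty Γ large A -> wf_ty Γ large B -> wf_tm Γ M (Prod A B) -> wf_tm Γ (nfst A B M) A.
Proof. intros; eapply wf_tfst; mtt. Qed.

Lemma wf_nsnd :
  wf_ty Γ large A -> wf_ty Γ large B -> wf_tm Γ M (Prod A B) -> wf_tm Γ (nsnd A B M) B.
Proof.
  intros.
  eapply wf_tm_conv; [eapply wf_tsnd; mtt|].
  eapply TSub_swk_sone with (A := A); mtt.
Qed.

Lemma eq_npair :
  eq_ty Γ large A A' -> eq_ty Γ large B B' -> eq_tm Γ M M' A -> eq_tm Γ N N' B ->
  eq_tm Γ (npair A B M N) (npair A' B' M' N') (Prod A B).
Proof.
  intros. apply eq_tpair; mtt.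
  - eapply eq_TSub_ty; [|eassumption]; mtt.
  - eapply eq_tm_conv_sym; [eassumption|]. eapply TSub_swk_sone with (A := A); mtt.
Qed.

End Products.

Section ProductsSub.
Variables (m : mode) (Γ Δ : ctx m) (A A' B B' : ty m) (M M' N N' : tm m) (sg : sub m).

Lemma npair_ev :
  wf_sub Γ sg Δ -> wf_tm Δ M A -> wf_tm Δ N B ->
  eq_ty Γ large A⟦sg⟧ A' -> eq_ty Γ large B⟦sg⟧ B' ->
  eq_tm Γ M⟪sg⟫ M' A' -> eq_tm Γ N⟪sg⟫ N' B' ->
  eq_tm Γ (npair A B M N)⟪sg⟫ (npair A' B' M' N') (Prod A' B').
Proof.
  intros.
  assert (eq_ty Γ large (Prod A B)⟦sg⟧ (Prod A' B')) by (eapply Prod_ev; mtt).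
  assert (T : eq_ty (Γ,,A⟦sg⟧) large B⟦swk⟧⟦slift 𝟙 sg⟧ B'⟦swk⟧)
    by (eapply TSub_lift_sub_hid; mtt).
  eapply eq_tm_trans.
  - eapply eq_tm_conv; [eapply eq_tpair_sub; mtt|eassumption].
    eapply wf_tm_conv_sym; [eassumption|]. eapply TSub_swk_sone with (A := A); mtt.
  - eapply eq_tm_conv; [apply eq_tpair|]; mtt.
    + eapply eq_tm_conv_sym; mtt.
    + eapply eq_tm_conv_sym; [eassumption|].
      eapply eq_ty_trans; [eapply eq_TSub_ty; [|exact T]|]; mtt.
      eapply TSub_swk_sone with (A := A⟦sg⟧); mtt.
    + apply eq_TSig; mtt.
Qed.

Lemma eq_Prod_fst :
  wf_sub Γ sg Δ -> wf_ty Δ large A -> wf_ty Δ large B ->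
  eq_ty Γ large A⟦sg⟧ A' -> eq_ty Γ large B⟦sg⟧ B' ->
  eq_ty Γ large (TSig A⟦sg⟧ B⟦swk⟧⟦slift 𝟙 sg⟧) (Prod A' B').
Proof.
  intros. apply eq_TSig; mtt. eapply TSub_lift_sub_hid; mtt.
Qed.

Lemma nfst_ev :
  wf_sub Γ sg Δ -> wf_ty Δ large A -> wf_ty Δ large B -> wf_tm Δ M (Prod A B) ->
  eq_ty Γ large A⟦sg⟧ A' -> eq_ty Γ large B⟦sg⟧ B' ->
  eq_tm Γ M⟪sg⟫ M' (Prod A' B') ->
  eq_tm Γ (nfst A B M)⟪sg⟫ (nfst A' B' M') A'.
Proof.
  intros.
  assert (eq_ty Γ large (TSig A⟦sg⟧ B⟦swk⟧⟦slift 𝟙 sg⟧) (Prod A' B')) by (apply eq_Prod_fst; auto).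
  assert (eq_ty (Γ,,A⟦sg⟧) large B⟦swk⟧⟦slift 𝟙 sg⟧ B'⟦swk⟧)
    by (eapply TSub_lift_sub_hid; mtt).
  eapply eq_tm_conv; [|eassumption].
  eapply eq_tm_trans; [eapply eq_tfst_sub; mtt|].
  apply eq_tfst; mtt. eapply eq_tm_conv_sym; mtt.
Qed.

Lemma nsnd_ev :
  wf_sub Γ sg Δ -> wf_ty Δ large A -> wf_ty Δ large B -> wf_tm Δ M (Prod A B) ->
  eq_ty Γ large A⟦sg⟧ A' -> eq_ty Γ large B⟦sg⟧ B' ->
  eq_tm Γ M⟪sg⟫ M' (Prod A' B') ->
  eq_tm Γ (nsnd A B M)⟪sg⟫ (nsnd A' B' M') B'.
Proof.
  intros.
  assert (eq_ty Γ large (TSig A⟦sg⟧ B⟦swk⟧⟦slift 𝟙 sg⟧) (Prod A' B')) by (apply eq_Prod_fst; auto).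
  assert (T' : eq_ty (Γ,,A⟦sg⟧) large B⟦swk⟧⟦slift 𝟙 sg⟧ B'⟦swk⟧)
    by (eapply TSub_lift_sub_hid; mtt).
  eapply eq_tm_trans.
  - eapply eq_tm_conv; [eapply eq_tsnd_sub; mtt|].
    eapply eq_ty_trans; [eapply eq_TSub_ty; [|eapply TSub_swk_sone with (A := A)]|]; mtt.
  - eapply eq_tm_conv; [apply eq_tsnd|]; mtt.
    + eapply eq_tm_conv_sym; mtt.
    + assert (wf_tm Γ (tfst A⟦sg⟧ B⟦swk⟧⟦slift 𝟙 sg⟧ M⟪sg⟫) A⟦sg⟧).
      { eapply wf_tfst; mtt. eapply wf_tm_conv_sym; mtt. }
      eapply eq_ty_trans; [eapply eq_TSub_ty; [|exact T']|]; mtt.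
      eapply TSub_swk_sone with (A := A⟦sg⟧); mtt.
Qed.

End ProductsSub.

Lemma TMod_ev n m (Γ Δ : ctx m) l (mu : hom n m) A A' sg :
  wf_sub Γ sg Δ -> wf_ty (Δ,{mu}) l A -> eq_ty (Γ,{mu}) l A⟦slock sg mu⟧ A' ->
  eq_ty Γ l (TMod mu A)⟦sg⟧ (TMod mu A').
Proof.
  intros. eapply eq_ty_trans; [eapply eq_TMod_sub; mtt|]. apply eq_TMod; mtt.
Qed.

Lemma tmod_ev n m (Γ Δ : ctx m) (mu : hom n m) A A' M M' sg :
  wf_sub Γ sg Δ -> wf_tm (Δ,{mu}) M A -> eq_ty (Γ,{mu}) large A⟦slock sg mu⟧ A' ->
  eq_tm (Γ,{mu}) M⟪slock sg mu⟫ M' A' ->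
  eq_tm Γ (tmod mu M)⟪sg⟫ (tmod mu M') (TMod mu A').
Proof.
  intros. eapply eq_tm_trans.
  - eapply eq_tm_conv; [eapply eq_tmod_sub; mtt; mtt|]. eapply TMod_ev; mtt.
  - apply eq_tmod; mtt.
Qed.

Definition nlet n m (mu : hom n m) (A : ty n) (C : ty m) (M0 M1 : tm m) : tm m :=
  tlet 𝟙 mu A C⟦swk⟧ M0 M1.

Section Let.
Variables (n m : mode) (mu : hom n m) (Γ Δ : ctx m) (A A' : ty n) (C C' : ty m)
  (M0 M0' M1 M1' : tm m) (sg : sub m).

Lemma wf_nlet_swk :
  wf_ty (Γ,{mu}) large A -> wf_ty Γ large C -> wf_tm Γ M0 (TMod mu A) ->
  wf_tm (Γ,[mu ∣ A]) M1 C⟦swk⟧ -> wf_tm Γ (nlet mu A C M0 M1) C.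
Proof. intros. apply wf_nlet; mtt. Qed.

Lemma TSub_swk_smodv_comp l (D : ty m) :
  wf_ty (Γ,{mu}) large A -> wf_ctx Γ -> wf_ty Γ l D ->
  eq_ty (Γ,[𝟙 ∘ mu ∣ A]) l D⟦swk⟧⟦smodv 𝟙 mu⟧ D⟦swk⟧.
Proof.
  intros. eapply eq_ty_ctx; [apply TSub_swk_smodv with (A := A); mtt|apply eq_ctx_ext_id_l; mtt].
  all: mtt.
Qed.

Lemma wf_ty_nlet_A : wf_ty (Γ,{mu}) large A -> wf_ctx Γ -> wf_ty (Γ,{𝟙},{mu}) large A.
Proof. intros; apply wf_ty_lock_id; auto. Qed.

Lemma eq_ty_nlet_A : wf_ctx Γ -> eq_ty (Γ,{mu}) large A A' -> eq_ty (Γ,{𝟙},{mu}) large A A'.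
Proof. intros; eapply eq_ty_ctx; [eassumption|]. apply eq_clock; mtt. Qed.

Lemma wf_tm_nlet_body :
  wf_ctx Γ -> wf_ty (Γ,{mu}) large A -> wf_ty Γ large C -> wf_tm (Γ,[mu ∣ A]) M1 C⟦swk⟧ ->
  wf_tm (Γ,[𝟙 ∘ mu ∣ A]) M1 C⟦swk⟧⟦smodv 𝟙 mu⟧.
Proof.
  intros. eapply wf_tm_conv_sym; [|apply TSub_swk_smodv_comp; mtt].
  eapply wf_tm_ctx; [eassumption|apply eq_ctx_ext_id_l; mtt].
Qed.

Lemma nlet_beta N :
  wf_ty Γ large C -> wf_tm (Γ,{mu}) N A -> wf_tm (Γ,[mu ∣ A]) M1 C⟦swk⟧ ->
  eq_tm Γ (nlet mu A C (tmod mu N) M1) M1⟪sone mu N⟫ C.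
Proof.
  intros.
  assert (eq_ctx (Γ,{mu}) (Γ,{𝟙 ∘ mu})) by (apply eq_clock; mtt).
  assert (wf_tm (Γ,{𝟙},{mu}) N A) by (eapply wf_tm_ctx; [eassumption|apply eq_clock; mtt]).
  assert (wf_tm (Γ,[𝟙 ∘ mu ∣ A]) M1 C⟦swk⟧).
  { eapply wf_tm_ctx; [eassumption|apply eq_ctx_ext_id_l; mtt]. }
  eapply eq_tm_trans.
  - eapply eq_tm_conv; [apply eq_TMod_beta; mtt|eapply TSub_swk_sone with (A := TMod mu A); mtt].
    apply wf_tm_nlet_body; mtt.
  - assert (wf_sub Γ (sone (𝟙 ∘ mu) N) (Γ,[𝟙 ∘ mu ∣ A])) by (apply wf_sone; mtt).
    assert (eq_ty Γ large C⟦swk⟧⟦sone (𝟙 ∘ mu) N⟧ C).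
    { eapply eq_ty_trans; [eapply TSub_comp_eq; [| |eapply swk_sone with (A := A)|]; mtt|].
      apply eq_TSub_id; mtt. }
    eapply eq_tm_conv; [|eassumption].
    eapply eq_tsub; [|apply eq_tm_refl; eassumption].
    eapply eq_sone; mtt.
Qed.

End Let.

Lemma nlet_ev n m (mu : hom n m) (Γ Δ : ctx m) A A' C C' M0 M0' M1 M1' sg :
  wf_sub Γ sg Δ -> wf_ty (Δ,{mu}) large A -> wf_ty Δ large C ->
  wf_tm Δ M0 (TMod mu A) -> wf_tm (Δ,[mu ∣ A]) M1 C⟦swk⟧ ->
  eq_ty (Γ,{mu}) large A⟦slock sg mu⟧ A' -> eq_ty Γ large C⟦sg⟧ C' ->
  eq_tm Γ M0⟪sg⟫ M0' (TMod mu A') ->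
  eq_tm (Γ,[mu ∣ A']) M1⟪slift mu sg⟫ M1' C'⟦swk⟧ ->
  eq_tm Γ (nlet mu A C M0 M1)⟪sg⟫ (nlet mu A' C' M0' M1') C'.
Proof.
  intros.
  assert (wf_ty (Δ,{𝟙},{mu}) large A) by (apply wf_ty_nlet_A; mtt).
  (* The annotation that [eq_tlet_sub] produces for a let over [𝟙]; the extra lock by [𝟙] vanishes
     only up to equality. *)
  set (A1 := A⟦slock (slock sg 𝟙) mu⟧).
  assert (EA : eq_ty (Γ,{𝟙},{mu}) large A1 A').
  { eapply eq_ty_trans; [|eapply eq_ty_nlet_A; mtt].
    eapply eq_TSub_sub; [|eassumption].
    eapply eq_sub_ctx; [apply eq_slock with (mu := mu) (Γ := Γ) (Δ := Δ) (sg := slock sg 𝟙)| |]; mtt.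
    apply eq_slock_hid; mtt. }
  assert (EA' : eq_ty (Γ,{mu}) large A1 A').
  { eapply eq_ty_ctx; [eassumption|apply eq_clock; mtt]. }
  assert (eq_ty (Γ,{mu}) large A⟦slock sg mu⟧ A1) by (eapply eq_ty_trans; mtt).
  assert (L : eq_sub (Γ,[𝟙 ∘ mu ∣ A']) (slift (𝟙 ∘ mu) sg) (slift mu sg) (Δ,[mu ∣ A])).
  { apply eq_sub_sym.
    eapply eq_sub_ctx with (Γ := Γ,[mu ∣ A']) (Δ := Δ,[mu ∣ A]); [|apply eq_ctx_ext_id_l; mtt|mtt].
    apply eq_sext; mtt.
    apply eq_tm_refl. eapply wf_tm_conv_sym; [apply wf_tvar; mtt|].
    eapply eq_ty_trans; [eapply TSub_slock_comp; mtt|].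
    eapply eq_TSub_ty; [|eassumption]; mtt. }
  assert (K : eq_ctx (Γ,,(TMod mu A)⟦sg⟧) (Γ,,TMod mu A1)).
  { eapply eq_ctx_ext_hid; mtt. eapply TMod_ev; mtt. }
  assert (T : eq_ty (Γ,,TMod mu A1) large C⟦swk⟧⟦slift 𝟙 sg⟧ C'⟦swk⟧).
  { eapply TSub_lift_sub_hid with (A := TMod mu A); mtt. eapply TMod_ev; mtt. }
  assert (TM : eq_ty Γ large (TMod mu A1) (TMod mu A')) by (apply eq_TMod; mtt).
  assert (eq_ctx (Γ,[𝟙 ∘ mu ∣ A']) (Γ,[𝟙 ∘ mu ∣ A1])).
  { eapply eq_ctx_ext with (l := large); mtt. eapply eq_ty_ctx; [apply eq_ty_sym; eassumption|mtt]. }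
  assert (eq_tm Γ M0⟪slock sg 𝟙⟫ M0' (TMod mu A1)).
  { eapply eq_tm_conv_sym; [|eassumption]. eapply eq_tm_trans; [|eassumption].
    eapply eq_tm_conv; [eapply tm_slock_hid; mtt; mtt|].
    eapply TMod_ev; mtt. }
  assert (eq_ty Γ large C⟦swk⟧⟦sone 𝟙 M0⟧⟦sg⟧ C').
  { eapply eq_ty_trans; [|eassumption].
    eapply eq_TSub_ty; [eassumption|]. eapply TSub_swk_sone with (A := TMod mu A); mtt. }
  eapply eq_tm_trans.
  - eapply eq_tm_conv; [eapply eq_tlet_sub; mtt|]; mtt. apply wf_tm_nlet_body; mtt.
  - eapply eq_tm_conv; [apply eq_tlet with (A' := A') (C' := C'⟦swk⟧)|]; mtt.
    + eapply eq_tm_conv_sym with (B := C'⟦swk⟧).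
      * eapply eq_tm_ctx; [|eassumption].
        eapply eq_tm_trans; [|eapply eq_tm_ctx; [eassumption|apply eq_ctx_ext_id_l; mtt]].
        eapply eq_tm_conv; [eapply eq_tsub; [eassumption|mtt]|].
        eapply eq_ty_trans; [eapply eq_TSub_sub; [exact L|mtt]|].
        eapply eq_ty_ctx; [eapply TSub_lift_sub with (A := A) (A' := A'); mtt|apply eq_ctx_ext_id_l; mtt].
      * eapply eq_ty_trans; [eapply eq_TSub_ty; [|eassumption]|].
        { eapply wf_sub_ctx; [apply wf_smodv_hid with (A := A1) (Γ := Γ)
            |apply eq_ctx_ext_id_l|]; mtt. }
        apply TSub_swk_smodv_comp; mtt.
    + eapply eq_ty_trans; [eapply eq_TSub_ty; [|eassumption]; mtt|].
      eapply TSub_swk_sone with (A := TMod mu A1); mtt.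
Qed.

Section LockSub.
Variables (n m p : mode) (Γ Δ Θ : ctx m) (nu : hom p m) (mu : hom n m) (sg tau rho : sub m).

Lemma TSub_slock_comp_eq l T T' :
  wf_sub Γ tau Δ -> wf_sub Δ sg Θ -> eq_sub Γ (sg ⊙ tau) rho Θ -> wf_ty (Θ,{nu}) l T ->
  eq_ty (Γ,{nu}) l T⟦slock rho nu⟧ T' ->
  eq_ty (Γ,{nu}) l T⟦slock sg nu⟧⟦slock tau nu⟧ T'.
Proof.
  intros. eapply eq_ty_trans; [|eassumption]. eapply TSub_comp_eq; mtt; mtt.
  eapply eq_sub_trans; [apply eq_sub_sym; eapply eq_slock_scomp; mtt|].
  apply eq_slock; mtt.
Qed.

Lemma tsub_slock_comp_eq M M' T T' :
  wf_sub Γ tau Δ -> wf_sub Δ sg Θ -> eq_sub Γ (sg ⊙ tau) rho Θ -> wf_tm (Θ,{nu}) M T ->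
  eq_ty (Γ,{nu}) large T⟦slock rho nu⟧ T' ->
  eq_tm (Γ,{nu}) M⟪slock rho nu⟫ M' T' ->
  eq_tm (Γ,{nu}) M⟪slock sg nu⟫⟪slock tau nu⟫ M' T'.
Proof.
  intros. eapply eq_tm_trans; [|eassumption]. eapply eq_tm_conv; [|eassumption].
  eapply tsub_comp_eq; mtt; mtt.
  eapply eq_sub_trans; [apply eq_sub_sym; eapply eq_slock_scomp; mtt|].
  apply eq_slock; mtt.
Qed.

End LockSub.

Lemma tsub_slock_sid n m (Γ : ctx m) (mu : hom n m) M A :
  wf_ctx Γ -> wf_tm (Γ,{mu}) M A -> eq_tm (Γ,{mu}) M⟪slock sid mu⟫ M A.
Proof.
  intros. eapply eq_tm_trans; [|apply eq_tsub_id; mtt].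
  eapply eq_tm_conv; [eapply eq_tsub; [apply eq_slock_sid; mtt|mtt]|].
  apply TSub_slock_sid; mtt.
Qed.

Lemma tm_comp_ev m (Γ Δ Θ : ctx m) sg tau rho M M' T T' :
  wf_sub Γ tau Δ -> wf_sub Δ sg Θ -> eq_sub Γ (sg ⊙ tau) rho Θ -> wf_tm Θ M T ->
  eq_ty Γ large T⟦rho⟧ T' -> eq_tm Γ M⟪rho⟫ M' T' ->
  eq_tm Γ M⟪sg⟫⟪tau⟫ M' T'.
Proof.
  intros. eapply eq_tm_trans; [|eassumption]. eapply eq_tm_conv; [|eassumption].
  eapply tsub_comp_eq; mtt; mtt.
Qed.

Lemma ty_comp_ev m (Γ Δ Θ : ctx m) l sg tau rho T T' :
  wf_sub Γ tau Δ -> wf_sub Δ sg Θ -> eq_sub Γ (sg ⊙ tau) rho Θ -> wf_ty Θ l T ->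
  eq_ty Γ l T⟦rho⟧ T' -> eq_ty Γ l T⟦sg⟧⟦tau⟧ T'.
Proof.
  intros. eapply eq_ty_trans; [|eassumption]. eapply TSub_comp_eq; mtt.
Qed.

(** * Modal application *)

Section AstBody.
Variables (n m : mode) (mu : hom n m) (Γ Δ : ctx m) (A A' B B' : ty n) (sg : sub m).
Hypotheses (wΓ : wf_ctx Γ) (wA : wf_ty (Γ,{mu}) large A) (wB : wf_ty (Γ,{mu}) large B).

Notation w := (slock swk mu).
Notation body A B := (tmod mu (napp A⟦w⟧⟦w⟧ B⟦w⟧⟦w⟧ tvar⟪w⟫ tvar)).

Lemma wf_ast_fun :
  wf_tm (Γ,[mu ∣ Arrow A B],[mu ∣ A⟦w⟧],{mu}) tvar⟪w⟫ (Arrow A⟦w⟧⟦w⟧ B⟦w⟧⟦w⟧).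
Proof.
  assert (wf_tm (Γ,[mu ∣ Arrow A B],{mu}) tvar (Arrow A B)⟦w⟧) by (apply wf_tvar; mtt).
  eapply wf_tm_conv; [eapply wf_tsub; mtt|].
  eapply eq_ty_trans; [eapply eq_TSub_ty; [|eapply Arrow_ev]|eapply Arrow_ev]; mtt; mtt.
Qed.

Lemma wf_ast_body :
  wf_tm (Γ,[mu ∣ Arrow A B],[mu ∣ A⟦w⟧]) (body A B) (TMod mu B⟦w⟧⟦w⟧).
Proof.
  pose proof wf_ast_fun.
  assert (wf_tm (Γ,[mu ∣ Arrow A B],[mu ∣ A⟦w⟧],{mu}) tvar A⟦w⟧⟦w⟧) by (apply wf_tvar; mtt).
  apply wf_tmod; mtt. apply wf_napp; mtt.
Qed.

(** The inner body of [ast] in an arbitrary environment holding function and argument. With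
    [sg = sid] it serves [ast_beta], and with [sg] followed by two weakenings it serves [ast_ev]. *)
Lemma ast_body_sub F N :
  wf_sub Δ sg Γ ->
  eq_ty (Δ,{mu}) large A⟦slock sg mu⟧ A' -> eq_ty (Δ,{mu}) large B⟦slock sg mu⟧ B' ->
  wf_tm (Δ,{mu}) F (Arrow A' B') -> wf_tm (Δ,{mu}) N A' ->
  eq_tm Δ (body A B)⟪sext mu (sext mu sg F) N⟫ (tmod mu (napp A' B' F N)) (TMod mu B').
Proof.
  intros.
  assert (wF : wf_tm (Δ,{mu}) F (Arrow A B)⟦slock sg mu⟧).
  { eapply wf_tm_conv_sym; [eassumption|]. eapply Arrow_ev; mtt. }
  assert (W1 : wf_sub Δ (sext mu sg F) (Γ,[mu ∣ Arrow A B])) by (apply wf_sext; mtt).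
  assert (E1 : eq_sub Δ (swk ⊙ sext mu sg F) sg Γ)
    by (eapply eq_swk_sext with (A := Arrow A B); mtt).
  assert (TA : eq_ty (Δ,{mu}) large A⟦w⟧⟦slock (sext mu sg F) mu⟧ A')
    by (eapply TSub_slock_comp_eq; mtt).
  assert (TB : eq_ty (Δ,{mu}) large B⟦w⟧⟦slock (sext mu sg F) mu⟧ B')
    by (eapply TSub_slock_comp_eq; mtt).
  assert (wN : wf_tm (Δ,{mu}) N A⟦w⟧⟦slock (sext mu sg F) mu⟧) by mtt.
  assert (W2 : wf_sub Δ (sext mu (sext mu sg F) N) (Γ,[mu ∣ Arrow A B],[mu ∣ A⟦w⟧]))
    by (apply wf_sext; mtt).
  assert (E2 : eq_sub Δ (swk ⊙ sext mu (sext mu sg F) N) (sext mu sg F) (Γ,[mu ∣ Arrow A B]))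
    by (eapply eq_swk_sext with (A := A⟦w⟧); mtt).
  assert (TA2 : eq_ty (Δ,{mu}) large A⟦w⟧⟦w⟧⟦slock (sext mu (sext mu sg F) N) mu⟧ A')
    by (eapply TSub_slock_comp_eq; mtt).
  assert (TB2 : eq_ty (Δ,{mu}) large B⟦w⟧⟦w⟧⟦slock (sext mu (sext mu sg F) N) mu⟧ B')
    by (eapply TSub_slock_comp_eq; mtt).
  assert (W := wf_ast_fun).
  assert (wv : wf_tm (Γ,[mu ∣ Arrow A B],[mu ∣ A⟦w⟧],{mu}) tvar A⟦w⟧⟦w⟧) by (apply wf_tvar; mtt).
  assert (wv1 : wf_tm (Γ,[mu ∣ Arrow A B],{mu}) tvar (Arrow A B)⟦w⟧) by (apply wf_tvar; mtt).
  eapply tmod_ev; mtt; mtt; [apply wf_napp; mtt|].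
  eapply napp_ev; mtt; mtt.
  - eapply tsub_slock_comp_eq with (T := (Arrow A B)⟦w⟧); mtt.
    + eapply TSub_slock_comp_eq; mtt. eapply Arrow_ev; mtt.
    + eapply eq_tm_conv; [eapply eq_tvar_sub; mtt; mtt|]. eapply Arrow_ev; mtt.
  - eapply eq_tm_conv; [eapply eq_tvar_sub; mtt; mtt|]; mtt.
Qed.

End AstBody.

Section Ast.
Variables (n m : mode) (mu : hom n m) (Γ Δ : ctx m) (A A' B B' : ty n)
  (f f' a a' : tm m) (sg : sub m).

Notation w := (slock swk mu).

Lemma wf_ast_inner : wf_ty (Γ,{mu}) large A -> wf_ty (Γ,{mu}) large B ->
  wf_tm Γ a (TMod mu A) ->
  wf_tm (Γ,[mu ∣ Arrow A B]) (nlet mu A⟦w⟧ (TMod mu B)⟦swk⟧ a⟪swk⟫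
    (tmod mu (napp A⟦w⟧⟦w⟧ B⟦w⟧⟦w⟧ tvar⟪w⟫ tvar))) (TMod mu B)⟦swk⟧.
Proof.
  intros.
  apply wf_nlet_swk; mtt.
  - eapply wf_tm_conv; [eapply wf_tsub; mtt|]. eapply TMod_ev; mtt.
  - eapply wf_tm_conv_sym; [apply wf_ast_body; mtt|].
    eapply eq_ty_trans; [eapply eq_TSub_ty; [|eapply TMod_ev]|eapply TMod_ev]; mtt; mtt.
Qed.

Lemma wf_ast : wf_ty (Γ,{mu}) large B ->
  wf_ty (Γ,{mu}) large A -> wf_tm Γ f (TMod mu (Arrow A B)) -> wf_tm Γ a (TMod mu A) ->
  wf_tm Γ (ast mu A B f a) (TMod mu B).
Proof.
  intros.
  apply wf_nlet_swk; mtt. apply wf_ast_inner; mtt.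
Qed.

Lemma ast_ev :
  wf_sub Δ sg Γ -> wf_ty (Γ,{mu}) large A -> wf_ty (Γ,{mu}) large B ->
  wf_tm Γ f (TMod mu (Arrow A B)) -> wf_tm Γ a (TMod mu A) ->
  eq_ty (Δ,{mu}) large A⟦slock sg mu⟧ A' -> eq_ty (Δ,{mu}) large B⟦slock sg mu⟧ B' ->
  eq_tm Δ f⟪sg⟫ f' (TMod mu (Arrow A' B')) -> eq_tm Δ a⟪sg⟫ a' (TMod mu A') ->
  eq_tm Δ (ast mu A B f a)⟪sg⟫ (ast mu A' B' f' a') (TMod mu B').
Proof.
  intros.
  assert (eq_ty (Δ,{mu}) large (Arrow A B)⟦slock sg mu⟧ (Arrow A' B')) by (eapply Arrow_ev; mtt).
  assert (eq_ty Δ large (TMod mu A)⟦sg⟧ (TMod mu A')) by (eapply TMod_ev; mtt).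
  assert (eq_ty Δ large (TMod mu B)⟦sg⟧ (TMod mu B')) by (eapply TMod_ev; mtt).
  eapply nlet_ev with (A := Arrow A B); mtt. { apply wf_ast_inner; mtt. }
  set (Γ1 := Γ,[mu ∣ Arrow A B]). set (Δ1 := Δ,[mu ∣ Arrow A' B']).
  assert (wf_sub Γ1 swk Γ) by (unfold Γ1; mtt). assert (wf_sub Δ1 swk Δ) by (unfold Δ1; mtt).
  assert (L : wf_sub Δ1 (slift mu sg) Γ1) by (apply wf_slift_ev; mtt).
  assert (wvF : wf_tm (Δ1,{mu}) tvar (Arrow A B)⟦slock (sg ⊙ swk) mu⟧).
  { eapply wf_tm_conv_sym; [apply wf_tvar; mtt|].
    eapply eq_ty_trans; [eapply TSub_slock_comp; mtt|]. eapply eq_TSub_ty; [|eassumption]; mtt. }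
  assert (E : eq_sub Δ1 (swk ⊙ slift mu sg) (sg ⊙ swk) Γ)
    by (eapply eq_swk_sext with (A := Arrow A B); mtt).
  assert (TA : eq_ty (Δ1,{mu}) large A⟦w⟧⟦slock (slift mu sg) mu⟧ A'⟦w⟧).
  { eapply TSub_slock_comp_eq; mtt. eapply eq_ty_trans; [eapply TSub_slock_comp; mtt|].
    eapply eq_TSub_ty; [|eassumption]; mtt. }
  assert (TB : eq_ty (Δ1,{mu}) large B⟦w⟧⟦slock (slift mu sg) mu⟧ B'⟦w⟧).
  { eapply TSub_slock_comp_eq; mtt. eapply eq_ty_trans; [eapply TSub_slock_comp; mtt|].
    eapply eq_TSub_ty; [|eassumption]; mtt. }
  assert (TB1 : eq_ty Δ1 large (TMod mu B)⟦swk⟧⟦slift mu sg⟧ (TMod mu B')⟦swk⟧)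
    by (eapply TSub_lift_sub with (A := Arrow A B); mtt).
  assert (wa : wf_tm Γ1 a⟪swk⟫ (TMod mu A⟦w⟧)).
  { eapply wf_tm_conv; [eapply wf_tsub; mtt|]. eapply TMod_ev; mtt. }
  eapply nlet_ev; mtt.
  - eapply wf_tm_conv_sym; [apply wf_ast_body; mtt|].
    eapply eq_ty_trans; [eapply eq_TSub_ty; [|eapply TMod_ev]|eapply TMod_ev]; mtt; mtt.
  - eapply tm_comp_ev with (T := TMod mu A); mtt.
    + eapply eq_ty_trans; [eapply eq_TSub_comp; mtt|].
      eapply eq_ty_trans; [eapply eq_TSub_ty; [|eassumption]; mtt|]. eapply TMod_ev; mtt.
    + eapply eq_tm_trans; [eapply eq_tm_conv; [eapply eq_tsub_comp; mtt|]|].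
      * eapply eq_ty_trans; [eapply eq_TSub_comp; mtt|].
        eapply eq_ty_trans; [eapply eq_TSub_ty; [|eassumption]; mtt|]. eapply TMod_ev; mtt.
      * eapply eq_tm_conv; [eapply eq_tsub; [mtt|eassumption]|]. eapply TMod_ev; mtt.
  - set (Γ2 := Γ1,[mu ∣ A⟦w⟧]). set (Δ2 := Δ1,[mu ∣ A'⟦w⟧]).
    assert (wf_sub Γ2 swk Γ1) by (unfold Γ2; mtt).
    assert (wf_sub Δ2 swk Δ1) by (unfold Δ2; mtt).
    assert (L2 : wf_sub Δ2 (slift mu (slift mu sg)) Γ2) by (apply wf_slift_ev; mtt).
    assert (X : eq_sub Δ2 (slift mu sg ⊙ swk) (sext mu (sg ⊙ swk ⊙ swk) tvar⟪w⟫) Γ1)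
      by (eapply eq_sext_comp; mtt).
    (* The double lift is rewritten as an environment ending in the two bound variables, the form in
       which [ast_body_sub] applies. *)
    assert (Y : eq_sub Δ2 (slift mu (slift mu sg))
      (sext mu (sext mu (sg ⊙ swk ⊙ swk) tvar⟪w⟫) tvar) Γ2).
    { apply eq_sext; mtt.
      apply eq_tm_refl. eapply wf_tm_conv_sym; [apply wf_tvar; mtt|].
      eapply eq_ty_trans; [eapply TSub_slock_comp; mtt|]. eapply eq_TSub_ty; [|eassumption]; mtt. }
    assert (TB2 : eq_ty Δ2 large (TMod mu B')⟦swk⟧⟦swk⟧ (TMod mu B'⟦w⟧⟦w⟧)).
    { eapply eq_ty_trans; [eapply eq_TSub_ty; [|eapply TMod_ev]|eapply TMod_ev]; mtt; mtt. }
    assert (TB3 : eq_ty Γ2 large (TMod mu B)⟦swk⟧⟦swk⟧ (TMod mu B⟦w⟧⟦w⟧)).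
    { eapply eq_ty_trans; [eapply eq_TSub_ty; [|eapply TMod_ev]|eapply TMod_ev]; mtt; mtt. }
    assert (TT : forall T T', wf_ty (Γ,{mu}) large T ->
      eq_ty (Δ,{mu}) large T⟦slock sg mu⟧ T' ->
      eq_ty (Δ2,{mu}) large T⟦slock (sg ⊙ swk ⊙ swk) mu⟧ T'⟦w⟧⟦w⟧).
    { intros. eapply eq_ty_trans; [eapply TSub_slock_comp; mtt|].
      eapply eq_TSub_ty; [mtt|]. eapply eq_ty_trans; [eapply TSub_slock_comp; mtt|].
      eapply eq_TSub_ty; [|eassumption]; mtt. }
    assert (wb := wf_ast_body (mu := mu) (Γ := Γ) (A := A) (B := B)).
    eapply eq_tm_conv_sym; [|exact TB2].
    assert (TB4 : eq_ty Δ2 large (TMod mu B⟦w⟧⟦w⟧)⟦slift mu (slift mu sg)⟧ (TMod mu B'⟦w⟧⟦w⟧)).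
    { eapply eq_ty_trans; [eapply eq_TSub_ty; [|apply eq_ty_sym; exact TB3]; mtt|].
      eapply eq_ty_trans; [eapply TSub_lift_sub with (A := A⟦w⟧); mtt|]; mtt. }
    eapply eq_tm_trans; [eapply eq_tm_conv; [eapply eq_tsub; [exact Y|apply eq_tm_refl, wb]|]|]; mtt.
    eapply ast_body_sub with (Γ := Γ); mtt.
    + apply TT; mtt.
    + apply TT; mtt.
    + apply wf_ast_fun; mtt.
    + apply wf_tvar; mtt.
Qed.

End Ast.

Section AstBeta.
Variables (n m : mode) (mu : hom n m) (Γ : ctx m) (A B : ty n) (F N : tm n).

Notation w := (slock swk mu).

(** Both lets reduce in turn; between the two reductions [sone mu F] must be pushed under the binder
    of the inner let. *)
Lemma ast_beta : wf_ctx Γ ->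
  wf_ty (Γ,{mu}) large A -> wf_ty (Γ,{mu}) large B ->
  wf_tm (Γ,{mu}) F (Arrow A B) -> wf_tm (Γ,{mu}) N A ->
  eq_tm Γ (ast mu A B (tmod mu F) (tmod mu N)) (tmod mu (napp A B F N)) (TMod mu B).
Proof.
  intros.
  assert (wN : wf_tm Γ (tmod mu N) (TMod mu A)) by mtt.
  assert (wF : wf_tm (Γ,{mu}) F (Arrow A B)⟦slock sid mu⟧).
  { eapply wf_tm_conv_sym; [eassumption|]. apply TSub_slock_sid; mtt. }
  assert (S : wf_sub Γ (sone mu F) (Γ,[mu ∣ Arrow A B])) by (apply wf_sone; mtt).
  assert (E : eq_sub Γ (swk ⊙ sone mu F) sid Γ) by (apply swk_sone with (A := Arrow A B); mtt).
  assert (TA : eq_ty (Γ,{mu}) large A⟦w⟧⟦slock (sone mu F) mu⟧ A).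
  { eapply TSub_slock_comp_eq; mtt. apply TSub_slock_sid; mtt. }
  assert (TC : forall l C, wf_ty Γ l C -> eq_ty Γ l C⟦swk⟧⟦sone mu F⟧ C).
  { intros. eapply ty_comp_ev; mtt. apply eq_TSub_id; mtt. }
  eapply eq_tm_trans; [apply nlet_beta with (A := Arrow A B); mtt; apply wf_ast_inner; mtt|].
  assert (wb : wf_tm (Γ,[mu ∣ Arrow A B],[mu ∣ A⟦w⟧])
    (tmod mu (napp A⟦w⟧⟦w⟧ B⟦w⟧⟦w⟧ tvar⟪w⟫ tvar)) (TMod mu B)⟦swk⟧⟦swk⟧).
  { eapply wf_tm_conv_sym; [apply wf_ast_body; mtt|].
    eapply eq_ty_trans; [eapply eq_TSub_ty; [|eapply TMod_ev]|eapply TMod_ev]; mtt; mtt. }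
  assert (L : wf_sub (Γ,[mu ∣ A]) (slift mu (sone mu F)) (Γ,[mu ∣ Arrow A B],[mu ∣ A⟦w⟧]))
    by (apply wf_slift_ev; mtt).
  assert (TL : eq_ty (Γ,[mu ∣ A]) large (TMod mu B)⟦swk⟧⟦swk⟧⟦slift mu (sone mu F)⟧ (TMod mu B)⟦swk⟧).
  { eapply TSub_lift_sub with (A := A⟦w⟧); mtt. apply TC; mtt. }
  assert (wf_tm (Γ,[mu ∣ A])
    (tmod mu (napp A⟦w⟧⟦w⟧ B⟦w⟧⟦w⟧ tvar⟪w⟫ tvar))⟪slift mu (sone mu F)⟫ (TMod mu B)⟦swk⟧).
  { eapply wf_tm_conv; [eapply wf_tsub; mtt|]. mtt. }
  assert (wa : wf_tm (Γ,[mu ∣ Arrow A B]) (tmod mu N)⟪swk⟫ (TMod mu A⟦w⟧)).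
  { eapply wf_tm_conv; [eapply wf_tsub; mtt|]. eapply TMod_ev; mtt. }
  eapply eq_tm_trans; [eapply nlet_ev with (A' := A) (M0' := tmod mu N); mtt|]; mtt.
  - apply TC; mtt.
  - eapply tm_comp_ev with (rho := sid); mtt.
    + apply eq_TSub_id; mtt.
    + apply eq_tsub_id; mtt.
  - eapply eq_tm_trans; [apply nlet_beta; mtt|].
    assert (X : eq_sub Γ (slift mu (sone mu F) ⊙ sone mu N) (sext mu (sone mu F) N)
      (Γ,[mu ∣ Arrow A B],[mu ∣ A⟦w⟧])).
    { apply slift_sone; mtt. }
    assert (S2 : wf_sub Γ (sone mu N) (Γ,[mu ∣ A])) by (apply wf_sone; mtt).
    assert (wf_tm (Γ,[mu ∣ Arrow A B],[mu ∣ A⟦w⟧])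
      (tmod mu (napp A⟦w⟧⟦w⟧ B⟦w⟧⟦w⟧ tvar⟪w⟫ tvar)) (TMod mu B⟦w⟧⟦w⟧))
      by (apply wf_ast_body; mtt).
    eapply tm_comp_ev with (T := (TMod mu B)⟦swk⟧⟦swk⟧); mtt.
    + assert (wf_sub Γ (sext mu (sone mu F) N) (Γ,[mu ∣ Arrow A B],[mu ∣ A⟦w⟧]))
        by (apply wf_sext; mtt).
      eapply ty_comp_ev; [| |eapply eq_swk_sext with (A := A⟦w⟧)| |]; mtt. apply TC; mtt.
    + apply ast_body_sub with (Γ := Γ); mtt; apply TSub_slock_sid; mtt.
Qed.

End AstBeta.

(** * [next], and extensionality of modal types *)

Lemma var0_sone m (Γ : ctx m) A M : wf_tm Γ M A -> eq_tm Γ tvar⟪sone 𝟙 M⟫ M A.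
Proof.
  intros.
  eapply eq_tm_conv; [apply var0_sext with (Δ := Γ) (A := A); mtt|apply eq_TSub_id; mtt].
  eapply wf_tm_conv_sym; [eassumption|]. apply eq_TSub_id; mtt.
Qed.

(** The let inside [next] eliminates [tmod 𝟙 M] and so reduces; the key then passes [sone 𝟙 M] by
    [key1l_nat]. Unfoldings of [tlob] are brought to this form, on which eliminators over ℓ
    reduce. *)
Lemma next_eq (Γ : ctx mt) A M :
  wf_tm Γ M A -> eq_tm Γ (next A M) (tmod ell M⟪key1l⟫) (Later A⟦key1l⟧).
Proof.
  intros.
  assert (wf_tm (Γ,,A) (tmod ell tvar⟪key1l⟫) (Later A⟦key1l⟧)⟦swk⟧).
  { eapply wf_tm_conv_sym; [|eapply Later_key1l_sub; mtt]. apply wf_tmod; mtt. }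
  eapply eq_tm_trans; [apply nlet_beta; mtt|].
  assert (T : eq_ty Γ large A⟦swk⟧⟦sone 𝟙 M⟧ A) by (apply TSub_swk_sone with (A := A); mtt).
  assert (wf_sub Γ (sone 𝟙 M) (Γ,,A)) by mtt.
  assert (eq_ty (Γ,{ell}) large A⟦swk⟧⟦key1l⟧⟦slock (sone 𝟙 M) ell⟧ A⟦key1l⟧).
  { eapply eq_ty_trans; [apply eq_ty_sym; eapply TSub_key1l; mtt|].
    eapply eq_TSub_ty; [|eassumption]; mtt. }
  eapply tmod_ev with (A := A⟦swk⟧⟦key1l⟧); mtt.
  assert (X : eq_sub (Γ,{ell}) (key1l ⊙ slock (sone 𝟙 M) ell) (sone 𝟙 M ⊙ key1l) (Γ,,A)).
  { apply eq_sub_sym, key1l_nat; mtt. }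
  assert (wf_tm (Γ,,A) tvar A⟦swk⟧) by mtt.
  assert (eq_ty (Γ,{ell}) large A⟦swk⟧⟦sone 𝟙 M⟧⟦key1l⟧ A⟦key1l⟧)
    by (eapply eq_TSub_ty; [|eassumption]; mtt).
  assert (eq_ty (Γ,{ell}) large A⟦swk⟧⟦sone 𝟙 M ⊙ key1l⟧ A⟦key1l⟧).
  { eapply eq_ty_trans; [eapply eq_TSub_comp; mtt|]; mtt. }
  eapply tm_comp_ev with (T := A⟦swk⟧); [| |exact X| | |]; mtt.
  eapply eq_tm_trans; [eapply eq_tm_conv; [eapply eq_tsub_comp; mtt|]|]; mtt.
  eapply eq_tsub; [apply eq_sub_refl; mtt|apply var0_sone; mtt].
Qed.

(* The modal eliminator into an extensional identity type: a term over
   [<mu | A>] is determined by its values on [mod_mu], although the modal types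
   have no eta rule. *)
Lemma TMod_ext n m (mu : hom n m) (Γ : ctx m) A C P Q M :
  wf_ty (Γ,{mu}) large A -> wf_tm (Γ,,TMod mu A) P C -> wf_tm (Γ,,TMod mu A) Q C ->
  eq_tm (Γ,[mu ∣ A]) P⟪smodv 𝟙 mu⟫ Q⟪smodv 𝟙 mu⟫ C⟦smodv 𝟙 mu⟧ ->
  wf_tm Γ M (TMod mu A) ->
  eq_tm Γ P⟪sone 𝟙 M⟫ Q⟪sone 𝟙 M⟫ C⟦sone 𝟙 M⟧.
Proof.
  intros.
  assert (wf_ty (Γ,{𝟙},{mu}) large A) by (apply wf_ty_nlet_A; mtt).
  assert (S : wf_sub Γ (sone 𝟙 M) (Γ,,TMod mu A)) by mtt.
  assert (V : wf_sub (Γ,[mu ∣ A]) (smodv 𝟙 mu) (Γ,,TMod mu A)) by (apply wf_smodv_hid; mtt).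
  apply eq_reflection with (P := tlet 𝟙 mu A (TEq C P Q) M (trefl P⟪smodv 𝟙 mu⟫)); mtt.
  eapply wf_tm_conv; [apply wf_tlet; mtt|eapply eq_TEq_sub; mtt].
  eapply wf_tm_ctx; [|apply eq_ctx_ext_id_l; mtt].
  eapply wf_tm_conv; [apply wf_trefl with (A := C⟦smodv 𝟙 mu⟧); mtt|].
  eapply eq_ty_trans; [|apply eq_ty_sym; eapply eq_TEq_sub; mtt].
  apply eq_TEq; mtt.
Qed.

Lemma TSub_comp_trans m (Γ Δ Θ : ctx m) l sg tau T T' T'' :
  wf_sub Γ tau Δ -> wf_sub Δ sg Θ -> wf_ty Θ l T ->
  eq_ty Δ l T⟦sg⟧ T' -> eq_ty Γ l T'⟦tau⟧ T'' -> eq_ty Γ l T⟦sg ⊙ tau⟧ T''.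
Proof.
  intros. eapply eq_ty_trans; [eapply eq_TSub_comp; mtt|].
  eapply eq_ty_trans; [eapply eq_TSub_ty|]; mtt.
Qed.

Lemma tsub_comp_trans m (Γ Δ Θ : ctx m) sg tau M M' M'' T T' T'' :
  wf_sub Γ tau Δ -> wf_sub Δ sg Θ -> wf_tm Θ M T ->
  eq_ty Δ large T⟦sg⟧ T' -> eq_ty Γ large T'⟦tau⟧ T'' ->
  eq_tm Δ M⟪sg⟫ M' T' -> eq_tm Γ M'⟪tau⟫ M'' T'' -> eq_tm Γ M⟪sg ⊙ tau⟫ M'' T''.
Proof.
  intros. assert (eq_ty Γ large T⟦sg ⊙ tau⟧ T'') by (eapply TSub_comp_trans; mtt; mtt).
  eapply eq_tm_trans; [|eassumption].
  eapply eq_tm_trans; [eapply eq_tm_conv; [eapply eq_tsub_comp; mtt|]; mtt|].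
  eapply eq_tm_conv; [eapply eq_tsub; mtt|]; mtt.
Qed.

(** * Commutativity of binary modal application *)

(** The shape of [app2], but over arbitrary types instead of decoded codes, because commutativity is
    also needed at [(TEl (Str' A))⟦key1l⟧]. *)
Definition app_two m (S R : ty m) (F u v : tm m) : tm m :=
  napp S R (napp S (Arrow S R) F u) v.

Definition ast_two n m (mu : hom n m) (S R : ty n) (F x y : tm m) : tm m :=
  ast mu S R (ast mu S (Arrow S R) F x) y.

(* Stability under substitution is built in, so that the property can be used
   under locks and binders. *)
Definition commutes m (Γ : ctx m) (S R : ty m) (F : tm m) : Prop :=
  forall (Δ : ctx m) sg S' R' F' u v,
  wf_sub Δ sg Γ -> eq_ty Δ large S⟦sg⟧ S' -> eq_ty Δ large R⟦sg⟧ R' ->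
  eq_tm Δ F⟪sg⟫ F' (Arrow S' (Arrow S' R')) -> wf_tm Δ u S' -> wf_tm Δ v S' ->
  eq_tm Δ (app_two S' R' F' u v) (app_two S' R' F' v u) R'.

Lemma Arrow2_ev m (Γ Δ : ctx m) A A' B B' sg :
  wf_sub Γ sg Δ -> wf_ty Δ large A -> wf_ty Δ large B ->
  eq_ty Γ large A⟦sg⟧ A' -> eq_ty Γ large B⟦sg⟧ B' ->
  eq_ty Γ large (Arrow A (Arrow A B))⟦sg⟧ (Arrow A' (Arrow A' B')).
Proof. intros; eapply Arrow_ev; mtt. eapply Arrow_ev; mtt. Qed.

Lemma commutes_sub m (Γ Δ : ctx m) S S' R R' F F' sg :
  wf_sub Δ sg Γ -> wf_ty Γ large S -> wf_ty Γ large R ->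
  wf_tm Γ F (Arrow S (Arrow S R)) ->
  eq_ty Δ large S⟦sg⟧ S' -> eq_ty Δ large R⟦sg⟧ R' ->
  eq_tm Δ F⟪sg⟫ F' (Arrow S' (Arrow S' R')) ->
  commutes Γ S R F -> commutes Δ S' R' F'.
Proof.
  intros W WS WR WF ES ER EF H Θ tau S1 R1 F1 u v X1 X2 X3 X4 X5 X6.
  apply H with (sg := sg ⊙ tau); mtt.
  - eapply TSub_comp_trans; mtt.
  - eapply TSub_comp_trans; mtt.
  - eapply tsub_comp_trans with (T' := Arrow S' (Arrow S' R')); mtt; eapply Arrow2_ev; mtt.
Qed.

Lemma commutes_app m (Γ : ctx m) S R F u v :
  wf_ty Γ large R -> wf_tm Γ F (Arrow S (Arrow S R)) -> wf_tm Γ u S -> wf_tm Γ v S ->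
  commutes Γ S R F -> eq_tm Γ (app_two S R F u v) (app_two S R F v u) R.
Proof.
  intros.
  match goal with H : commutes _ _ _ _ |- _ => apply H with (sg := sid) end; mtt.
  - apply eq_TSub_id; mtt.
  - apply eq_TSub_id; mtt.
  - apply eq_tsub_id; mtt.
Qed.

(** Congruence without reopening the two nested lets: the identity substitution is inserted, and
    [ast_ev] evaluates it with the primed components as chosen forms. *)
Lemma eq_ast n m (mu : hom n m) (Γ : ctx m) A A' B B' f f' a a' :
  eq_ty (Γ,{mu}) large A A' -> eq_ty (Γ,{mu}) large B B' ->
  eq_tm Γ f f' (TMod mu (Arrow A B)) -> eq_tm Γ a a' (TMod mu A) ->
  eq_tm Γ (ast mu A B f a) (ast mu A' B' f' a') (TMod mu B).
Proof.
  intros.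
  assert (eq_ty Γ large (TMod mu (Arrow A B)) (TMod mu (Arrow A' B'))).
  { apply eq_TMod; mtt. apply eq_Arrow; mtt. }
  assert (eq_ty Γ large (TMod mu A) (TMod mu A')) by (apply eq_TMod; mtt).
  assert (eq_ty Γ large (TMod mu B) (TMod mu B')) by (apply eq_TMod; mtt).
  assert (wf_tm Γ (ast mu A B f a) (TMod mu B)) by (apply wf_ast; mtt).
  eapply eq_tm_trans; [apply eq_tm_sym, eq_tsub_id; mtt|].
  eapply eq_tm_conv_sym; [|eassumption].
  eapply ast_ev with (Γ := Γ); mtt.
  - eapply eq_ty_trans; [apply TSub_slock_sid; mtt|]; mtt.
  - eapply eq_ty_trans; [apply TSub_slock_sid; mtt|]; mtt.
  - eapply eq_tm_conv; [|eassumption]. eapply eq_tm_trans; [apply eq_tsub_id|]; mtt.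
  - eapply eq_tm_conv; [|eassumption]. eapply eq_tm_trans; [apply eq_tsub_id|]; mtt.
Qed.

Section AstTwo.
Variables (n m : mode) (mu : hom n m).

Lemma wf_ast_two (Γ : ctx m) S R F x y :
  wf_ty (Γ,{mu}) large S -> wf_ty (Γ,{mu}) large R ->
  wf_tm Γ F (TMod mu (Arrow S (Arrow S R))) ->
  wf_tm Γ x (TMod mu S) -> wf_tm Γ y (TMod mu S) ->
  wf_tm Γ (ast_two mu S R F x y) (TMod mu R).
Proof.
  intros. apply wf_ast; mtt. apply wf_ast; mtt.
Qed.

Lemma ast_two_ev (Γ Δ : ctx m) S S' R R' F F' x x' y y' sg :
  wf_sub Δ sg Γ -> wf_ty (Γ,{mu}) large S -> wf_ty (Γ,{mu}) large R ->
  wf_tm Γ F (TMod mu (Arrow S (Arrow S R))) ->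
  wf_tm Γ x (TMod mu S) -> wf_tm Γ y (TMod mu S) ->
  eq_ty (Δ,{mu}) large S⟦slock sg mu⟧ S' -> eq_ty (Δ,{mu}) large R⟦slock sg mu⟧ R' ->
  eq_tm Δ F⟪sg⟫ F' (TMod mu (Arrow S' (Arrow S' R'))) ->
  eq_tm Δ x⟪sg⟫ x' (TMod mu S') -> eq_tm Δ y⟪sg⟫ y' (TMod mu S') ->
  eq_tm Δ (ast_two mu S R F x y)⟪sg⟫ (ast_two mu S' R' F' x' y') (TMod mu R').
Proof.
  intros.
  assert (eq_ty (Δ,{mu}) large (Arrow S R)⟦slock sg mu⟧ (Arrow S' R')) by (eapply Arrow_ev; mtt).
  eapply ast_ev with (Γ := Γ); mtt. { apply wf_ast; mtt. }
  eapply ast_ev with (Γ := Γ); mtt.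
Qed.

Lemma ast_two_beta (Γ : ctx m) S R F u v :
  wf_ctx Γ -> wf_ty (Γ,{mu}) large S -> wf_ty (Γ,{mu}) large R ->
  wf_tm (Γ,{mu}) F (Arrow S (Arrow S R)) -> wf_tm (Γ,{mu}) u S -> wf_tm (Γ,{mu}) v S ->
  eq_tm Γ (ast_two mu S R (tmod mu F) (tmod mu u) (tmod mu v))
    (tmod mu (app_two S R F u v)) (TMod mu R).
Proof.
  intros. assert (wf_tm (Γ,{mu}) (napp S (Arrow S R) F u) (Arrow S R)) by (apply wf_napp; mtt).
  eapply eq_tm_trans; [apply eq_ast; [| |apply ast_beta|]; mtt|].
  apply ast_beta; mtt.
Qed.

(** On introduced arguments both sides reduce to [tmod mu] of an application, where the
    commutativity of [F] behind the lock applies. *)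
Lemma ast_two_comm_mod (Γ : ctx m) S R F u v :
  wf_ctx Γ -> wf_ty (Γ,{mu}) large S -> wf_ty (Γ,{mu}) large R ->
  wf_tm (Γ,{mu}) F (Arrow S (Arrow S R)) -> wf_tm (Γ,{mu}) u S -> wf_tm (Γ,{mu}) v S ->
  commutes (Γ,{mu}) S R F ->
  eq_tm Γ (ast_two mu S R (tmod mu F) (tmod mu u) (tmod mu v))
    (ast_two mu S R (tmod mu F) (tmod mu v) (tmod mu u)) (TMod mu R).
Proof.
  intros.
  assert (eq_tm (Γ,{mu}) (app_two S R F u v) (app_two S R F v u) R) by (apply commutes_app; mtt).
  eapply eq_tm_trans; [apply ast_two_beta; mtt|].
  eapply eq_tm_trans; [|apply eq_tm_sym, ast_two_beta; mtt].
  apply eq_tmod; mtt.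
Qed.

(** [S], [R] and [F] are weakened past the variable about to be eliminated. Whichever [tau] fills
    that variable, only the composite [rho] of [swk] and [tau] matters for them. It is used with
    [tau] equal to [sone 𝟙 M] and to [smodv 𝟙 mu]. *)
Lemma ast_two_swk_ev (Γ Δ : ctx m) S S' R R' F F' x x' y y' tau rho :
  wf_sub Δ tau (Γ,,TMod mu S) -> eq_sub Δ (swk ⊙ tau) rho Γ ->
  wf_ty (Γ,{mu}) large S -> wf_ty (Γ,{mu}) large R ->
  wf_tm (Γ,{mu}) F (Arrow S (Arrow S R)) ->
  wf_tm (Γ,,TMod mu S) x (TMod mu S⟦slock swk mu⟧) ->
  wf_tm (Γ,,TMod mu S) y (TMod mu S⟦slock swk mu⟧) ->
  eq_ty (Δ,{mu}) large S⟦slock rho mu⟧ S' -> eq_ty (Δ,{mu}) large R⟦slock rho mu⟧ R' ->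
  eq_tm (Δ,{mu}) F⟪slock rho mu⟫ F' (Arrow S' (Arrow S' R')) ->
  eq_tm Δ x⟪tau⟫ x' (TMod mu S') -> eq_tm Δ y⟪tau⟫ y' (TMod mu S') ->
  wf_tm (Γ,,TMod mu S) (ast_two mu S⟦slock swk mu⟧ R⟦slock swk mu⟧
    (tmod mu F⟪slock swk mu⟫) x y) (TMod mu R⟦slock swk mu⟧) /\
  eq_tm Δ (ast_two mu S⟦slock swk mu⟧ R⟦slock swk mu⟧ (tmod mu F⟪slock swk mu⟫) x y)⟪tau⟫
    (ast_two mu S' R' (tmod mu F') x' y') (TMod mu R').
Proof.
  intros.
  assert (wf_ctx Γ).
  { match goal with H : wf_tm (Γ,{mu}) _ _ |- _ => idtac end.
    apply (wf_sub_wf_ctx_r (eq_sub_wf_r H0)). }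
  assert (wf_sub Δ rho Γ) by (eapply eq_sub_wf_r; eassumption).
  assert (wf_tm (Γ,,TMod mu S,{mu}) F⟪slock swk mu⟫
    (Arrow S⟦slock swk mu⟧ (Arrow S⟦slock swk mu⟧ R⟦slock swk mu⟧))).
  { eapply wf_tm_conv; [eapply wf_tsub; mtt|]. eapply Arrow2_ev; mtt. }
  assert (eq_ty (Δ,{mu}) large S⟦slock swk mu⟧⟦slock tau mu⟧ S')
    by (eapply TSub_slock_comp_eq; mtt).
  assert (eq_ty (Δ,{mu}) large R⟦slock swk mu⟧⟦slock tau mu⟧ R')
    by (eapply TSub_slock_comp_eq; mtt).
  split; [apply wf_ast_two; mtt|].
  eapply ast_two_ev; mtt.
  eapply tmod_ev; mtt. { eapply Arrow2_ev; mtt. }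
  eapply tsub_slock_comp_eq; mtt. eapply Arrow2_ev; mtt.
Qed.

(** [TMod_ext] for an equation between two applications. The eliminated variable may occur in any of
    the four argument positions, so each has three forms: generic over [Γ'], primed at the actual
    [M], and doubly primed at mod_mu of a variable. *)
Lemma ast_two_ext (Γ : ctx m) S R F M x1 x2 y1 y2 x1' x2' y1' y2' x1'' x2'' y1'' y2'' :
  wf_ctx Γ -> wf_ty (Γ,{mu}) large S -> wf_ty (Γ,{mu}) large R ->
  wf_tm (Γ,{mu}) F (Arrow S (Arrow S R)) -> wf_tm Γ M (TMod mu S) ->
  let Γ' := Γ,,TMod mu S in let Δ := Γ,[mu ∣ S] in let w := slock swk mu in
  wf_tm Γ' x1 (TMod mu S⟦w⟧) -> wf_tm Γ' x2 (TMod mu S⟦w⟧) ->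
  wf_tm Γ' y1 (TMod mu S⟦w⟧) -> wf_tm Γ' y2 (TMod mu S⟦w⟧) ->
  eq_tm Δ x1⟪smodv 𝟙 mu⟫ x1'' (TMod mu S⟦w⟧) -> eq_tm Δ x2⟪smodv 𝟙 mu⟫ x2'' (TMod mu S⟦w⟧) ->
  eq_tm Δ y1⟪smodv 𝟙 mu⟫ y1'' (TMod mu S⟦w⟧) -> eq_tm Δ y2⟪smodv 𝟙 mu⟫ y2'' (TMod mu S⟦w⟧) ->
  eq_tm Γ x1⟪sone 𝟙 M⟫ x1' (TMod mu S) -> eq_tm Γ x2⟪sone 𝟙 M⟫ x2' (TMod mu S) ->
  eq_tm Γ y1⟪sone 𝟙 M⟫ y1' (TMod mu S) -> eq_tm Γ y2⟪sone 𝟙 M⟫ y2' (TMod mu S) ->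
  eq_tm Δ (ast_two mu S⟦w⟧ R⟦w⟧ (tmod mu F⟪w⟫) x1'' y1'')
    (ast_two mu S⟦w⟧ R⟦w⟧ (tmod mu F⟪w⟫) x2'' y2'') (TMod mu R⟦w⟧) ->
  eq_tm Γ (ast_two mu S R (tmod mu F) x1' y1') (ast_two mu S R (tmod mu F) x2' y2') (TMod mu R).
Proof.
  intros wΓ wS wR wF wM Γ' Δ w wx1 wx2 wy1 wy2 ex1 ex2 ey1 ey2 fx1 fx2 fy1 fy2 E. subst w.
  assert (E1 : eq_sub Γ (swk ⊙ sone 𝟙 M) sid Γ) by (apply swk_sone with (A := TMod mu S); mtt).
  assert (E2 : eq_sub Δ (swk ⊙ smodv 𝟙 mu) swk Γ) by (apply swk_smodv; mtt).
  assert (W1 : wf_sub Γ (sone 𝟙 M) Γ') by (unfold Γ'; mtt).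
  assert (W2 : wf_sub Δ (smodv 𝟙 mu) Γ') by (apply wf_smodv_hid; mtt).
  assert (W3 : wf_sub Γ' swk Γ) by (unfold Γ'; mtt).
  assert (W4 : wf_sub Δ swk Γ) by (unfold Δ; mtt).
  assert (TS : eq_ty (Γ,{mu}) large S⟦slock sid mu⟧ S) by (apply TSub_slock_sid; mtt).
  assert (TR : eq_ty (Γ,{mu}) large R⟦slock sid mu⟧ R) by (apply TSub_slock_sid; mtt).
  assert (EF : eq_tm (Γ,{mu}) F⟪slock sid mu⟫ F (Arrow S (Arrow S R)))
    by (apply tsub_slock_sid; mtt).
  assert (wF' : wf_tm (Δ,{mu}) F⟪slock swk mu⟫ (Arrow S⟦slock swk mu⟧ (Arrow S⟦slock swk mu⟧ R⟦slock swk mu⟧))).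
  { eapply wf_tm_conv; [eapply wf_tsub; mtt|]. eapply Arrow2_ev; mtt. }
  assert (RS : eq_ty (Δ,{mu}) large S⟦slock swk mu⟧ S⟦slock swk mu⟧) by mtt.
  assert (RR : eq_ty (Δ,{mu}) large R⟦slock swk mu⟧ R⟦slock swk mu⟧) by mtt.
  assert (RF := eq_tm_refl wF').
  destruct (ast_two_swk_ev W1 E1 wS wR wF wx1 wy1 TS TR EF fx1 fy1) as [V1 Q1].
  destruct (ast_two_swk_ev W1 E1 wS wR wF wx2 wy2 TS TR EF fx2 fy2) as [V2 Q2].
  destruct (ast_two_swk_ev W2 E2 wS wR wF wx1 wy1 RS RR RF ex1 ey1) as [_ Q3].
  destruct (ast_two_swk_ev W2 E2 wS wR wF wx2 wy2 RS RR RF ex2 ey2) as [_ Q4].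
  assert (T1 : eq_ty Γ large (TMod mu R⟦slock swk mu⟧)⟦sone 𝟙 M⟧ (TMod mu R)).
  { eapply TMod_ev; mtt. eapply TSub_slock_comp_eq; mtt. }
  assert (T2 : eq_ty Δ large (TMod mu R⟦slock swk mu⟧)⟦smodv 𝟙 mu⟧ (TMod mu R⟦slock swk mu⟧)).
  { eapply TMod_ev; mtt. eapply TSub_slock_comp_eq; mtt. }
  eapply eq_tm_trans; [apply eq_tm_sym; exact Q1|].
  eapply eq_tm_trans; [|exact Q2].
  eapply eq_tm_conv; [|exact T1].
  eapply TMod_ext; [exact wS|exact V1|exact V2| |exact wM].
  eapply eq_tm_conv_sym; [|exact T2].
  eapply eq_tm_trans; [exact Q3|]. eapply eq_tm_trans; [eassumption|]. apply eq_tm_sym; exact Q4.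
Qed.

Lemma var0_smodv (Γ : ctx m) S : wf_ctx Γ -> wf_ty (Γ,{mu}) large S ->
  eq_tm (Γ,[mu ∣ S]) tvar⟪smodv 𝟙 mu⟫ (tmod mu tvar) (TMod mu S⟦slock swk mu⟧).
Proof.
  intros.
  assert (T : eq_ty (Γ,[mu ∣ S]) large (TMod mu S)⟦swk⟧ (TMod mu S⟦slock swk mu⟧))
    by (eapply TMod_ev; mtt).
  eapply eq_tm_conv; [apply var0_sext with (Δ := Γ) (A := TMod mu S)|exact T]; mtt.
  eapply wf_tm_conv_sym; [|exact T]. apply wf_tmod; mtt. apply wf_tvar; mtt.
Qed.

Lemma commutes_swk (Γ : ctx m) S R F : wf_ctx Γ -> wf_ty (Γ,{mu}) large S ->
  wf_ty (Γ,{mu}) large R -> wf_tm (Γ,{mu}) F (Arrow S (Arrow S R)) ->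
  commutes (Γ,{mu}) S R F ->
  let Δ := Γ,[mu ∣ S] in let w := slock swk mu in
  wf_tm (Δ,{mu}) F⟪w⟫ (Arrow S⟦w⟧ (Arrow S⟦w⟧ R⟦w⟧)) /\
  commutes (Δ,{mu}) S⟦w⟧ R⟦w⟧ F⟪w⟫.
Proof.
  intros. subst w. assert (W : wf_sub Δ swk Γ) by (unfold Δ; mtt).
  assert (wf_tm (Δ,{mu}) F⟪slock swk mu⟫
    (Arrow S⟦slock swk mu⟧ (Arrow S⟦slock swk mu⟧ R⟦slock swk mu⟧))).
  { eapply wf_tm_conv; [eapply wf_tsub; mtt|]. eapply Arrow2_ev; mtt. }
  split; mtt. eapply commutes_sub with (sg := slock swk mu); mtt.
  all: mtt.
Qed.

(** The halfway case: one argument is already [tmod mu u], and eliminating [y] leaves only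
    introduced arguments, as in [ast_two_comm_mod]. *)
Lemma ast_two_comm_mod_l (Γ : ctx m) S R F u y :
  wf_ty (Γ,{mu}) large S -> wf_ty (Γ,{mu}) large R ->
  wf_tm (Γ,{mu}) F (Arrow S (Arrow S R)) ->
  wf_tm (Γ,{mu}) u S -> wf_tm Γ y (TMod mu S) -> commutes (Γ,{mu}) S R F ->
  eq_tm Γ (ast_two mu S R (tmod mu F) (tmod mu u) y)
    (ast_two mu S R (tmod mu F) y (tmod mu u)) (TMod mu R).
Proof.
  intros.
  assert (W1 : wf_sub Γ (sone 𝟙 y) (Γ,,TMod mu S)) by mtt.
  assert (W2 : wf_sub (Γ,[mu ∣ S]) (smodv 𝟙 mu) (Γ,,TMod mu S)) by (apply wf_smodv_hid; mtt).
  assert (E1 : eq_sub Γ (swk ⊙ sone 𝟙 y) sid Γ) by (apply swk_sone with (A := TMod mu S); mtt).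
  assert (E2 : eq_sub (Γ,[mu ∣ S]) (swk ⊙ smodv 𝟙 mu) swk Γ) by (apply swk_smodv; mtt).
  assert (TS : eq_ty (Γ,{mu}) large S⟦slock sid mu⟧ S) by (apply TSub_slock_sid; mtt).
  assert (eq_ty (Γ,,TMod mu S) large (TMod mu S)⟦swk⟧ (TMod mu S⟦slock swk mu⟧))
    by (eapply TMod_ev; mtt).
  destruct (@commutes_swk Γ S R F) as [K1 K2]; mtt.
  assert (wf_tm (Γ,,TMod mu S) tvar (TMod mu S⟦slock swk mu⟧)).
  { eapply wf_tm_conv; [apply wf_var0; mtt|eassumption]. }
  assert (eq_tm (Γ,[mu ∣ S]) (tmod mu u⟪slock swk mu⟫)⟪smodv 𝟙 mu⟫
    (tmod mu u⟪slock swk mu⟫) (TMod mu S⟦slock swk mu⟧)).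
  { eapply tmod_ev with (A := S⟦slock swk mu⟧); mtt; [eapply TSub_slock_comp_eq|eapply tsub_slock_comp_eq]; mtt. }
  assert (eq_tm Γ (tmod mu u⟪slock swk mu⟫)⟪sone 𝟙 y⟫ (tmod mu u) (TMod mu S)).
  { eapply tmod_ev with (A := S⟦slock swk mu⟧); mtt; [eapply TSub_slock_comp_eq|eapply tsub_slock_comp_eq]; mtt.
    apply tsub_slock_sid; mtt. }
  eapply ast_two_ext with (M := y) (x1 := tmod mu u⟪slock swk mu⟫) (y1 := tvar)
    (x2 := tvar) (y2 := tmod mu u⟪slock swk mu⟫); mtt; try (apply var0_smodv; mtt);
    try (apply var0_sone; mtt).
  apply ast_two_comm_mod; mtt. apply wf_tvar; mtt.
Qed.

(** Eliminating [x] makes it [tmod mu tvar], and the halfway case finishes with [y] weakened. The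
    order matters: [y] is eliminated over a context that already contains the variable coming from
    [x]. *)
Lemma ast_two_comm (Γ : ctx m) S R F x y :
  wf_ty (Γ,{mu}) large S -> wf_ty (Γ,{mu}) large R ->
  wf_tm (Γ,{mu}) F (Arrow S (Arrow S R)) ->
  wf_tm Γ x (TMod mu S) -> wf_tm Γ y (TMod mu S) -> commutes (Γ,{mu}) S R F ->
  eq_tm Γ (ast_two mu S R (tmod mu F) x y) (ast_two mu S R (tmod mu F) y x) (TMod mu R).
Proof.
  intros.
  assert (W1 : wf_sub Γ (sone 𝟙 x) (Γ,,TMod mu S)) by mtt.
  assert (W2 : wf_sub (Γ,[mu ∣ S]) (smodv 𝟙 mu) (Γ,,TMod mu S)) by (apply wf_smodv_hid; mtt).
  assert (E1 : eq_sub Γ (swk ⊙ sone 𝟙 x) sid Γ) by (apply swk_sone with (A := TMod mu S); mtt).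
  assert (E2 : eq_sub (Γ,[mu ∣ S]) (swk ⊙ smodv 𝟙 mu) swk Γ) by (apply swk_smodv; mtt).
  assert (T1 : eq_ty (Γ,,TMod mu S) large (TMod mu S)⟦swk⟧ (TMod mu S⟦slock swk mu⟧))
    by (eapply TMod_ev; mtt).
  assert (T2 : eq_ty (Γ,[mu ∣ S]) large (TMod mu S)⟦swk⟧ (TMod mu S⟦slock swk mu⟧))
    by (eapply TMod_ev; mtt).
  destruct (@commutes_swk Γ S R F) as [K1 K2]; mtt.
  assert (wf_tm (Γ,,TMod mu S) tvar (TMod mu S⟦slock swk mu⟧)).
  { eapply wf_tm_conv; [apply wf_var0; mtt|eassumption]. }
  assert (wf_tm (Γ,,TMod mu S) y⟪swk⟫ (TMod mu S⟦slock swk mu⟧)).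
  { eapply wf_tm_conv; [eapply wf_tsub; mtt|eassumption]. }
  assert (wf_tm (Γ,[mu ∣ S]) y⟪swk⟫ (TMod mu S⟦slock swk mu⟧)).
  { eapply wf_tm_conv; [eapply wf_tsub; mtt|eassumption]. }
  assert (eq_tm (Γ,[mu ∣ S]) y⟪swk⟫⟪smodv 𝟙 mu⟫ y⟪swk⟫ (TMod mu S⟦slock swk mu⟧)).
  { eapply tm_comp_ev; mtt. }
  assert (eq_tm Γ y⟪swk⟫⟪sone 𝟙 x⟫ y (TMod mu S)).
  { eapply tm_comp_ev; mtt. apply eq_TSub_id; mtt. apply eq_tsub_id; mtt. }
  eapply ast_two_ext with (M := x) (x1 := tvar) (y1 := y⟪swk⟫)
    (x2 := y⟪swk⟫) (y2 := tvar); mtt; try (apply var0_smodv; mtt);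
    try (apply var0_sone; mtt).
  apply ast_two_comm_mod_l; mtt. apply wf_tvar; mtt.
Qed.

End AstTwo.

(** * Codes, and the operator whose fixed point is [Str'] *)

Lemma TU_ev m (Γ Δ : ctx m) sg : wf_sub Γ sg Δ -> eq_ty Γ large TU⟦sg⟧ TU.
Proof. intros; eapply eq_TU_sub; eassumption. Qed.

Lemma TEl_ev m (Γ Δ : ctx m) l M M' sg :
  wf_sub Γ sg Δ -> wf_tm Δ M TU -> eq_tm Γ M⟪sg⟫ M' TU ->
  eq_ty Γ l (TEl M)⟦sg⟧ (TEl M').
Proof.
  intros. eapply eq_ty_trans; [eapply eq_TEl_sub; mtt|]. apply eq_TEl; mtt.
Qed.

Lemma tcode_ev m (Γ Δ : ctx m) A A' sg :
  wf_sub Γ sg Δ -> wf_ty Δ small A -> eq_ty Γ small A⟦sg⟧ A' ->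
  eq_tm Γ (tcode A)⟪sg⟫ (tcode A') TU.
Proof.
  intros. eapply eq_tm_trans; [eapply eq_tcode_sub; mtt|]. apply eq_tcode; mtt.
Qed.

Lemma cmod_ev n m (mu : hom n m) (Γ Δ : ctx m) M M' sg :
  wf_sub Γ sg Δ -> wf_tm (Δ,{mu}) M TU -> eq_tm (Γ,{mu}) M⟪slock sg mu⟫ M' TU ->
  eq_tm Γ (cmod mu M)⟪sg⟫ (cmod mu M') TU.
Proof.
  intros. eapply tcode_ev; mtt. eapply TMod_ev; mtt. eapply TEl_ev; mtt.
Qed.

Lemma cprod_ev m (Γ Δ : ctx m) M M' N N' sg :
  wf_sub Γ sg Δ -> wf_tm Δ M TU -> wf_tm Δ N TU ->
  eq_tm Γ M⟪sg⟫ M' TU -> eq_tm Γ N⟪sg⟫ N' TU ->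
  eq_tm Γ (cprod M N)⟪sg⟫ (cprod M' N') TU.
Proof.
  intros. eapply tcode_ev; mtt. eapply Prod_ev; mtt; eapply TEl_ev; mtt.
Qed.

Lemma eq_cprod m (Γ : ctx m) M M' N N' :
  eq_tm Γ M M' TU -> eq_tm Γ N N' TU -> eq_tm Γ (cprod M N) (cprod M' N') TU.
Proof. intros. apply eq_tcode, eq_Prod; mtt; apply eq_TEl; mtt. Qed.

(** The definition of [Str'] writes the constant motive as [TU], where [nlet] has [TU⟦swk⟧].
    Congruence in the motive identifies the two lets. *)
Lemma tlet_nlet n m (mu : hom n m) (Γ : ctx m) A C D M0 M1 :
  wf_ty (Γ,{mu}) large A -> wf_ty Γ large C -> wf_tm Γ M0 (TMod mu A) ->
  wf_tm (Γ,[mu ∣ A]) M1 C⟦swk⟧ -> eq_ty (Γ,,TMod mu A) large C⟦swk⟧ D ->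
  eq_tm Γ (tlet 𝟙 mu A D M0 M1) (nlet mu A C M0 M1) C.
Proof.
  intros.
  assert (wf_ty (Γ,{𝟙},{mu}) large A) by (apply wf_ty_nlet_A; mtt).
  apply eq_tm_sym.
  eapply eq_tm_conv; [apply eq_tlet; mtt|eapply TSub_swk_sone with (A := TMod mu A); mtt].
  apply eq_tm_refl, wf_tm_nlet_body; mtt.
Qed.

Lemma nlam_beta m (Γ : ctx m) A B M N :
  wf_ty Γ large B -> wf_tm (Γ,,A) M B⟦swk⟧ -> wf_tm Γ N A ->
  eq_tm Γ (napp A B (tlam A M) N) M⟪sone 𝟙 N⟫ B.
Proof.
  intros. eapply eq_tm_conv; [apply eq_TPi_beta; mtt|eapply TSub_swk_sone with (A := A); mtt].
Qed.

(** The map ▷U → U that turns a delayed code into the code of a delayed type. *)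
Definition letcode (X : tm mt) : tm mt := tlet 𝟙 ell TU TU X (cmod ell tvar).
(** The operator whose guarded fixed point is [Str'], with its delayed argument made explicit so
    that instances of the body can be named. *)
Definition strF (A : tm ms) (X : tm mt) : tm mt := cprod (cmod del A) (letcode X).

Lemma wf_letcode_body (Γ : ctx mt) : wf_ctx Γ ->
  wf_tm (Γ,[ell ∣ TU],{ell}) tvar TU /\
  wf_tm (Γ,[ell ∣ TU]) (cmod ell tvar) TU /\
  wf_tm (Γ,[ell ∣ TU]) (cmod ell tvar) TU⟦swk⟧.
Proof.
  intros.
  assert (wf_tm (Γ,[ell ∣ TU],{ell}) tvar TU).
  { eapply wf_tm_conv; [apply wf_tvar; mtt|]. eapply TU_ev; mtt. }
  assert (wf_tm (Γ,[ell ∣ TU]) (cmod ell tvar) TU) by (unfold cmod; mtt).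
  repeat split; mtt. eapply wf_tm_conv_sym; [eassumption|]. eapply TU_ev; mtt.
Qed.

Lemma letcode_nlet (Γ : ctx mt) X : wf_tm Γ X (Later TU) ->
  eq_tm Γ (letcode X) (nlet ell TU TU X (cmod ell tvar)) TU.
Proof.
  intros. destruct (wf_letcode_body (Γ := Γ)) as (? & ? & ?); mtt.
  apply tlet_nlet; mtt. eapply TU_ev; mtt.
Qed.

Lemma wf_letcode (Γ : ctx mt) X : wf_tm Γ X (Later TU) -> wf_tm Γ (letcode X) TU.
Proof. intros. eapply eq_tm_wf_l, letcode_nlet; mtt. Qed.

Lemma letcode_ev (Γ Δ : ctx mt) X X' sg :
  wf_sub Γ sg Δ -> wf_tm Δ X (Later TU) -> eq_tm Γ X⟪sg⟫ X' (Later TU) ->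
  eq_tm Γ (letcode X)⟪sg⟫ (letcode X') TU.
Proof.
  intros.
  destruct (wf_letcode_body (Γ := Γ)) as (? & ? & ?); mtt.
  destruct (wf_letcode_body (Γ := Δ)) as (? & ? & ?); mtt.
  eapply eq_tm_trans; [|apply eq_tm_sym, letcode_nlet; mtt].
  eapply eq_tm_trans.
  { eapply eq_tm_conv; [eapply eq_tsub; [apply eq_sub_refl; mtt|apply letcode_nlet; mtt]|].
    eapply TU_ev; mtt. }
  assert (T : eq_ty (Γ,{ell}) large TU⟦slock sg ell⟧ TU) by (eapply TU_ev; mtt).
  assert (L : wf_sub (Γ,[ell ∣ TU]) (slift ell sg) (Δ,[ell ∣ TU])) by (apply wf_slift_ev; mtt).
  eapply nlet_ev; mtt; [eapply TU_ev; mtt|].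
  assert (T1 : eq_ty (Γ,[ell ∣ TU]) large TU⟦swk⟧ TU) by (eapply TU_ev; mtt).
  eapply eq_tm_conv_sym; [|exact T1]. eapply cmod_ev; mtt.
  assert (T2 : eq_ty (Γ,[ell ∣ TU],{ell}) large TU⟦slock (sg ⊙ swk) ell⟧ TU) by (eapply TU_ev; mtt).
  eapply eq_tm_conv; [eapply eq_tvar_sub; mtt; mtt|exact T2].
  all: mtt.
Qed.

Lemma letcode_beta (Γ : ctx mt) M : wf_ctx Γ -> wf_tm (Γ,{ell}) M TU ->
  eq_tm Γ (letcode (tmod ell M)) (cmod ell M) TU.
Proof.
  intros. destruct (wf_letcode_body (Γ := Γ)) as (? & ? & ?); mtt.
  eapply eq_tm_trans; [apply letcode_nlet; mtt|].
  { unfold Later; mtt. }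
  eapply eq_tm_trans; [apply nlet_beta; mtt|].
  assert (wf_sub Γ (sone ell M) (Γ,[ell ∣ TU])) by (apply wf_sone; mtt).
  assert (T : eq_ty (Γ,{ell}) large TU⟦slock sid ell⟧ TU) by (eapply TU_ev; mtt).
  eapply cmod_ev; mtt. eapply eq_tm_conv; [eapply eq_tvar_sub; mtt; mtt|exact T].
  all: mtt.
Qed.

Lemma wf_strF (Γ : ctx mt) A X : wf_tm (Γ,{del}) A TU -> wf_tm Γ X (Later TU) ->
  wf_tm Γ (strF A X) TU.
Proof.
  intros. assert (wf_tm Γ (letcode X) TU) by (apply wf_letcode; mtt).
  unfold strF, cprod, cmod; mtt.
Qed.

Lemma strF_ev (Γ Δ : ctx mt) A A' X X' sg :
  wf_sub Γ sg Δ -> wf_tm (Δ,{del}) A TU -> wf_tm Δ X (Later TU) ->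
  eq_tm (Γ,{del}) A⟪slock sg del⟫ A' TU -> eq_tm Γ X⟪sg⟫ X' (Later TU) ->
  eq_tm Γ (strF A X)⟪sg⟫ (strF A' X') TU.
Proof.
  intros.
  assert (wf_tm Δ (letcode X) TU) by (apply wf_letcode; mtt).
  eapply cprod_ev; mtt.
  - unfold cmod; mtt.
  - eapply cmod_ev; mtt.
  - eapply letcode_ev; mtt.
Qed.

Lemma tm_lock_TU n m (Γ Δ Θ : ctx m) (nu : hom n m) sg tau rho A A' :
  wf_sub Γ tau Δ -> wf_sub Δ sg Θ -> eq_sub Γ (sg ⊙ tau) rho Θ -> wf_tm (Θ,{nu}) A TU ->
  eq_tm (Γ,{nu}) A⟪slock rho nu⟫ A' TU ->
  eq_tm (Γ,{nu}) A⟪slock sg nu⟫⟪slock tau nu⟫ A' TU.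
Proof.
  intros. assert (wf_sub Γ rho Θ) by (eapply eq_sub_wf_r; mtt).
  eapply tsub_slock_comp_eq; mtt. eapply TU_ev; mtt.
Qed.

Lemma tm_lock_TU_trans n m (Γ Δ Θ : ctx m) (nu : hom n m) sg tau A A' A'' :
  wf_sub Γ tau Δ -> wf_sub Δ sg Θ -> wf_tm (Θ,{nu}) A TU ->
  eq_tm (Δ,{nu}) A⟪slock sg nu⟫ A' TU -> eq_tm (Γ,{nu}) A'⟪slock tau nu⟫ A'' TU ->
  eq_tm (Γ,{nu}) A⟪slock (sg ⊙ tau) nu⟫ A'' TU.
Proof.
  intros. eapply eq_tm_trans with (N := A⟪slock sg nu ⊙ slock tau nu⟫).
  - eapply eq_tm_conv; [eapply eq_tsub; [eapply eq_slock_scomp|]|]; mtt.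
    eapply TU_ev; mtt.
  - eapply tsub_comp_trans with (T := TU) (T' := TU); mtt; eapply TU_ev; mtt.
Qed.

(** * Guarded streams *)

Section StrRules.
Variables (Γ : ctx mt) (A : tm ms).
Hypotheses (wΓ : wf_ctx Γ) (wA : wf_tm (Γ,{del}) A TU).

Lemma Later_TU_key1l (Δ : ctx mt) : wf_ctx Δ -> eq_ty Δ large (Later TU⟦key1l⟧) (Later TU).
Proof. intros. apply eq_TMod; mtt. eapply TU_ev; mtt. Qed.

Lemma wf_Str'_body :
  wf_tm (Γ,,Later TU) (strF A⟪slock swk del⟫ tvar) TU /\
  wf_tm (Γ,,Later TU) (strF A⟪slock swk del⟫ tvar) TU⟦swk⟧ /\
  wf_tm (Γ,,Later TU) tvar (Later TU).
Proof.
  assert (wf_tm (Γ,,Later TU) tvar (Later TU)).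
  { eapply wf_tm_conv; [apply wf_var0; mtt|]. eapply TMod_ev; mtt. eapply TU_ev; mtt. }
  assert (wf_tm (Γ,,Later TU) (strF A⟪slock swk del⟫ tvar) TU) by (apply wf_strF; mtt).
  repeat split; mtt. eapply wf_tm_conv_sym; [eassumption|eapply TU_ev; mtt].
Qed.

Lemma wf_Str'_fun :
  wf_tm Γ (tlam (Later TU) (strF A⟪slock swk del⟫ tvar)) (Arrow (Later TU) TU) /\
  wf_tm Γ (tlam (Later TU) (strF A⟪slock swk del⟫ tvar)) (Arrow (Later TU⟦key1l⟧) TU).
Proof.
  destruct wf_Str'_body as (? & ? & ?).
  assert (wf_tm Γ (tlam (Later TU) (strF A⟪slock swk del⟫ tvar)) (Arrow (Later TU) TU)).
  { apply wf_nlam; mtt. }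
  split; mtt. eapply wf_tm_conv_sym; [eassumption|].
  assert (eq_ty Γ large (Later TU⟦key1l⟧) (Later TU)) by (apply Later_TU_key1l; mtt).
  apply eq_Arrow; mtt.
Qed.

Lemma wf_Str' : wf_tm Γ (Str' A) TU.
Proof. destruct wf_Str'_fun. apply wf_tlob; mtt. Qed.

(** [next] of the fixed point is [tmod ell] of its restriction along the key, and on such an
    argument [letcode] reduces. *)
Lemma Str'_unfold :
  eq_tm Γ (Str' A) (cprod (cmod del A) (cmod ell (Str' A)⟪key1l⟫)) TU.
Proof.
  destruct wf_Str'_fun as [K1 K2]. destruct wf_Str'_body as (K3 & K4 & K5).
  assert (W := wf_Str').
  assert (TL : eq_ty Γ large (Later TU⟦key1l⟧) (Later TU)) by (apply Later_TU_key1l; mtt).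
  assert (wn : wf_tm Γ (tmod ell (Str' A)⟪key1l⟫) (Later TU)) by (unfold Later; mtt).
  assert (wf_sub Γ (sone 𝟙 (tmod ell (Str' A)⟪key1l⟫)) (Γ,,Later TU)) by mtt.
  eapply eq_tm_trans; [apply eq_tlob_unfold; mtt|].
  eapply eq_tm_trans with (N := napp (Later TU) TU
    (tlam (Later TU) (strF A⟪slock swk del⟫ tvar)) (tmod ell (Str' A)⟪key1l⟫)).
  { apply eq_napp; mtt. apply next_eq; mtt. }
  eapply eq_tm_trans; [apply nlam_beta; mtt|].
  eapply eq_tm_trans; [eapply strF_ev with (A' := A); mtt|].
  - eapply tm_lock_TU with (rho := sid); mtt.
    + apply swk_sone with (A := Later TU); mtt.
    + apply tsub_slock_sid; mtt.
  - apply var0_sone; mtt.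
  - apply eq_cprod; [unfold cmod; mtt|]. apply letcode_beta; mtt.
Qed.

Lemma wf_StrHd l : wf_ty Γ l (StrHd A).
Proof. unfold StrHd; mtt. Qed.

Lemma wf_StrTl l : wf_ty Γ l (StrTl A).
Proof. assert (W := wf_Str'). unfold StrTl; mtt. Qed.

(** Equal codes decode to equal types. [zipWith'] is well typed only modulo this equation, since it
    projects from streams and builds them as pairs. *)
Lemma El_Str'_eq : eq_ty Γ large (TEl (Str' A)) (Prod (StrHd A) (StrTl A)).
Proof.
  assert (W := wf_Str').
  apply eq_ty_large.
  eapply eq_ty_trans; [apply eq_TEl, Str'_unfold|].
  eapply eq_ty_trans; [apply eq_TEl_code; unfold cmod; mtt|].
  assert (eq_ty Γ small (TEl (cmod del A)) (StrHd A)) by (apply eq_TEl_code, wf_StrHd).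
  assert (eq_ty Γ small (TEl (cmod ell (Str' A)⟪key1l⟫)) (StrTl A)).
  { eapply eq_ty_trans; [apply eq_TEl_code; unfold Later; mtt|]. apply eq_TMod; mtt.
    apply eq_ty_sym. eapply eq_TEl_sub; mtt. }
  apply eq_Prod; mtt.
Qed.

End StrRules.

Lemma Str'_ev (Γ Δ : ctx mt) A A' sg :
  wf_sub Γ sg Δ -> wf_tm (Δ,{del}) A TU -> eq_tm (Γ,{del}) A⟪slock sg del⟫ A' TU ->
  eq_tm Γ (Str' A)⟪sg⟫ (Str' A') TU.
Proof.
  intros.
  destruct (wf_Str'_fun (Γ := Δ) (A := A)) as [K1 K2]; mtt.
  destruct (wf_Str'_body (Γ := Δ) (A := A)) as (K3 & K4 & K5); mtt.
  destruct (wf_Str'_body (Γ := Γ) (A := A')) as (K3' & K4' & K5'); mtt.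
  assert (TUs : eq_ty Γ large TU⟦sg⟧ TU) by (eapply TU_ev; mtt).
  assert (TL : eq_ty Γ large (Later TU⟦key1l⟧) (Later TU)) by (apply Later_TU_key1l; mtt).
  assert (TLs : eq_ty Γ large (Later TU)⟦sg⟧ (Later TU)).
  { eapply TMod_ev; mtt. eapply TU_ev; mtt. }
  assert (TL' : eq_ty Γ large (Later TU⟦sg⟧⟦key1l⟧) (Later TU)).
  { eapply eq_ty_trans; [apply eq_Later_key1l|]; mtt. }
  eapply eq_tm_trans; [eapply eq_tm_conv; [eapply eq_tlob_sub; mtt|exact TUs]|].
  eapply eq_tm_conv; [apply eq_tlob with (A' := TU)|exact TUs]; mtt.
  eapply eq_tm_conv_sym with (B := Arrow (Later TU) TU); [|apply eq_Arrow; mtt].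
  eapply nlam_ev with (B := TU) (B' := TU); mtt.
  assert (L : wf_sub (Γ,,Later TU) (slift 𝟙 sg) (Δ,,Later TU)) by (eapply wf_slift_ev_hid; mtt).
  assert (E : eq_sub (Γ,,Later TU) (swk ⊙ slift 𝟙 sg) (sg ⊙ swk) Δ).
  { eapply swk_sext_hid with (A := Later TU); mtt. eapply wf_tm_conv_sym; [exact K5'|].
    eapply TMod_ev; mtt. eapply TU_ev; mtt. }
  eapply eq_tm_conv_sym with (B := TU); [|eapply TU_ev; mtt].
  eapply strF_ev; mtt.
  - eapply tm_lock_TU; mtt. eapply tm_lock_TU_trans; mtt.
  - assert (T : eq_ty (Γ,,Later TU) large (Later TU)⟦sg ⊙ swk⟧ (Later TU)).
    { eapply TMod_ev; mtt. eapply TU_ev; mtt. }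
    eapply eq_tm_conv; [apply var0_sext with (Δ := Δ) (A := Later TU); mtt|exact T].
Qed.

Lemma El_Str'_ev (Γ Δ : ctx mt) l A A' sg :
  wf_sub Γ sg Δ -> wf_tm (Δ,{del}) A TU -> eq_tm (Γ,{del}) A⟪slock sg del⟫ A' TU ->
  eq_ty Γ l (TEl (Str' A))⟦sg⟧ (TEl (Str' A')).
Proof.
  intros. assert (wf_tm Δ (Str' A) TU) by (apply wf_Str'; mtt).
  eapply TEl_ev; mtt. eapply Str'_ev; mtt.
Qed.

Lemma StrHd_ev (Γ Δ : ctx mt) l A A' sg :
  wf_sub Γ sg Δ -> wf_tm (Δ,{del}) A TU -> eq_tm (Γ,{del}) A⟪slock sg del⟫ A' TU ->
  eq_ty Γ l (StrHd A)⟦sg⟧ (StrHd A').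
Proof.
  intros. eapply TMod_ev; mtt. eapply TEl_ev; mtt.
Qed.

Lemma El_Str'_key1l_ev (Γ Δ : ctx mt) l A A' sg :
  wf_sub Γ sg Δ -> wf_tm (Δ,{del}) A TU -> eq_tm (Γ,{del}) A⟪slock sg del⟫ A' TU ->
  eq_ty (Γ,{ell}) l (TEl (Str' A))⟦key1l⟧⟦slock sg ell⟧ (TEl (Str' A'))⟦key1l⟧.
Proof.
  intros.
  assert (wf_tm Δ (Str' A) TU) by (apply wf_Str'; mtt).
  eapply eq_ty_trans; [apply eq_ty_sym; eapply TSub_key1l; mtt|].
  eapply eq_TSub_ty; [mtt|]. eapply El_Str'_ev; mtt.
Qed.

Lemma StrTl_ev (Γ Δ : ctx mt) l A A' sg :
  wf_sub Γ sg Δ -> wf_tm (Δ,{del}) A TU -> eq_tm (Γ,{del}) A⟪slock sg del⟫ A' TU ->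
  eq_ty Γ l (StrTl A)⟦sg⟧ (StrTl A').
Proof.
  intros. assert (wf_tm Δ (Str' A) TU) by (apply wf_Str'; mtt).
  eapply TMod_ev; mtt. eapply El_Str'_key1l_ev; mtt.
Qed.

(** * The body of [zipWith'] as a function of its free data *)

(** The pair computed by [zipWith' A A B], with the recursive call [r] as a parameter: [r] is
    [var 2] in the open body and a [tmod ell] after unfolding. The two argument types coincide, as
    commutativity requires. *)
Definition zipBody (A B : tm ms) (f r x y : tm mt) : tm mt :=
  npair (StrHd B) (StrTl B)
    (ast_two del (TEl A) (TEl B) f
      (nfst (StrHd A) (StrTl A) x) (nfst (StrHd A) (StrTl A) y))
    (ast_two ell (TEl (Str' A))⟦key1l⟧ (TEl (Str' B))⟦key1l⟧ r
      (nsnd (StrHd A) (StrTl A) x) (nsnd (StrHd A) (StrTl A) y)).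

Definition zipFunTy (A B : tm ms) : ty ms := Arrow (TEl A) (Arrow (TEl A) (TEl B)).
(** [(zipTy A A B)⟦key1l⟧] with the key pushed to the leaves, the shape of function type that
    [ast ell] expects. *)
Definition zipRecTy (A B : tm ms) : ty mt :=
  Arrow (TEl (Str' A))⟦key1l⟧ (Arrow (TEl (Str' A))⟦key1l⟧ (TEl (Str' B))⟦key1l⟧).

Section ZipBody.
Variables (Γ : ctx mt) (A B : tm ms) (f r x y : tm mt).
Hypotheses (wΓ : wf_ctx Γ) (wA : wf_tm (Γ,{del}) A TU) (wB : wf_tm (Γ,{del}) B TU).

Lemma zip_types :
  wf_tm Γ (Str' A) TU /\ wf_tm Γ (Str' B) TU /\
  wf_ty Γ large (StrHd A) /\ wf_ty Γ large (StrHd B) /\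
  wf_ty Γ large (StrTl A) /\ wf_ty Γ large (StrTl B) /\
  eq_ty Γ large (TEl (Str' A)) (Prod (StrHd A) (StrTl A)) /\
  eq_ty Γ large (TEl (Str' B)) (Prod (StrHd B) (StrTl B)) /\
  wf_ty (Γ,{ell}) large (TEl (Str' A))⟦key1l⟧ /\
  wf_ty (Γ,{ell}) large (TEl (Str' B))⟦key1l⟧.
Proof.
  assert (wf_tm Γ (Str' A) TU) by (apply wf_Str'; mtt).
  assert (wf_tm Γ (Str' B) TU) by (apply wf_Str'; mtt).
  repeat split; mtt; (apply wf_StrHd || apply wf_StrTl || apply El_Str'_eq); mtt.
Qed.

Lemma wf_zip_heads :
  wf_tm Γ x (TEl (Str' A)) ->
  wf_tm Γ x (Prod (StrHd A) (StrTl A)) /\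
  wf_tm Γ (nfst (StrHd A) (StrTl A) x) (TMod del (TEl A)) /\
  wf_tm Γ (nsnd (StrHd A) (StrTl A) x) (TMod ell (TEl (Str' A))⟦key1l⟧).
Proof.
  destruct zip_types as (?&?&?&?&?&?&?&?&?&?). intros.
  repeat split; [mtt|apply wf_nfst; mtt|apply wf_nsnd; mtt].
Qed.

End ZipBody.

Lemma wf_zipBody (Γ : ctx mt) A B f r x y :
  wf_tm (Γ,{del}) A TU -> wf_tm (Γ,{del}) B TU ->
  wf_tm Γ f (TMod del (zipFunTy A B)) -> wf_tm Γ r (Later (zipRecTy A B)) ->
  wf_tm Γ x (TEl (Str' A)) -> wf_tm Γ y (TEl (Str' A)) ->
  wf_tm Γ (zipBody A B f r x y) (TEl (Str' B)) /\
  wf_tm Γ (ast_two del (TEl A) (TEl B) f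
      (nfst (StrHd A) (StrTl A) x) (nfst (StrHd A) (StrTl A) y)) (StrHd B) /\
  wf_tm Γ (ast_two ell (TEl (Str' A))⟦key1l⟧ (TEl (Str' B))⟦key1l⟧ r
      (nsnd (StrHd A) (StrTl A) x) (nsnd (StrHd A) (StrTl A) y)) (StrTl B).
Proof.
  intros.
  destruct (zip_types (Γ := Γ) (A := A) (B := B)) as (?&?&?&?&?&?&?&?&?&?); mtt.
  destruct (wf_zip_heads (Γ := Γ) (A := A) (B := B) (x := x)) as (?&?&?); mtt.
  destruct (wf_zip_heads (Γ := Γ) (A := A) (B := B) (x := y)) as (?&?&?); mtt.
  assert (wf_tm Γ (ast_two del (TEl A) (TEl B) f
      (nfst (StrHd A) (StrTl A) x) (nfst (StrHd A) (StrTl A) y)) (StrHd B))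
    by (apply wf_ast_two; mtt).
  assert (wf_tm Γ (ast_two ell (TEl (Str' A))⟦key1l⟧ (TEl (Str' B))⟦key1l⟧ r
      (nsnd (StrHd A) (StrTl A) x) (nsnd (StrHd A) (StrTl A) y)) (StrTl B))
    by (apply wf_ast_two; mtt).
  repeat split; mtt. eapply wf_tm_conv_sym; [|eassumption]. apply wf_npair; mtt.
Qed.

Lemma zipBody_ev (Γ Δ : ctx mt) A A' B B' f f' r r' x x' y y' sg :
  wf_sub Δ sg Γ ->
  wf_tm (Γ,{del}) A TU -> wf_tm (Γ,{del}) B TU ->
  wf_tm Γ f (TMod del (zipFunTy A B)) -> wf_tm Γ r (Later (zipRecTy A B)) ->
  wf_tm Γ x (TEl (Str' A)) -> wf_tm Γ y (TEl (Str' A)) ->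
  eq_tm (Δ,{del}) A⟪slock sg del⟫ A' TU -> eq_tm (Δ,{del}) B⟪slock sg del⟫ B' TU ->
  eq_tm Δ f⟪sg⟫ f' (TMod del (zipFunTy A' B')) -> eq_tm Δ r⟪sg⟫ r' (Later (zipRecTy A' B')) ->
  eq_tm Δ x⟪sg⟫ x' (TEl (Str' A')) -> eq_tm Δ y⟪sg⟫ y' (TEl (Str' A')) ->
  eq_tm Δ (zipBody A B f r x y)⟪sg⟫ (zipBody A' B' f' r' x' y') (TEl (Str' B')).
Proof.
  intros.
  destruct (zip_types (Γ := Γ) (A := A) (B := B)) as (?&?&?&?&?&?&?&?&?&?); mtt.
  destruct (zip_types (Γ := Δ) (A := A') (B := B')) as (?&?&?&?&?&?&?&?&?&?); mtt.
  destruct (wf_zip_heads (Γ := Γ) (A := A) (B := B) (x := x)) as (?&?&?); mtt.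
  destruct (wf_zip_heads (Γ := Γ) (A := A) (B := B) (x := y)) as (?&?&?); mtt.
  destruct (@wf_zipBody Γ A B f r x y) as (?&?&?); mtt.
  assert (eq_ty Δ large (StrHd A)⟦sg⟧ (StrHd A')) by (eapply StrHd_ev; mtt).
  assert (eq_ty Δ large (StrHd B)⟦sg⟧ (StrHd B')) by (eapply StrHd_ev; mtt).
  assert (eq_ty Δ large (StrTl A)⟦sg⟧ (StrTl A')) by (eapply StrTl_ev; mtt).
  assert (eq_ty Δ large (StrTl B)⟦sg⟧ (StrTl B')) by (eapply StrTl_ev; mtt).
  assert (eq_tm Δ x⟪sg⟫ x' (Prod (StrHd A') (StrTl A'))) by (eapply eq_tm_conv; mtt).
  assert (eq_tm Δ y⟪sg⟫ y' (Prod (StrHd A') (StrTl A'))) by (eapply eq_tm_conv; mtt).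
  eapply eq_tm_conv_sym; [|eassumption]. eapply npair_ev; mtt.
  - eapply ast_two_ev; mtt; try (eapply TEl_ev; mtt); eapply nfst_ev; mtt.
  - eapply ast_two_ev; mtt; try (eapply El_Str'_key1l_ev; mtt); eapply nsnd_ev; mtt.
Qed.

Lemma zipBody_comm (Γ : ctx mt) A B f r x y :
  wf_tm (Γ,{del}) A TU -> wf_tm (Γ,{del}) B TU ->
  wf_tm (Γ,{del}) f (zipFunTy A B) -> wf_tm (Γ,{ell}) r (zipRecTy A B) ->
  wf_tm Γ x (TEl (Str' A)) -> wf_tm Γ y (TEl (Str' A)) ->
  commutes (Γ,{del}) (TEl A) (TEl B) f ->
  commutes (Γ,{ell}) (TEl (Str' A))⟦key1l⟧ (TEl (Str' B))⟦key1l⟧ r ->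
  eq_tm Γ (zipBody A B (tmod del f) (tmod ell r) x y)
    (zipBody A B (tmod del f) (tmod ell r) y x) (TEl (Str' B)).
Proof.
  intros.
  destruct (zip_types (Γ := Γ) (A := A) (B := B)) as (?&?&?&?&?&?&?&?&?&?); mtt.
  destruct (wf_zip_heads (Γ := Γ) (A := A) (B := B) (x := x)) as (?&?&?); mtt.
  destruct (wf_zip_heads (Γ := Γ) (A := A) (B := B) (x := y)) as (?&?&?); mtt.
  eapply eq_tm_conv_sym; [|eassumption].
  apply eq_npair; mtt; apply ast_two_comm; mtt.
Qed.

Lemma zipTy_ev (Γ Δ : ctx mt) A A' B B' sg :
  wf_sub Δ sg Γ -> wf_tm (Γ,{del}) A TU -> wf_tm (Γ,{del}) B TU ->
  eq_tm (Δ,{del}) A⟪slock sg del⟫ A' TU -> eq_tm (Δ,{del}) B⟪slock sg del⟫ B' TU ->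
  eq_ty Δ large (zipTy A A B)⟦sg⟧ (zipTy A' A' B').
Proof.
  intros.
  destruct (zip_types (Γ := Γ) (A := A) (B := B)) as (?&?&?&?&?&?&?&?&?&?); mtt.
  eapply Arrow2_ev; mtt; eapply El_Str'_ev; mtt.
Qed.

Lemma zipTy_key1l (Γ : ctx mt) A B :
  wf_ctx Γ -> wf_tm (Γ,{del}) A TU -> wf_tm (Γ,{del}) B TU ->
  wf_ty Γ large (zipTy A A B) /\
  eq_ty (Γ,{ell}) large (zipTy A A B)⟦key1l⟧ (zipRecTy A B) /\
  eq_ty Γ large (Later (zipTy A A B)⟦key1l⟧) (Later (zipRecTy A B)).
Proof.
  intros. destruct (zip_types (Γ := Γ) (A := A) (B := B)) as (?&?&?&?&?&?&?&?&?&?); mtt.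
  assert (wf_ty Γ large (zipTy A A B)) by (unfold zipTy; mtt).
  assert (eq_ty (Γ,{ell}) large (zipTy A A B)⟦key1l⟧ (zipRecTy A B))
    by (eapply Arrow2_ev; mtt).
  repeat split; mtt. apply eq_TMod; mtt.
Qed.

Lemma Later_zipTy_ev (Γ Δ : ctx mt) A A' B B' sg :
  wf_sub Δ sg Γ -> wf_tm (Γ,{del}) A TU -> wf_tm (Γ,{del}) B TU ->
  eq_tm (Δ,{del}) A⟪slock sg del⟫ A' TU -> eq_tm (Δ,{del}) B⟪slock sg del⟫ B' TU ->
  eq_ty Δ large (Later (zipTy A A B)⟦key1l⟧)⟦sg⟧ (Later (zipTy A' A' B')⟦key1l⟧) /\
  eq_ty Δ large (Later (zipTy A A B)⟦key1l⟧)⟦sg⟧ (Later (zipRecTy A' B')).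
Proof.
  intros.
  destruct (zipTy_key1l (Γ := Γ) (A := A) (B := B)) as (?&?&?); mtt.
  destruct (zipTy_key1l (Γ := Δ) (A := A') (B := B')) as (?&?&?); mtt.
  assert (eq_ty Δ large (zipTy A A B)⟦sg⟧ (zipTy A' A' B')) by (eapply zipTy_ev; mtt).
  assert (eq_ty Δ large (Later (zipTy A A B)⟦key1l⟧)⟦sg⟧ (Later (zipTy A' A' B')⟦key1l⟧)).
  { eapply eq_ty_trans; [eapply Later_key1l_sub; mtt|]. apply eq_Later_key1l; mtt. }
  split; mtt. eapply eq_ty_trans; mtt.
Qed.

Lemma zipFunTy_ev (Γ Δ : ctx ms) A A' B B' sg :
  wf_sub Δ sg Γ -> wf_tm Γ A TU -> wf_tm Γ B TU ->
  eq_tm Δ A⟪sg⟫ A' TU -> eq_tm Δ B⟪sg⟫ B' TU ->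
  eq_ty Δ large (zipFunTy A B)⟦sg⟧ (zipFunTy A' B').
Proof. intros. eapply Arrow2_ev; mtt; eapply TEl_ev; mtt. Qed.

Lemma zipFun_mod_ev (Γ Δ : ctx mt) A A' B B' f sg :
  wf_sub Δ sg Γ -> wf_tm (Γ,{del}) A TU -> wf_tm (Γ,{del}) B TU ->
  wf_tm Γ f (TMod del (zipFunTy A B)) ->
  eq_tm (Δ,{del}) A⟪slock sg del⟫ A' TU -> eq_tm (Δ,{del}) B⟪slock sg del⟫ B' TU ->
  eq_ty Δ large (TMod del (zipFunTy A B))⟦sg⟧ (TMod del (zipFunTy A' B')) /\
  wf_tm Δ f⟪sg⟫ (TMod del (zipFunTy A' B')).
Proof.
  intros. assert (wf_ty (Γ,{del}) large (zipFunTy A B)) by (unfold zipFunTy; mtt).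
  assert (eq_ty Δ large (TMod del (zipFunTy A B))⟦sg⟧ (TMod del (zipFunTy A' B'))).
  { eapply TMod_ev; mtt. eapply zipFunTy_ev; mtt. }
  split; mtt. eapply wf_tm_conv; [eapply wf_tsub; mtt|eassumption].
Qed.

(** * Unfolding [zipWith'] and substituting into it *)

Definition zipBodyOpen (A B : tm ms) (f : tm mt) : tm mt :=
  zipBody A⟪slock (swkn 3) del⟫ B⟪slock (swkn 3) del⟫ f⟪swkn 3⟫ (var 2) (var 1) (var 0).
Definition zipF (A B : tm ms) (f : tm mt) : tm mt :=
  tlam (Later (zipTy A A B)⟦key1l⟧)
    (tlam (TEl (Str' A))⟦swkn 1⟧ (tlam (TEl (Str' A))⟦swkn 2⟧ (zipBodyOpen A B f))).

Lemma zipWith'_eq A B f : zipWith' A A B f = tlob (zipTy A A B) (zipF A B f).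
Proof. reflexivity. Qed.

Section ZipCtx.
Variables (Γ : ctx mt) (A B : tm ms) (f : tm mt).
Hypotheses (wΓ : wf_ctx Γ) (wA : wf_tm (Γ,{del}) A TU) (wB : wf_tm (Γ,{del}) B TU)
  (wf : wf_tm Γ f (TMod del (zipFunTy A B))).

Notation S := (TEl (Str' A)).
Notation R := (TEl (Str' B)).
Notation L := (Later (zipTy A A B)⟦key1l⟧).
Notation Γ1 := (Γ,,L).
Notation Γ2 := (Γ1,,S⟦swk⟧).
Notation Γ3 := (Γ2,,S⟦swk ⊙ swk⟧).
Notation A3 := A⟪slock (swk ⊙ swk ⊙ swk) del⟫.
Notation B3 := B⟪slock (swk ⊙ swk ⊙ swk) del⟫.

Lemma zip_ctx : wf_ty Γ large S /\ wf_ty Γ large R /\ wf_ty Γ large L /\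
  wf_sub Γ1 swk Γ /\ wf_sub Γ2 swk Γ1 /\ wf_sub Γ2 (swk ⊙ swk) Γ /\
  wf_sub Γ3 swk Γ2 /\ wf_sub Γ3 (swk ⊙ swk ⊙ swk) Γ.
Proof.
  destruct (zip_types (Γ := Γ) (A := A) (B := B)) as (?&?&?&?&?&?&?&?&?&?); mtt.
  assert (wf_ty Γ large (zipTy A A B)) by (unfold zipTy; mtt).
  repeat split; mtt.
Qed.

(** Each variable is needed at two types: the weakened one, which the substitution lemmas produce,
    and the one built from the weakened codes, which the projections and [ast] demand. *)
Lemma zip_vars :
  wf_tm Γ3 (var 2) L⟦swk ⊙ swk ⊙ swk⟧ /\ wf_tm Γ3 (var 1) S⟦swk ⊙ swk ⊙ swk⟧ /\
  wf_tm Γ3 (var 0) S⟦swk ⊙ swk ⊙ swk⟧ /\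
  wf_tm Γ3 (var 2) (Later (zipRecTy A3 B3)) /\ wf_tm Γ3 (var 1) (TEl (Str' A3)) /\
  wf_tm Γ3 (var 0) (TEl (Str' A3)).
Proof.
  destruct zip_ctx as (?&?&?&?&?&?&?&?).
  assert (eq_ty Γ3 large S⟦swk ⊙ swk ⊙ swk⟧ (TEl (Str' A3))) by (eapply El_Str'_ev; mtt).
  assert (eq_ty Γ3 large L⟦swk ⊙ swk ⊙ swk⟧ (Later (zipRecTy A3 B3)))
    by (eapply Later_zipTy_ev; mtt).
  assert (wf_tm Γ3 (var 2) L⟦swk ⊙ swk ⊙ swk⟧).
  { apply wf_tm_conv with (A := L⟦swk⟧⟦swk⟧⟦swk⟧).
    - eapply wf_tsub; [mtt|]. eapply wf_tsub; mtt.
    - apply eq_ty_sym. eapply TSub_comp_trans with (T' := L⟦swk⟧⟦swk⟧); mtt. eapply eq_TSub_comp; mtt. }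
  assert (wf_tm Γ3 (var 1) S⟦swk ⊙ swk ⊙ swk⟧).
  { apply wf_tm_conv with (A := S⟦swk⟧⟦swk⟧⟦swk⟧).
    - eapply wf_tsub; mtt.
    - apply eq_ty_sym. eapply TSub_comp_trans with (T' := S⟦swk⟧⟦swk⟧); mtt. eapply eq_TSub_comp; mtt. }
  assert (wf_tm Γ3 (var 0) S⟦swk ⊙ swk ⊙ swk⟧).
  { apply wf_tm_conv with (A := S⟦swk ⊙ swk⟧⟦swk⟧); [apply wf_var0; mtt|].
    apply eq_ty_sym. eapply TSub_comp_trans; mtt. }
  repeat split; mtt.
Qed.

Lemma wf_zipBodyOpen :
  wf_tm Γ3 (zipBodyOpen A B f) (TEl (Str' B3)) /\
  wf_tm Γ3 (zipBodyOpen A B f) R⟦swk ⊙ swk⟧⟦swk⟧ /\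
  wf_tm Γ2 (tlam S⟦swk ⊙ swk⟧ (zipBodyOpen A B f)) (Arrow S⟦swk⟧ R⟦swk⟧)⟦swk⟧ /\
  wf_tm Γ1 (tlam S⟦swk⟧ (tlam S⟦swk ⊙ swk⟧ (zipBodyOpen A B f))) (zipTy A A B)⟦swk⟧ /\
  wf_tm Γ (zipF A B f) (Arrow L (zipTy A A B)).
Proof.
  destruct zip_ctx as (?&?&?&?&?&?&?&?). destruct zip_vars as (?&?&?&?&?&?).
  destruct (zipFun_mod_ev (Γ := Γ) (Δ := Γ3) (A := A) (A' := A3) (B := B) (B' := B3)
    (f := f) (sg := swk ⊙ swk ⊙ swk)) as [? ?]; mtt.
  assert (K1 : wf_tm Γ3 (zipBodyOpen A B f) (TEl (Str' B3))) by (apply wf_zipBody; mtt).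
  assert (eq_ty Γ3 large R⟦swk ⊙ swk ⊙ swk⟧ (TEl (Str' B3))) by (eapply El_Str'_ev; mtt).
  assert (K2 : wf_tm Γ3 (zipBodyOpen A B f) R⟦swk ⊙ swk⟧⟦swk⟧).
  { eapply wf_tm_conv_sym; [exact K1|].
    eapply eq_ty_trans; [apply eq_ty_sym; eapply eq_TSub_comp; mtt|]; mtt. }
  assert (K3 : wf_tm Γ2 (tlam S⟦swk ⊙ swk⟧ (zipBodyOpen A B f)) (Arrow S⟦swk⟧ R⟦swk⟧)⟦swk⟧).
  { eapply wf_tm_conv_sym; [apply wf_nlam; mtt|]; mtt.
    eapply Arrow_ev; mtt; apply eq_ty_sym; eapply eq_TSub_comp; mtt. }
  assert (K4 : wf_tm Γ1 (tlam S⟦swk⟧ (tlam S⟦swk ⊙ swk⟧ (zipBodyOpen A B f))) (zipTy A A B)⟦swk⟧).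
  { eapply wf_tm_conv_sym; [apply wf_nlam; mtt|]; mtt. eapply Arrow2_ev; mtt. }
  repeat split; mtt. apply wf_nlam; mtt. unfold zipTy; mtt.
Qed.

Lemma wf_zipWith' : wf_tm Γ (zipWith' A A B f) (zipTy A A B).
Proof.
  destruct zip_ctx as (?&?&?&?&?&?&?&?). destruct wf_zipBodyOpen as (?&?&?&?&?).
  rewrite zipWith'_eq. apply wf_tlob; mtt. unfold zipTy; mtt.
Qed.

(** Facts about the environment that stores a recursive call and two streams on top of [sg].
    Unfolding needs it for [sg = sid], substitution for [sg] followed by three weakenings. *)
Lemma zip_sext (Δ : ctx mt) sg r x y :
  wf_sub Δ sg Γ -> wf_tm Δ r L⟦sg⟧ -> wf_tm Δ x S⟦sg⟧ -> wf_tm Δ y S⟦sg⟧ ->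
  wf_sub Δ (sext 𝟙 sg r) Γ1 /\ wf_sub Δ (sext 𝟙 (sext 𝟙 sg r) x) Γ2 /\
  wf_sub Δ (sext 𝟙 (sext 𝟙 (sext 𝟙 sg r) x) y) Γ3 /\
  eq_sub Δ (swk ⊙ sext 𝟙 sg r) sg Γ /\
  eq_sub Δ (swk ⊙ sext 𝟙 (sext 𝟙 sg r) x) (sext 𝟙 sg r) Γ1 /\
  eq_sub Δ (swk ⊙ sext 𝟙 (sext 𝟙 (sext 𝟙 sg r) x) y) (sext 𝟙 (sext 𝟙 sg r) x) Γ2 /\
  eq_sub Δ (swk ⊙ swk ⊙ sext 𝟙 (sext 𝟙 sg r) x) sg Γ /\
  eq_sub Δ (swk ⊙ swk ⊙ swk ⊙ sext 𝟙 (sext 𝟙 (sext 𝟙 sg r) x) y) sg Γ /\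
  eq_tm Δ (var 2)⟪sext 𝟙 (sext 𝟙 (sext 𝟙 sg r) x) y⟫ r L⟦sg⟧ /\
  eq_tm Δ (var 1)⟪sext 𝟙 (sext 𝟙 (sext 𝟙 sg r) x) y⟫ x S⟦sg⟧ /\
  eq_tm Δ (var 0)⟪sext 𝟙 (sext 𝟙 (sext 𝟙 sg r) x) y⟫ y S⟦sg⟧.
Proof.
  destruct zip_ctx as (?&?&?&?&?&?&?&?). intros.
  set (s1 := sext 𝟙 sg r). assert (W1 : wf_sub Δ s1 Γ1) by (unfold s1; mtt).
  assert (E1 : eq_sub Δ (swk ⊙ s1) sg Γ) by (apply swk_sext_hid with (A := L); mtt).
  assert (T1 : eq_ty Δ large S⟦swk⟧⟦s1⟧ S⟦sg⟧) by (eapply TSub_comp_eq; mtt).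
  set (s2 := sext 𝟙 s1 x). assert (W2 : wf_sub Δ s2 Γ2) by (unfold s2; mtt).
  assert (E2 : eq_sub Δ (swk ⊙ s2) s1 Γ1) by (apply swk_sext_hid with (A := S⟦swk⟧); mtt).
  assert (E2' : eq_sub Δ (swk ⊙ swk ⊙ s2) sg Γ).
  { eapply eq_sub_trans; [eapply eq_scomp_assoc; mtt|].
    eapply eq_sub_trans; [eapply eq_scomp; mtt|]; mtt. }
  assert (T2 : eq_ty Δ large S⟦swk ⊙ swk⟧⟦s2⟧ S⟦sg⟧) by (eapply TSub_comp_eq; mtt).
  set (s3 := sext 𝟙 s2 y). assert (W3 : wf_sub Δ s3 Γ3) by (unfold s3; mtt).
  assert (E3 : eq_sub Δ (swk ⊙ s3) s2 Γ2) by (apply swk_sext_hid with (A := S⟦swk ⊙ swk⟧); mtt).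
  assert (E3' : eq_sub Δ (swk ⊙ swk ⊙ swk ⊙ s3) sg Γ).
  { eapply eq_sub_trans; [eapply eq_scomp_assoc; mtt|].
    eapply eq_sub_trans; [eapply eq_scomp; mtt|]; mtt. }
  assert (V1 : eq_tm Δ tvar⟪s1⟫ r L⟦sg⟧) by (eapply var0_sext with (Δ := Γ); mtt).
  assert (V2 : eq_tm Δ tvar⟪s2⟫ x S⟦sg⟧).
  { eapply eq_tm_conv; [eapply var0_sext with (Δ := Γ1) (A := S⟦swk⟧); mtt|]; mtt. }
  assert (V3 : eq_tm Δ tvar⟪s3⟫ y S⟦sg⟧).
  { eapply eq_tm_conv; [eapply var0_sext with (Δ := Γ2) (A := S⟦swk ⊙ swk⟧); mtt|]; mtt. }
  assert (TL : eq_ty Δ large L⟦swk⟧⟦s1⟧ L⟦sg⟧) by (eapply TSub_comp_eq; mtt).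
  assert (TL2 : eq_ty Δ large L⟦swk⟧⟦swk⟧⟦s2⟧ L⟦sg⟧).
  { eapply ty_comp_ev; mtt; mtt. }
  assert (TS2 : eq_ty Δ large S⟦swk⟧⟦swk⟧⟦s2⟧ S⟦sg⟧).
  { eapply ty_comp_ev; mtt; mtt. }
  repeat split; mtt; unfold var.
  - eapply tm_comp_ev; mtt; mtt. eapply tm_comp_ev; mtt; mtt.
  - eapply tm_comp_ev; mtt; mtt.
Qed.

Lemma zipBodyOpen_ev (Δ : ctx mt) A' B' f' sg r x y :
  wf_sub Δ sg Γ ->
  eq_tm (Δ,{del}) A⟪slock sg del⟫ A' TU -> eq_tm (Δ,{del}) B⟪slock sg del⟫ B' TU ->
  eq_tm Δ f⟪sg⟫ f' (TMod del (zipFunTy A' B')) ->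
  wf_tm Δ r L⟦sg⟧ -> wf_tm Δ x S⟦sg⟧ -> wf_tm Δ y S⟦sg⟧ ->
  eq_tm Δ (zipBodyOpen A B f)⟪sext 𝟙 (sext 𝟙 (sext 𝟙 sg r) x) y⟫
    (zipBody A' B' f' r x y) (TEl (Str' B')).
Proof.
  intros. destruct zip_ctx as (?&?&?&?&?&?&?&?). destruct zip_vars as (?&?&?&?&?&?).
  destruct (zip_sext (Δ := Δ) (sg := sg) (r := r) (x := x) (y := y))
    as (?&?&?&?&?&?&?&?&?&?&?); mtt.
  destruct (zipFun_mod_ev (Γ := Γ) (Δ := Γ3) (A := A) (A' := A3) (B := B) (B' := B3)
    (f := f) (sg := swk ⊙ swk ⊙ swk)) as [? ?]; mtt.
  destruct (zipFun_mod_ev (Γ := Γ) (Δ := Δ) (A := A) (A' := A') (B := B) (B' := B')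
    (f := f) (sg := sg)) as [? ?]; mtt.
  assert (eq_ty Δ large S⟦sg⟧ (TEl (Str' A'))) by (eapply El_Str'_ev; mtt).
  assert (eq_ty Δ large L⟦sg⟧ (Later (zipRecTy A' B')))
    by (eapply Later_zipTy_ev; mtt).
  eapply zipBody_ev with (Γ := Γ3); mtt.
  - eapply tm_lock_TU; mtt.
  - eapply tm_lock_TU; mtt.
  - eapply tm_comp_ev; mtt.
  - eapply eq_tm_conv; mtt.
  - eapply eq_tm_conv; mtt.
  - eapply eq_tm_conv; mtt.
Qed.

(** Unfolding delivers the recursive call as [next], hence as a [tmod ell]. The function applied to
    the tails is then an introduced one, as [ast_two_comm] requires. *)
Lemma zipWith'_app x y : wf_tm Γ x S -> wf_tm Γ y S ->
  eq_tm Γ (app_two S R (zipWith' A A B f) x y)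
    (zipBody A B f (tmod ell (zipWith' A A B f)⟪key1l⟫) x y) R.
Proof.
  intros. destruct zip_ctx as (?&?&?&?&?&?&?&?). destruct wf_zipBodyOpen as (?&?&?&?&?).
  pose proof wf_zipWith' as W.
  set (r := tmod ell (zipWith' A A B f)⟪key1l⟫).
  assert (wf_tm Γ r L) by (unfold r, Later; mtt).
  assert (TI : forall T, wf_ty Γ large T -> eq_ty Γ large T⟦sid⟧ T) by (intros; apply eq_TSub_id; mtt).
  assert (eq_ty Γ large L⟦sid⟧ L) by (apply TI; mtt).
  assert (eq_ty Γ large S⟦sid⟧ S) by (apply TI; mtt).
  destruct (zip_sext (Δ := Γ) (sg := sid) (r := r) (x := x) (y := y))
    as (?&?&?&?&?&?&?&?&?&?&?); mtt.
  assert (T1 : forall T, wf_ty Γ large T -> eq_ty Γ large T⟦swk⟧⟦sext 𝟙 sid r⟧ T).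
  { intros. eapply ty_comp_ev; mtt. apply TI; mtt. }
  assert (T2 : forall T, wf_ty Γ large T ->
    eq_ty Γ large T⟦swk ⊙ swk⟧⟦sext 𝟙 (sext 𝟙 sid r) x⟧ T).
  { intros. eapply ty_comp_ev; mtt. apply TI; mtt. }
  assert (X1 : eq_tm Γ (zipWith' A A B f)
    (tlam S⟦swk⟧ (tlam S⟦swk ⊙ swk⟧ (zipBodyOpen A B f)))⟪sext 𝟙 sid r⟫ (Arrow S (Arrow S R))).
  { eapply eq_tm_trans; [apply eq_tlob_unfold; mtt|].
    (* The identity substitution is inserted so that all three β steps are instances of
       [nlam_sub_app], each adding one entry to the environment. *)
    eapply eq_tm_trans with (N := napp L (zipTy A A B) (zipF A B f)⟪sid⟫ r).
    - apply eq_napp; mtt; [apply eq_tm_sym, eq_tsub_id; mtt|apply next_eq; mtt].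
    - eapply nlam_sub_app with (B := zipTy A A B); mtt. apply TI; mtt. }
  assert (X2 : eq_tm Γ (napp S (Arrow S R) (zipWith' A A B f) x)
    (tlam S⟦swk ⊙ swk⟧ (zipBodyOpen A B f))⟪sext 𝟙 (sext 𝟙 sid r) x⟫ (Arrow S R)).
  { eapply eq_tm_trans; [apply eq_napp; mtt|].
    eapply nlam_sub_app with (B := Arrow S⟦swk⟧ R⟦swk⟧); mtt.
    - apply T1; mtt.
    - eapply Arrow_ev; mtt; apply T1; mtt. }
  assert (X3 : eq_tm Γ (app_two S R (zipWith' A A B f) x y)
    (zipBodyOpen A B f)⟪sext 𝟙 (sext 𝟙 (sext 𝟙 sid r) x) y⟫ R).
  { eapply eq_tm_trans; [apply eq_napp; mtt|].
    eapply nlam_sub_app with (B := R⟦swk ⊙ swk⟧); mtt; apply T2; mtt. }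
  eapply eq_tm_trans; [exact X3|].
  apply zipBodyOpen_ev; mtt.
  - apply tsub_slock_sid; mtt.
  - apply tsub_slock_sid; mtt.
  - apply eq_tsub_id; mtt.
Qed.

End ZipCtx.

Lemma sext_comp_hid m (Γ Δ Θ : ctx m) A sg tau M :
  wf_sub Γ tau Δ -> wf_sub Δ sg Θ -> wf_ty Θ large A -> wf_tm Δ M A⟦sg⟧ ->
  eq_sub Γ (sext 𝟙 sg M ⊙ tau) (sext 𝟙 (sg ⊙ tau) M⟪tau⟫) (Θ,,A).
Proof.
  intros.
  assert (T : eq_ty Δ large A⟦slock sg 𝟙⟧ A⟦sg⟧) by (eapply TSub_slock_hid; mtt).
  eapply eq_sub_trans; [eapply eq_sext_comp; mtt|].
  assert (eq_ty Γ large A⟦sg ⊙ tau⟧ A⟦sg⟧⟦tau⟧) by (eapply eq_TSub_comp; mtt).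
  eapply eq_sext_hid; mtt.
  eapply eq_tm_conv_sym; [|eassumption]. eapply tm_slock_hid; mtt.
Qed.

Lemma wf_tsub_comp m (Γ Δ Θ : ctx m) sg tau M T :
  wf_sub Γ tau Δ -> wf_sub Δ sg Θ -> wf_ty Θ large T -> wf_tm Δ M T⟦sg⟧ ->
  wf_tm Γ M⟪tau⟫ T⟦sg ⊙ tau⟧.
Proof.
  intros. eapply wf_tm_conv_sym; [|eapply eq_TSub_comp; mtt]. eapply wf_tsub; mtt.
Qed.

Lemma wf_var_lift m (Γ Δ : ctx m) A A' sg :
  wf_sub Γ sg Δ -> wf_ty Δ large A -> eq_ty Γ large A⟦sg⟧ A' ->
  wf_tm (Γ,,A') tvar A⟦sg ⊙ swk⟧.
Proof.
  intros.
  eapply wf_tm_conv_sym; [apply wf_var0; mtt|]. eapply TSub_comp_trans; mtt.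
Qed.

(** Three nested lifts amount to the environment made of [sg] after three weakenings and the three
    newest variables. Substitution under the binders of [zipF] thereby becomes a case of
    [zipBodyOpen_ev]. *)
Lemma slift3 m (Γ Δ : ctx m) A0 A1 A2 A0' A1' A2' sg :
  wf_sub Δ sg Γ -> wf_ty Γ large A0 -> wf_ty (Γ,,A0) large A1 -> wf_ty (Γ,,A0,,A1) large A2 ->
  eq_ty Δ large A0⟦sg⟧ A0' -> eq_ty (Δ,,A0') large A1⟦slift 𝟙 sg⟧ A1' ->
  eq_ty (Δ,,A0',,A1') large A2⟦slift 𝟙 (slift 𝟙 sg)⟧ A2' ->
  eq_sub (Δ,,A0',,A1',,A2') (slift 𝟙 (slift 𝟙 (slift 𝟙 sg)))
    (sext 𝟙 (sext 𝟙 (sext 𝟙 (sg ⊙ (swk ⊙ swk ⊙ swk)) (var 2)) (var 1)) (var 0)) (Γ,,A0,,A1,,A2).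
Proof.
  intros. set (Δ1 := Δ,,A0'). set (Δ2 := Δ1,,A1'). set (Δ3 := Δ2,,A2').
  assert (wf_sub Δ1 swk Δ) by (unfold Δ1; mtt).
  assert (wf_sub Δ2 swk Δ1) by (unfold Δ2; mtt).
  assert (wf_sub Δ3 swk Δ2) by (unfold Δ3; mtt).
  set (s1 := slift 𝟙 sg) in *. set (s2 := slift 𝟙 s1) in *.
  assert (W1 : wf_sub Δ1 s1 (Γ,,A0)) by (eapply wf_slift_ev_hid; mtt).
  assert (W2 : wf_sub Δ2 s2 (Γ,,A0,,A1)) by (eapply wf_slift_ev_hid; mtt).
  assert (V1 : wf_tm Δ1 tvar A0⟦sg ⊙ swk⟧) by (eapply wf_var_lift; mtt).
  assert (V2 : wf_tm Δ2 tvar A1⟦s1 ⊙ swk⟧) by (eapply wf_var_lift; mtt).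
  assert (V3 : wf_tm Δ3 tvar A2⟦s2 ⊙ swk⟧) by (eapply wf_var_lift; mtt).
  assert (V1' : wf_tm Δ2 tvar⟪swk⟫ A0⟦sg ⊙ swk ⊙ swk⟧) by (eapply wf_tsub_comp; mtt).
  assert (V1'' : wf_tm Δ3 (var 2) A0⟦sg ⊙ swk ⊙ swk ⊙ swk⟧) by (eapply wf_tsub_comp; mtt).
  assert (V2' : wf_tm Δ3 (var 1) A1⟦s1 ⊙ swk ⊙ swk⟧) by (eapply wf_tsub_comp; mtt).
  assert (E0 : eq_sub Δ3 (sg ⊙ swk ⊙ swk ⊙ swk) (sg ⊙ (swk ⊙ swk ⊙ swk)) Γ).
  { eapply eq_sub_trans.
    - eapply eq_scomp; [apply eq_sub_refl; mtt|]. eapply eq_scomp_assoc; mtt.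
    - eapply eq_scomp_assoc; mtt. }
  assert (E1 : eq_sub Δ3 (s1 ⊙ swk ⊙ swk) (sext 𝟙 (sg ⊙ (swk ⊙ swk ⊙ swk)) (var 2)) (Γ,,A0)).
  { eapply eq_sub_trans; [eapply eq_scomp; [apply eq_sub_refl; mtt|eapply sext_comp_hid; mtt]|].
    eapply eq_sub_trans; [eapply sext_comp_hid; mtt|]. eapply eq_sext_hid; mtt. }
  assert (E2 : eq_sub Δ3 (s2 ⊙ swk)
    (sext 𝟙 (sext 𝟙 (sg ⊙ (swk ⊙ swk ⊙ swk)) (var 2)) (var 1)) (Γ,,A0,,A1)).
  { eapply eq_sub_trans; [eapply sext_comp_hid; mtt|]. eapply eq_sext_hid; mtt. }
  eapply eq_sext_hid; mtt.
Qed.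

Lemma zipWith'_ev (Γ Δ : ctx mt) A A' B B' f f' sg :
  wf_sub Δ sg Γ -> wf_tm (Γ,{del}) A TU -> wf_tm (Γ,{del}) B TU ->
  wf_tm Γ f (TMod del (zipFunTy A B)) ->
  eq_tm (Δ,{del}) A⟪slock sg del⟫ A' TU -> eq_tm (Δ,{del}) B⟪slock sg del⟫ B' TU ->
  eq_tm Δ f⟪sg⟫ f' (TMod del (zipFunTy A' B')) ->
  eq_tm Δ (zipWith' A A B f)⟪sg⟫ (zipWith' A' A' B' f') (zipTy A' A' B').
Proof.
  intros.
  destruct (zip_ctx (Γ := Γ) (A := A) (B := B)) as (?&?&?&?&?&?&?&?); mtt.
  destruct (zip_ctx (Γ := Δ) (A := A') (B := B')) as (?&?&?&?&?&?&?&?); mtt.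
  destruct (zip_vars (Γ := Δ) (A := A') (B := B')) as (v2&v1&v0&_&_&_); mtt.
  destruct (wf_zipBodyOpen (Γ := Γ) (A := A) (B := B) (f := f)) as (?&?&?&?&?); mtt.
  destruct (wf_zipBodyOpen (Γ := Δ) (A := A') (B := B') (f := f')) as (?&?&?&?&?); mtt.
  set (S := TEl (Str' A)) in *. set (R := TEl (Str' B)) in *.
  set (S' := TEl (Str' A')) in *. set (R' := TEl (Str' B')) in *.
  set (L := Later (zipTy A A B)⟦key1l⟧) in *. set (L' := Later (zipTy A' A' B')⟦key1l⟧) in *.
  assert (TS : eq_ty Δ large S⟦sg⟧ S') by (eapply El_Str'_ev; mtt).
  assert (TR : eq_ty Δ large R⟦sg⟧ R') by (eapply El_Str'_ev; mtt).
  assert (TL : eq_ty Δ large L⟦sg⟧ L') by (eapply Later_zipTy_ev; mtt).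
  assert (TZ : eq_ty Δ large (zipTy A A B)⟦sg⟧ (zipTy A' A' B')) by (eapply zipTy_ev; mtt).
  assert (wf_ty Γ large (zipTy A A B)) by (unfold zipTy; mtt).
  assert (W1 : wf_sub (Δ,,L') (slift 𝟙 sg) (Γ,,L)) by (eapply wf_slift_ev_hid; mtt).
  assert (T1 : forall T T', wf_ty Γ large T -> eq_ty Δ large T⟦sg⟧ T' ->
    eq_ty (Δ,,L') large T⟦swk⟧⟦slift 𝟙 sg⟧ T'⟦swk⟧).
  { intros. eapply TSub_lift_sub_hid with (A := L); mtt. }
  assert (TS1 := T1 S S' ltac:(mtt) TS). assert (TR1 := T1 R R' ltac:(mtt) TR).
  assert (W2 : wf_sub (Δ,,L',,S'⟦swk⟧) (slift 𝟙 (slift 𝟙 sg)) (Γ,,L,,S⟦swk⟧))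
    by (eapply wf_slift_ev_hid; mtt).
  assert (T2 : forall T T', wf_ty Γ large T -> eq_ty Δ large T⟦sg⟧ T' ->
    eq_ty (Δ,,L',,S'⟦swk⟧) large T⟦swk ⊙ swk⟧⟦slift 𝟙 (slift 𝟙 sg)⟧ T'⟦swk ⊙ swk⟧).
  { intros. eapply eq_ty_trans; [eapply eq_TSub_ty; [exact W2|eapply eq_TSub_comp; mtt]|].
    eapply eq_ty_trans; [eapply TSub_lift_sub_hid with (A := S⟦swk⟧) (B' := T'⟦swk⟧); mtt; apply T1; mtt|].
    apply eq_ty_sym; eapply eq_TSub_comp; mtt. }
  assert (TS2 := T2 S S' ltac:(mtt) TS). assert (TR2 := T2 R R' ltac:(mtt) TR).
  assert (TZ' : eq_ty Δ large (Arrow (Later (zipTy A A B)⟦sg⟧⟦key1l⟧) (zipTy A A B)⟦sg⟧)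
    (Arrow L' (zipTy A' A' B'))).
  { apply eq_Arrow; mtt. apply eq_Later_key1l; mtt. }
  rewrite !zipWith'_eq.
  eapply eq_tm_trans; [eapply eq_tm_conv; [eapply eq_tlob_sub; mtt|exact TZ]|].
  eapply eq_tm_conv; [apply eq_tlob; mtt|exact TZ].
  eapply eq_tm_conv_sym; [|exact TZ'].
  eapply nlam_ev with (B := zipTy A A B); mtt.
  eapply eq_tm_conv_sym with (B := Arrow S'⟦swk⟧ (Arrow S'⟦swk⟧ R'⟦swk⟧)); [|eapply Arrow2_ev; mtt].
  assert (TA : eq_ty (Δ,,L') large (Arrow S⟦swk⟧ R⟦swk⟧)⟦slift 𝟙 sg⟧ (Arrow S'⟦swk⟧ R'⟦swk⟧))
    by (eapply Arrow_ev; mtt).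
  eapply nlam_ev with (B := Arrow S⟦swk⟧ R⟦swk⟧); mtt.
  eapply eq_tm_conv_sym with (B := Arrow S'⟦swk ⊙ swk⟧ R'⟦swk ⊙ swk⟧).
  2: { eapply Arrow_ev; mtt; apply eq_ty_sym; eapply eq_TSub_comp; mtt. }
  eapply nlam_ev with (B := R⟦swk ⊙ swk⟧); mtt.
  assert (X := slift3 (Γ := Γ) (Δ := Δ) (A0 := L) (A1 := S⟦swk⟧) (A2 := S⟦swk ⊙ swk⟧)
    (A0' := L') (A1' := S'⟦swk⟧) (A2' := S'⟦swk ⊙ swk⟧) (sg := sg)).
  match type of X with ?a -> ?b -> ?c -> ?d -> ?e -> ?g -> ?h -> _ =>
    assert (E := X ltac:(mtt) ltac:(mtt) ltac:(mtt) ltac:(mtt) ltac:(mtt) ltac:(mtt) ltac:(mtt)) end.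
  set (Δ3 := Δ,,L',,S'⟦swk⟧,,S'⟦swk ⊙ swk⟧) in *.
  set (A3 := A'⟪slock (swk ⊙ swk ⊙ swk) del⟫) in *.
  set (B3 := B'⟪slock (swk ⊙ swk ⊙ swk) del⟫) in *.
  assert (eq_tm (Δ3,{del}) A'⟪slock (swk ⊙ swk ⊙ swk) del⟫ A3 TU) by (unfold A3; mtt).
  assert (eq_tm (Δ3,{del}) B'⟪slock (swk ⊙ swk ⊙ swk) del⟫ B3 TU) by (unfold B3; mtt).
  destruct (zipFun_mod_ev (Γ := Δ) (Δ := Δ3) (A := A') (A' := A3) (B := B') (B' := B3)
    (f := f') (sg := swk ⊙ swk ⊙ swk)) as [? ?]; mtt.
  destruct (zipFun_mod_ev (Γ := Γ) (Δ := Δ) (A := A) (A' := A') (B := B) (B' := B')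
    (f := f) (sg := sg)) as [? ?]; mtt.
  assert (TR3 : eq_ty Δ3 large R'⟦swk ⊙ swk⟧⟦swk⟧ (TEl (Str' B3))).
  { eapply eq_ty_trans; [apply eq_ty_sym; eapply eq_TSub_comp; mtt|]. eapply El_Str'_ev; mtt. }
  assert (TRs : eq_ty Δ3 large R⟦swk ⊙ swk⟧⟦swk⟧⟦slift 𝟙 (slift 𝟙 (slift 𝟙 sg))⟧
    R'⟦swk ⊙ swk⟧⟦swk⟧).
  { eapply TSub_lift_sub_hid with (A := S⟦swk ⊙ swk⟧); mtt. }
  eapply eq_tm_trans; [eapply eq_tm_conv; [eapply eq_tsub; [exact E|mtt]|exact TRs]|].
  eapply eq_tm_conv_sym; [|exact TR3].
  assert (TC : forall T T', wf_ty Γ large T -> eq_ty Δ large T⟦sg⟧ T' ->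
    eq_ty Δ3 large T⟦sg ⊙ (swk ⊙ swk ⊙ swk)⟧ T'⟦swk ⊙ swk ⊙ swk⟧).
  { intros. eapply TSub_comp_trans; mtt. }
  (* By definition [zipBodyOpen A' B' f'] is [zipBody] at [A3], [B3], the weakened [f'] and the
     three variables, so evaluating the open body in the environment of [E] reaches it. *)
  apply zipBodyOpen_ev with (Γ := Γ); mtt.
  - eapply tm_lock_TU_trans; mtt.
  - eapply tm_lock_TU_trans; mtt.
  - eapply tsub_comp_trans; mtt.
  - eapply wf_tm_conv_sym; [exact v2|apply TC; mtt].
  - eapply wf_tm_conv_sym; [exact v1|apply TC; mtt].
  - eapply wf_tm_conv_sym; [exact v0|apply TC; mtt].
Qed.

Section AppTwo.
Variable m : mode.

Lemma wf_app_two (Γ : ctx m) S R F u v :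
  wf_ty Γ large R -> wf_tm Γ F (Arrow S (Arrow S R)) -> wf_tm Γ u S -> wf_tm Γ v S ->
  wf_tm Γ (app_two S R F u v) R.
Proof. intros. apply wf_napp; mtt. apply wf_napp; mtt. Qed.

Lemma eq_app_two (Γ : ctx m) S S' R R' F F' u u' v v' :
  eq_ty Γ large S S' -> eq_ty Γ large R R' -> eq_tm Γ F F' (Arrow S (Arrow S R)) ->
  eq_tm Γ u u' S -> eq_tm Γ v v' S ->
  eq_tm Γ (app_two S R F u v) (app_two S' R' F' u' v') R.
Proof.
  intros. apply eq_napp; mtt. apply eq_napp; mtt.
  apply eq_Arrow; mtt.
Qed.

Lemma app_two_ev (Γ Δ : ctx m) S S' R R' F F' u u' v v' sg :
  wf_sub Δ sg Γ -> wf_ty Γ large R -> wf_tm Γ F (Arrow S (Arrow S R)) ->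
  wf_tm Γ u S -> wf_tm Γ v S ->
  eq_ty Δ large S⟦sg⟧ S' -> eq_ty Δ large R⟦sg⟧ R' ->
  eq_tm Δ F⟪sg⟫ F' (Arrow S' (Arrow S' R')) -> eq_tm Δ u⟪sg⟫ u' S' -> eq_tm Δ v⟪sg⟫ v' S' ->
  eq_tm Δ (app_two S R F u v)⟪sg⟫ (app_two S' R' F' u' v') R'.
Proof.
  intros.
  assert (wf_tm Γ (napp S (Arrow S R) F u) (Arrow S R)) by (apply wf_napp; mtt).
  eapply napp_ev; mtt. eapply napp_ev; mtt. eapply Arrow_ev; mtt.
Qed.

End AppTwo.

(** * Equations quantified over two variables *)

Lemma slift_sext_hid m (Γ Δ Θ : ctx m) A M sg tau :
  wf_sub Γ tau Δ -> wf_sub Δ sg Θ -> wf_ty Θ large A -> wf_tm Γ M A⟦sg⟧⟦tau⟧ ->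
  eq_sub Γ (slift 𝟙 sg ⊙ sext 𝟙 tau M) (sext 𝟙 (sg ⊙ tau) M) (Θ,,A).
Proof.
  intros. apply slift_sext with (Δ := Δ); mtt.
  apply wf_tm_lock_hid; mtt. eapply wf_tm_conv_sym; [eassumption|].
  eapply eq_ty_trans; [|eapply TSub_slock_hid; mtt].
  eapply eq_TSub_ty; [|eapply TSub_slock_hid; mtt].
  eapply wf_sub_ctx; [apply wf_slock with (mu := 𝟙)| |]; mtt.
Qed.

Lemma TPi_var m (Γ : ctx m) A B p :
  wf_ty Γ large A -> wf_ty (Γ,,A) large B -> wf_tm Γ p (TPi A B) ->
  wf_tm (Γ,,A) (tapp A⟦swk⟧ B⟦slift 𝟙 swk⟧ p⟪swk⟫ tvar) B.
Proof.
  intros.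
  eapply wf_tm_conv; [apply wf_tapp|apply TSub_sid_sone]; mtt.
  eapply wf_tm_conv; [eapply wf_tsub|eapply eq_TPi_sub]; mtt.
Qed.

Lemma Pi2_Eq_sub m (Γ Δ : ctx m) S0 S1 T a b sg :
  wf_sub Δ sg Γ -> wf_ty Γ large S0 -> wf_ty (Γ,,S0) large S1 ->
  wf_tm (Γ,,S0,,S1) a T -> wf_tm (Γ,,S0,,S1) b T ->
  wf_sub (Δ,,S0⟦sg⟧,,S1⟦slift 𝟙 sg⟧) (slift 𝟙 (slift 𝟙 sg)) (Γ,,S0,,S1) /\
  eq_ty Δ large (TPi S0 (TPi S1 (TEq T a b)))⟦sg⟧
    (TPi S0⟦sg⟧ (TPi S1⟦slift 𝟙 sg⟧ (TEq T⟦slift 𝟙 (slift 𝟙 sg)⟧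
      a⟪slift 𝟙 (slift 𝟙 sg)⟫ b⟪slift 𝟙 (slift 𝟙 sg)⟫))).
Proof.
  intros.
  assert (W2 : wf_sub (Δ,,S0⟦sg⟧,,S1⟦slift 𝟙 sg⟧) (slift 𝟙 (slift 𝟙 sg)) (Γ,,S0,,S1))
    by (apply wf_slift_hid; mtt).
  split; mtt.
  eapply eq_ty_trans; [eapply eq_TPi_sub; mtt|]. apply eq_TPi; mtt.
  eapply eq_ty_trans; [eapply eq_TPi_sub; mtt|]. apply eq_TPi; mtt.
  eapply eq_TEq_sub; mtt.
Qed.

Lemma Pi2_Eq_intro m (Γ : ctx m) S0 S1 T a b :
  wf_ty Γ large S0 -> wf_ty (Γ,,S0) large S1 -> eq_tm (Γ,,S0,,S1) a b T ->
  wf_tm Γ (tlam S0 (tlam S1 (trefl a))) (TPi S0 (TPi S1 (TEq T a b))).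
Proof.
  intros. assert (wf_tm (Γ,,S0,,S1) (trefl a) (TEq T a b)).
  { eapply wf_tm_conv; [apply wf_trefl with (A := T); mtt|]. apply eq_TEq; mtt. }
  apply wf_tlam; mtt.
Qed.

(** Applied to the two variables, [p] proves the equation over the extended context, and reflection
    makes it judgmental. *)
Lemma Pi2_Eq_elim m (Γ : ctx m) S0 S1 T a b p :
  wf_ty Γ large S0 -> wf_ty (Γ,,S0) large S1 ->
  wf_tm (Γ,,S0,,S1) a T -> wf_tm (Γ,,S0,,S1) b T ->
  wf_tm Γ p (TPi S0 (TPi S1 (TEq T a b))) -> eq_tm (Γ,,S0,,S1) a b T.
Proof.
  intros. eapply eq_reflection; mtt.
  eapply TPi_var; mtt. eapply TPi_var; mtt.
Qed.

(** * The type of commutativity proofs *)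

Section Comm.
Variables (m : mode) (Γ : ctx m) (S R : ty m) (F : tm m).
Hypotheses (wΓ : wf_ctx Γ) (wS : wf_ty Γ large S) (wR : wf_ty Γ large R)
  (wF : wf_tm Γ F (Arrow S (Arrow S R))).

Notation w := (swk ⊙ swk).
Notation Γ2 := (Γ,,S,,S⟦swk⟧).

Definition comm_lhs : tm m := app_two S⟦w⟧ R⟦w⟧ F⟪w⟫ (var 1) (var 0).
Definition comm_rhs : tm m := app_two S⟦w⟧ R⟦w⟧ F⟪w⟫ (var 0) (var 1).
(** The internal counterpart of [commutes]: [tlob] can only inhabit a type, whereas [ast_two_comm]
    consumes the external property. [commOf_intro] and [commOf_elim] translate between the two. *)
Definition commOf : ty m := TPi S (TPi S⟦swk⟧ (TEq R⟦w⟧ comm_lhs comm_rhs)).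

Lemma comm_ctx :
  wf_sub Γ2 w Γ /\ wf_tm Γ2 (var 1) S⟦w⟧ /\ wf_tm Γ2 (var 0) S⟦w⟧ /\
  wf_tm Γ2 F⟪w⟫ (Arrow S⟦w⟧ (Arrow S⟦w⟧ R⟦w⟧)) /\
  wf_tm Γ2 comm_lhs R⟦w⟧ /\ wf_tm Γ2 comm_rhs R⟦w⟧ /\ wf_ty Γ large commOf.
Proof.
  assert (wf_tm Γ2 (var 1) S⟦w⟧) by (eapply wf_tsub_comp; mtt).
  assert (wf_tm Γ2 (var 0) S⟦w⟧).
  { eapply wf_tm_conv_sym; [apply wf_var0; mtt|eapply eq_TSub_comp; mtt]. }
  assert (wf_tm Γ2 F⟪w⟫ (Arrow S⟦w⟧ (Arrow S⟦w⟧ R⟦w⟧))).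
  { eapply wf_tm_conv; [eapply wf_tsub; mtt|]. eapply Arrow2_ev; mtt. }
  assert (wf_tm Γ2 comm_lhs R⟦w⟧) by (apply wf_app_two; mtt).
  assert (wf_tm Γ2 comm_rhs R⟦w⟧) by (apply wf_app_two; mtt).
  repeat split; mtt. unfold commOf; mtt.
Qed.

Lemma comm_ev (Δ : ctx m) th rho S' R' F' u v :
  wf_sub Δ th Γ2 -> eq_sub Δ (w ⊙ th) rho Γ ->
  eq_ty Δ large S⟦rho⟧ S' -> eq_ty Δ large R⟦rho⟧ R' ->
  eq_tm Δ F⟪rho⟫ F' (Arrow S' (Arrow S' R')) ->
  eq_tm Δ (var 1)⟪th⟫ u S' -> eq_tm Δ (var 0)⟪th⟫ v S' ->
  eq_tm Δ comm_lhs⟪th⟫ (app_two S' R' F' u v) R' /\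
  eq_tm Δ comm_rhs⟪th⟫ (app_two S' R' F' v u) R' /\
  eq_ty Δ large R⟦w⟧⟦th⟧ R'.
Proof.
  destruct comm_ctx as (?&?&?&?&?&?&?). intros.
  assert (eq_ty Δ large S⟦w⟧⟦th⟧ S') by (eapply ty_comp_ev; mtt).
  assert (eq_ty Δ large R⟦w⟧⟦th⟧ R') by (eapply ty_comp_ev; mtt).
  assert (wf_sub Δ rho Γ) by (eapply eq_sub_wf_r; mtt).
  assert (eq_ty Δ large (Arrow S (Arrow S R))⟦rho⟧ (Arrow S' (Arrow S' R'))) by (eapply Arrow2_ev; mtt).
  assert (eq_tm Δ F⟪w⟫⟪th⟫ F' (Arrow S' (Arrow S' R'))) by (eapply tm_comp_ev; mtt).
  repeat split; mtt; eapply app_two_ev; mtt.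
Qed.

Lemma comm_sext (Δ : ctx m) sg u v :
  wf_sub Δ sg Γ -> wf_tm Δ u S⟦sg⟧ -> wf_tm Δ v S⟦sg⟧ ->
  wf_sub Δ (sext 𝟙 sg u) (Γ,,S) /\ wf_sub Δ (sext 𝟙 (sext 𝟙 sg u) v) Γ2 /\
  eq_sub Δ (w ⊙ sext 𝟙 (sext 𝟙 sg u) v) sg Γ /\
  eq_tm Δ (var 1)⟪sext 𝟙 (sext 𝟙 sg u) v⟫ u S⟦sg⟧ /\
  eq_tm Δ (var 0)⟪sext 𝟙 (sext 𝟙 sg u) v⟫ v S⟦sg⟧.
Proof.
  intros.
  set (s1 := sext 𝟙 sg u). assert (W1 : wf_sub Δ s1 (Γ,,S)) by (unfold s1; mtt).
  assert (E1 : eq_sub Δ (swk ⊙ s1) sg Γ) by (apply swk_sext_hid with (A := S); mtt).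
  assert (T1 : eq_ty Δ large S⟦swk⟧⟦s1⟧ S⟦sg⟧) by (eapply TSub_comp_eq; mtt).
  set (s2 := sext 𝟙 s1 v). assert (W2 : wf_sub Δ s2 Γ2) by (unfold s2; mtt).
  assert (E2 : eq_sub Δ (swk ⊙ s2) s1 (Γ,,S)) by (apply swk_sext_hid with (A := S⟦swk⟧); mtt).
  assert (E2' : eq_sub Δ (w ⊙ s2) sg Γ).
  { eapply eq_sub_trans; [eapply eq_scomp_assoc; mtt|].
    eapply eq_sub_trans; [eapply eq_scomp; mtt|]; mtt. }
  assert (V1 : eq_tm Δ tvar⟪s1⟫ u S⟦sg⟧) by (eapply var0_sext with (Δ := Γ); mtt).
  assert (V2 : eq_tm Δ tvar⟪s2⟫ v S⟦sg⟧).
  { eapply eq_tm_conv; [eapply var0_sext with (Δ := Γ,,S) (A := S⟦swk⟧); mtt|]; mtt. }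
  repeat split; mtt. eapply tm_comp_ev; mtt; mtt.
Qed.

(** Reflection gives the equation for two generic variables over [Δ]. A further [tau] with arguments
    [u] and [v] forms an environment; composed with the double lift of [sg], it becomes [sg ⊙ tau]
    extended by [u] and [v], in which [comm_ev] evaluates both sides. *)
Lemma commOf_elim (Δ : ctx m) sg S' R' F' p :
  wf_sub Δ sg Γ -> eq_ty Δ large S⟦sg⟧ S' -> eq_ty Δ large R⟦sg⟧ R' ->
  eq_tm Δ F⟪sg⟫ F' (Arrow S' (Arrow S' R')) ->
  wf_tm Δ p commOf⟦sg⟧ -> commutes Δ S' R' F'.
Proof.
  destruct comm_ctx as (?&?&?&?&?&?&?).
  intros W ES ER EF Wp Θ tau S2 R2 F2 u v Wt ES2 ER2 EF2 Wu Wv.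
  destruct (Pi2_Eq_sub (Γ := Γ) (Δ := Δ) (S0 := S) (S1 := S⟦swk⟧) (T := R⟦w⟧)
    (a := comm_lhs) (b := comm_rhs) (sg := sg)) as [W2 E2]; mtt.
  assert (E : eq_tm (Δ,,S⟦sg⟧,,S⟦swk⟧⟦slift 𝟙 sg⟧) comm_lhs⟪slift 𝟙 (slift 𝟙 sg)⟫
    comm_rhs⟪slift 𝟙 (slift 𝟙 sg)⟫ R⟦w⟧⟦slift 𝟙 (slift 𝟙 sg)⟧).
  { eapply Pi2_Eq_elim; mtt. eapply wf_tm_conv; [exact Wp|exact E2]. }
  assert (TS : eq_ty Θ large S⟦sg ⊙ tau⟧ S2) by (eapply TSub_comp_trans; mtt).
  assert (TR : eq_ty Θ large R⟦sg ⊙ tau⟧ R2) by (eapply TSub_comp_trans; mtt).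
  assert (TF : eq_tm Θ F⟪sg ⊙ tau⟫ F2 (Arrow S2 (Arrow S2 R2))).
  { eapply tsub_comp_trans with (T' := Arrow S' (Arrow S' R')); mtt; eapply Arrow2_ev; mtt. }
  assert (TSt : eq_ty Θ large S⟦sg⟧⟦tau⟧ S2).
  { eapply eq_ty_trans; [eapply eq_TSub_ty; [exact Wt|exact ES]|]; mtt. }
  destruct (comm_sext (Δ := Θ) (sg := sg ⊙ tau) (u := u) (v := v)) as (?&?&?&?&?); mtt.
  assert (Wt1 : wf_sub Θ (sext 𝟙 tau u) (Δ,,S⟦sg⟧)) by mtt.
  assert (X1 : eq_sub Θ (slift 𝟙 sg ⊙ sext 𝟙 tau u) (sext 𝟙 (sg ⊙ tau) u) (Γ,,S))
    by (apply slift_sext_hid with (Δ := Δ); mtt).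
  assert (wf_tm Θ v S⟦swk⟧⟦slift 𝟙 sg⟧⟦sext 𝟙 tau u⟧).
  { eapply wf_tm_conv_sym; [exact Wv|]. eapply ty_comp_ev; mtt.
    eapply ty_comp_ev; [| |apply swk_sext_hid with (A := S)| |]; mtt. }
  assert (Wt2 : wf_sub Θ (sext 𝟙 (sext 𝟙 tau u) v) (Δ,,S⟦sg⟧,,S⟦swk⟧⟦slift 𝟙 sg⟧)) by mtt.
  assert (X2 : eq_sub Θ (slift 𝟙 (slift 𝟙 sg) ⊙ sext 𝟙 (sext 𝟙 tau u) v)
    (sext 𝟙 (sext 𝟙 (sg ⊙ tau) u) v) Γ2).
  { eapply eq_sub_trans; [apply slift_sext_hid with (Δ := Δ,,S⟦sg⟧); mtt|].
    eapply eq_sext_hid; mtt. apply eq_tm_refl.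
    eapply wf_tm_conv; [eassumption|]. apply eq_ty_sym; eapply eq_TSub_comp; mtt. }
  destruct (comm_ev (Δ := Θ) (th := sext 𝟙 (sext 𝟙 (sg ⊙ tau) u) v) (rho := sg ⊙ tau)
    (S' := S2) (R' := R2) (F' := F2) (u := u) (v := v)) as (L1&L2&L3); mtt.
  { eapply eq_tm_conv; mtt. }
  { eapply eq_tm_conv; mtt. }
  assert (L4 : eq_ty Θ large R⟦w⟧⟦slift 𝟙 (slift 𝟙 sg)⟧⟦sext 𝟙 (sext 𝟙 tau u) v⟧ R2)
    by (eapply ty_comp_ev; mtt).
  eapply eq_tm_trans; [apply eq_tm_sym; eapply tm_comp_ev with (M := comm_lhs); mtt|].
  eapply eq_tm_trans; [|eapply tm_comp_ev with (M := comm_rhs); mtt].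
  eapply eq_tm_conv; [eapply eq_tsub; [apply eq_sub_refl; exact Wt2|exact E]|exact L4].
Qed.

Lemma swk2_slift2 (Δ : ctx m) sg : wf_sub Δ sg Γ ->
  wf_sub (Δ,,S⟦sg⟧,,S⟦swk⟧⟦slift 𝟙 sg⟧) w Δ /\
  wf_sub (Δ,,S⟦sg⟧,,S⟦swk⟧⟦slift 𝟙 sg⟧) (slift 𝟙 (slift 𝟙 sg)) Γ2 /\
  eq_sub (Δ,,S⟦sg⟧,,S⟦swk⟧⟦slift 𝟙 sg⟧) (w ⊙ slift 𝟙 (slift 𝟙 sg)) (sg ⊙ w) Γ.
Proof.
  intros.
  assert (W2 : wf_sub (Δ,,S⟦sg⟧,,S⟦swk⟧⟦slift 𝟙 sg⟧) (slift 𝟙 (slift 𝟙 sg)) Γ2)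
    by (apply wf_slift_hid; mtt).
  repeat split; mtt.
  eapply eq_sub_trans; [eapply eq_scomp_assoc; mtt|].
  eapply eq_sub_trans.
  { eapply eq_scomp; [apply swk_slift_hid with (A := S⟦swk⟧)|apply eq_sub_refl]; mtt. all: mtt. }
  eapply eq_sub_trans; [apply eq_sub_sym; eapply eq_scomp_assoc; mtt|].
  eapply eq_sub_trans.
  { eapply eq_scomp; [apply eq_sub_refl|apply swk_slift_hid with (A := S)]; mtt. }
  eapply eq_scomp_assoc; mtt.
Qed.

Lemma commOf_intro (Δ : ctx m) sg S' R' F' :
  wf_sub Δ sg Γ -> eq_ty Δ large S⟦sg⟧ S' -> eq_ty Δ large R⟦sg⟧ R' ->
  eq_tm Δ F⟪sg⟫ F' (Arrow S' (Arrow S' R')) ->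
  commutes Δ S' R' F' -> exists q, wf_tm Δ q commOf⟦sg⟧.
Proof.
  destruct comm_ctx as (?&?&?&?&?&?&?). intros W ES ER EF HC.
  destruct (Pi2_Eq_sub (Γ := Γ) (Δ := Δ) (S0 := S) (S1 := S⟦swk⟧) (T := R⟦w⟧)
    (a := comm_lhs) (b := comm_rhs) (sg := sg)) as [W2 E2]; mtt.
  destruct (swk2_slift2 (Δ := Δ) (sg := sg)) as (K1&K2&K3); mtt.
  set (Δ2 := Δ,,S⟦sg⟧,,S⟦swk⟧⟦slift 𝟙 sg⟧) in *. set (s2 := slift 𝟙 (slift 𝟙 sg)) in *.
  assert (TS : eq_ty Δ2 large S⟦sg ⊙ w⟧ S'⟦w⟧) by (eapply TSub_comp_trans; mtt).
  assert (TR : eq_ty Δ2 large R⟦sg ⊙ w⟧ R'⟦w⟧) by (eapply TSub_comp_trans; mtt).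
  assert (TA : eq_ty Δ2 large (Arrow S' (Arrow S' R'))⟦w⟧ (Arrow S'⟦w⟧ (Arrow S'⟦w⟧ R'⟦w⟧)))
    by (eapply Arrow2_ev; mtt).
  assert (WF' : wf_tm Δ2 F'⟪w⟫ (Arrow S'⟦w⟧ (Arrow S'⟦w⟧ R'⟦w⟧))).
  { eapply wf_tm_conv; [eapply wf_tsub; mtt|exact TA]. }
  assert (TF : eq_tm Δ2 F⟪sg ⊙ w⟫ F'⟪w⟫ (Arrow S'⟦w⟧ (Arrow S'⟦w⟧ R'⟦w⟧))).
  { eapply tsub_comp_trans with (T' := Arrow S' (Arrow S' R')); mtt; eapply Arrow2_ev; mtt. }
  assert (TSs : eq_ty Δ2 large S⟦w⟧⟦s2⟧ S'⟦w⟧) by (eapply ty_comp_ev; mtt).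
  assert (V1 : wf_tm Δ2 (var 1)⟪s2⟫ S'⟦w⟧) by (eapply wf_tm_conv; [eapply wf_tsub; mtt|exact TSs]).
  assert (V0 : wf_tm Δ2 (var 0)⟪s2⟫ S'⟦w⟧) by (eapply wf_tm_conv; [eapply wf_tsub; mtt|exact TSs]).
  destruct (comm_ev (Δ := Δ2) (th := s2) (rho := sg ⊙ w)
    (S' := S'⟦w⟧) (R' := R'⟦w⟧) (F' := F'⟪w⟫) (u := (var 1)⟪s2⟫) (v := (var 0)⟪s2⟫)) as (L1&L2&L3); mtt.
  eexists. eapply wf_tm_conv_sym; [|exact E2]. apply Pi2_Eq_intro; mtt.
  eapply eq_tm_conv_sym; [|exact L3].
  eapply eq_tm_trans; [exact L1|]. eapply eq_tm_trans; [|apply eq_tm_sym; exact L2].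
  (* The external property is used at the weakening past the two bound variables, with these
     variables as arguments. *)
  apply HC with (sg := w); mtt.
Qed.

End Comm.

(** * Löb induction for [zipWith'] *)

(** This opens a hypothesis [r] of modal type while proving an equation. The equation is read over a
    dummy variable of type [TMod mu X], [TMod_ext] replaces that variable by mod_mu of one annotated
    [mu], and instantiation at [r] leads back to [Δ]. *)
Lemma TMod_weaken n m (mu : hom n m) (Δ : ctx m) X C M N r :
  wf_ty (Δ,{mu}) large X -> wf_tm Δ r (TMod mu X) -> wf_tm Δ M C -> wf_tm Δ N C ->
  eq_tm (Δ,[mu ∣ X]) M⟪swk⟫ N⟪swk⟫ C⟦swk⟧ -> eq_tm Δ M N C.
Proof.
  intros.
  assert (W1 : wf_sub Δ (sone 𝟙 r) (Δ,,TMod mu X)) by mtt.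
  assert (W2 : wf_sub (Δ,[mu ∣ X]) (smodv 𝟙 mu) (Δ,,TMod mu X)) by (apply wf_smodv_hid; mtt).
  assert (E1 : eq_sub Δ (swk ⊙ sone 𝟙 r) sid Δ) by (apply swk_sone with (A := TMod mu X); mtt).
  assert (E2 : eq_sub (Δ,[mu ∣ X]) (swk ⊙ smodv 𝟙 mu) swk Δ) by (apply swk_smodv; mtt).
  assert (TI : eq_ty Δ large C⟦sid⟧ C) by (apply eq_TSub_id; mtt).
  assert (T1 : eq_ty Δ large C⟦swk⟧⟦sone 𝟙 r⟧ C) by (eapply ty_comp_ev; mtt).
  assert (T2 : eq_ty (Δ,[mu ∣ X]) large C⟦swk⟧⟦smodv 𝟙 mu⟧ C⟦swk⟧) by (eapply ty_comp_ev; mtt).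
  assert (P1 : forall K, wf_tm Δ K C -> eq_tm Δ K⟪swk⟫⟪sone 𝟙 r⟫ K C).
  { intros. eapply tm_comp_ev; mtt. apply eq_tsub_id; mtt. }
  assert (P2 : forall K, wf_tm Δ K C -> eq_tm (Δ,[mu ∣ X]) K⟪swk⟫⟪smodv 𝟙 mu⟫ K⟪swk⟫ C⟦swk⟧).
  { intros. eapply tm_comp_ev; mtt. }
  eapply eq_tm_trans; [apply eq_tm_sym, P1; mtt|]. eapply eq_tm_trans; [|apply P1; mtt].
  eapply eq_tm_conv; [|exact T1]. eapply TMod_ext with (A := X); mtt.
  eapply eq_tm_conv_sym; [|exact T2].
  eapply eq_tm_trans; [apply P2; mtt|]. eapply eq_tm_trans; [|apply eq_tm_sym, P2; mtt]. mtt.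
Qed.

(** After one unfolding on each side, all that remains of the induction is the commutativity of the
    delayed copy of [zipWith'], which is a premise here. *)
Lemma zip_step (Δ : ctx mt) A B f u v :
  wf_tm (Δ,{del}) A TU -> wf_tm (Δ,{del}) B TU -> wf_tm (Δ,{del}) f (zipFunTy A B) ->
  wf_tm Δ u (TEl (Str' A)) -> wf_tm Δ v (TEl (Str' A)) ->
  commutes (Δ,{del}) (TEl A) (TEl B) f ->
  commutes (Δ,{ell}) (TEl (Str' A))⟦key1l⟧ (TEl (Str' B))⟦key1l⟧
    (zipWith' A A B (tmod del f))⟪key1l⟫ ->
  eq_tm Δ (app_two (TEl (Str' A)) (TEl (Str' B)) (zipWith' A A B (tmod del f)) u v)
    (app_two (TEl (Str' A)) (TEl (Str' B)) (zipWith' A A B (tmod del f)) v u) (TEl (Str' B)).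
Proof.
  intros.
  assert (wf_tm Δ (zipWith' A A B (tmod del f)) (zipTy A A B)) by (apply wf_zipWith'; mtt).
  destruct (zipTy_key1l (Γ := Δ) (A := A) (B := B)) as (?&?&?); mtt.
  assert (wf_tm (Δ,{ell}) (zipWith' A A B (tmod del f))⟪key1l⟫ (zipRecTy A B)).
  { eapply wf_tm_conv; [eapply wf_tsub; mtt|]; mtt. }
  eapply eq_tm_trans; [apply zipWith'_app; mtt|].
  eapply eq_tm_trans; [|apply eq_tm_sym, zipWith'_app; mtt].
  apply zipBody_comm; mtt.
Qed.

(** Establishing [commutes] means working over an arbitrary [Δ] with a map [rho] to [Γ]. There the
    data are known only up to equality, as [A'], [B'], [f'], and the Löb hypothesis is a term [r] of
    its substituted type. *)
Lemma zip_core (Γ Δ : ctx mt) A B f A' B' f' rho r u v :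
  wf_tm (Γ,{del}) A TU -> wf_tm (Γ,{del}) B TU -> wf_tm (Γ,{del}) f (zipFunTy A B) ->
  commutes (Γ,{del}) (TEl A) (TEl B) f ->
  wf_sub Δ rho Γ ->
  eq_tm (Δ,{del}) A⟪slock rho del⟫ A' TU -> eq_tm (Δ,{del}) B⟪slock rho del⟫ B' TU ->
  eq_tm (Δ,{del}) f⟪slock rho del⟫ f' (zipFunTy A' B') ->
  wf_tm Δ r (Later (commOf (TEl (Str' A)) (TEl (Str' B)) (zipWith' A A B (tmod del f)))⟦key1l⟧)⟦rho⟧ ->
  wf_tm Δ u (TEl (Str' A')) -> wf_tm Δ v (TEl (Str' A')) ->
  eq_tm Δ (app_two (TEl (Str' A')) (TEl (Str' B')) (zipWith' A' A' B' (tmod del f')) u v)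
    (app_two (TEl (Str' A')) (TEl (Str' B')) (zipWith' A' A' B' (tmod del f')) v u) (TEl (Str' B')).
Proof.
  intros wA wB wf HC Wr EA EB Ef wr wu wv.
  destruct (zip_types (Γ := Γ) (A := A) (B := B)) as (?&?&?&?&?&?&?&?&?&?); mtt.
  destruct (zip_types (Γ := Δ) (A := A') (B := B')) as (?&?&?&?&?&?&?&?&?&?); mtt.
  set (Z := zipWith' A A B (tmod del f)) in *.
  assert (wZ : wf_tm Γ Z (zipTy A A B)) by (apply wf_zipWith'; mtt).
  set (T := commOf (TEl (Str' A)) (TEl (Str' B)) Z) in *.
  assert (wT : wf_ty Γ large T) by (apply comm_ctx; mtt).
  set (X := T⟦key1l⟧⟦slock rho ell⟧).
  assert (wX : wf_ty (Δ,{ell}) large X) by (unfold X; mtt).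
  assert (wr' : wf_tm Δ r (TMod ell X)).
  { eapply wf_tm_conv; [exact wr|]. eapply TMod_ev; mtt. }
  set (Z' := zipWith' A' A' B' (tmod del f')).
  assert (wZ' : wf_tm Δ Z' (zipTy A' A' B')) by (apply wf_zipWith'; mtt).
  assert (wf_tm Δ (app_two (TEl (Str' A')) (TEl (Str' B')) Z' u v) (TEl (Str' B')))
    by (apply wf_app_two; mtt).
  assert (wf_tm Δ (app_two (TEl (Str' A')) (TEl (Str' B')) Z' v u) (TEl (Str' B')))
    by (apply wf_app_two; mtt).
  (* From here on the Löb hypothesis is a variable annotated with ℓ; everything else is weakened
     past it. *)
  eapply TMod_weaken; [exact wX|exact wr'|mtt|mtt|].
  set (D := Δ,[ell ∣ X]). assert (wD : wf_sub D swk Δ) by (unfold D; mtt).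
  set (As := A'⟪slock swk del⟫). set (Bs := B'⟪slock swk del⟫). set (fs := f'⟪slock swk del⟫).
  assert (wAs : wf_tm (D,{del}) As TU) by (unfold As; mtt).
  assert (wBs : wf_tm (D,{del}) Bs TU) by (unfold Bs; mtt).
  assert (Tf : eq_ty (D,{del}) large (zipFunTy A' B')⟦slock swk del⟧ (zipFunTy As Bs))
    by (eapply zipFunTy_ev; mtt).
  assert (wfs : wf_tm (D,{del}) fs (zipFunTy As Bs)).
  { eapply wf_tm_conv; [eapply wf_tsub; mtt|exact Tf]. }
  assert (EAs : eq_tm (D,{del}) A⟪slock (rho ⊙ swk) del⟫ As TU) by (eapply tm_lock_TU_trans; mtt).
  assert (EBs : eq_tm (D,{del}) B⟪slock (rho ⊙ swk) del⟫ Bs TU) by (eapply tm_lock_TU_trans; mtt).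
  assert (TfG : eq_ty (Δ,{del}) large (zipFunTy A B)⟦slock rho del⟧ (zipFunTy A' B'))
    by (eapply zipFunTy_ev; mtt).
  assert (Efs : eq_tm (D,{del}) f⟪slock (rho ⊙ swk) del⟫ fs (zipFunTy As Bs)).
  { eapply eq_tm_trans with (N := f⟪slock rho del ⊙ slock swk del⟫).
    - eapply eq_tm_conv; [eapply eq_tsub; [eapply eq_slock_scomp; mtt|mtt]|].
      eapply zipFunTy_ev; mtt.
    - eapply tsub_comp_trans; mtt. }
  set (Zs := zipWith' As As Bs (tmod del fs)).
  assert (EZ' : eq_tm D Z'⟪swk⟫ Zs (zipTy As As Bs)).
  { eapply zipWith'_ev; mtt. eapply tmod_ev; mtt. }
  assert (EZ : eq_tm D Z⟪rho ⊙ swk⟫ Zs (zipTy As As Bs)).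
  { eapply zipWith'_ev; mtt. eapply tmod_ev; mtt. eapply zipFunTy_ev; mtt. }
  assert (TS : eq_ty D large (TEl (Str' A'))⟦swk⟧ (TEl (Str' As))) by (eapply El_Str'_ev; mtt).
  assert (TR : eq_ty D large (TEl (Str' B'))⟦swk⟧ (TEl (Str' Bs))) by (eapply El_Str'_ev; mtt).
  assert (wus : wf_tm D u⟪swk⟫ (TEl (Str' As))) by (eapply wf_tm_conv; [eapply wf_tsub; mtt|exact TS]).
  assert (wvs : wf_tm D v⟪swk⟫ (TEl (Str' As))) by (eapply wf_tm_conv; [eapply wf_tsub; mtt|exact TS]).
  assert (HCs : commutes (D,{del}) (TEl As) (TEl Bs) fs).
  { eapply commutes_sub with (Γ := Γ,{del}) (sg := slock (rho ⊙ swk) del); [| | | | | | |exact HC]; mtt;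
      eapply TEl_ev; mtt. }
  destruct (zipTy_key1l (Γ := D) (A := As) (B := Bs)) as (?&?&?); mtt.
  assert (wZsk : wf_tm (D,{ell}) Zs⟪key1l⟫ (zipRecTy As Bs)).
  { eapply wf_tm_conv; [eapply wf_tsub; mtt|]; mtt. }
  assert (HZ : commutes (D,{ell}) (TEl (Str' As))⟦key1l⟧ (TEl (Str' Bs))⟦key1l⟧ Zs⟪key1l⟫).
  (* Behind the lock the opened hypothesis is [tvar]. Naturality of the key converts its type to [T]
     along [rho ⊙ swk ⊙ key1l], an instance of [commOf], so it yields commutativity of exactly the
     delayed copy that [zip_step] asks for. *)
  { eapply commOf_elim with (Γ := Γ) (S := TEl (Str' A)) (R := TEl (Str' B)) (F := Z) (sg := rho ⊙ swk ⊙ key1l) (p := tvar); mtt.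
    - eapply TSub_comp_trans with (T' := TEl (Str' As)); mtt. eapply El_Str'_ev; mtt.
    - eapply TSub_comp_trans with (T' := TEl (Str' Bs)); mtt. eapply El_Str'_ev; mtt.
    - eapply tsub_comp_trans with (T' := zipTy As As Bs); mtt. eapply zipTy_ev; mtt.
    - assert (wv0 : wf_tm (D,{ell}) tvar X⟦slock swk ell⟧) by (apply wf_tvar; mtt).
      eapply wf_tm_conv; [exact wv0|].
      eapply eq_ty_trans; [apply eq_ty_sym; eapply TSub_slock_comp; mtt|].
      eapply TSub_comp_eq; [| |apply eq_sub_sym, key1l_nat|]; mtt. }
  assert (E1 : eq_tm D (app_two (TEl (Str' A')) (TEl (Str' B')) Z' u v)⟪swk⟫
    (app_two (TEl (Str' As)) (TEl (Str' Bs)) Zs u⟪swk⟫ v⟪swk⟫) (TEl (Str' Bs)))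
    by (eapply app_two_ev; mtt).
  assert (E2 : eq_tm D (app_two (TEl (Str' A')) (TEl (Str' B')) Z' v u)⟪swk⟫
    (app_two (TEl (Str' As)) (TEl (Str' Bs)) Zs v⟪swk⟫ u⟪swk⟫) (TEl (Str' Bs)))
    by (eapply app_two_ev; mtt).
  eapply eq_tm_conv_sym; [|exact TR].
  eapply eq_tm_trans; [exact E1|]. eapply eq_tm_trans; [|apply eq_tm_sym; exact E2].
  apply zip_step; mtt.
Qed.

Lemma zipWith'_commutes (Γ : ctx mt) A B f : wf_ctx Γ ->
  wf_tm (Γ,{del}) A TU -> wf_tm (Γ,{del}) B TU -> wf_tm (Γ,{del}) f (zipFunTy A B) ->
  commutes (Γ,{del}) (TEl A) (TEl B) f ->
  commutes Γ (TEl (Str' A)) (TEl (Str' B)) (zipWith' A A B (tmod del f)).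
Proof.
  intros wΓ wA wB wf HC.
  destruct (zip_types (Γ := Γ) (A := A) (B := B)) as (?&?&?&?&?&?&?&?&?&?); mtt.
  set (Z := zipWith' A A B (tmod del f)) in *.
  assert (wZ : wf_tm Γ Z (zipTy A A B)) by (apply wf_zipWith'; mtt).
  set (T := commOf (TEl (Str' A)) (TEl (Str' B)) Z) in *.
  assert (wT : wf_ty Γ large T) by (apply comm_ctx; mtt).
  set (L := Later T⟦key1l⟧). assert (wL : wf_ty Γ large L) by (unfold L; mtt).
  assert (Q : exists q, wf_tm (Γ,,L) q T⟦swk⟧).
  { eapply commOf_intro with (Γ := Γ) (S := TEl (Str' A)) (R := TEl (Str' B)) (S' := (TEl (Str' A))⟦swk⟧) (R' := (TEl (Str' B))⟦swk⟧)
      (F' := Z⟪swk⟫); mtt.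
    - apply eq_tm_refl. eapply wf_tm_conv; [eapply wf_tsub; mtt|]. eapply Arrow2_ev; mtt.
    (* Over [Γ,,L] a substitution [tau] reaches [Γ] through [swk ⊙ tau], and the Löb hypothesis
       becomes [tvar⟪tau⟫]. [S'], [R'] and [F'] are given only up to equality and are first replaced
       by the forms that [zip_core] uses. *)
    - intros Δ tau S' R' F' u v Wt ES ER EF Wu Wv.
      set (A' := A⟪slock (swk ⊙ tau) del⟫). set (B' := B⟪slock (swk ⊙ tau) del⟫).
      set (f' := f⟪slock (swk ⊙ tau) del⟫).
      assert (wA' : wf_tm (Δ,{del}) A' TU) by (unfold A'; mtt).
      assert (wB' : wf_tm (Δ,{del}) B' TU) by (unfold B'; mtt).
      assert (wf' : wf_tm (Δ,{del}) f' (zipFunTy A' B')).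
      { eapply wf_tm_conv; [eapply wf_tsub; mtt|]. eapply zipFunTy_ev; mtt. }
      assert (TS : eq_ty Δ large (TEl (Str' A))⟦swk ⊙ tau⟧ (TEl (Str' A')))
        by (eapply El_Str'_ev; mtt).
      assert (TR : eq_ty Δ large (TEl (Str' B))⟦swk ⊙ tau⟧ (TEl (Str' B')))
        by (eapply El_Str'_ev; mtt).
      assert (ES' : eq_ty Δ large S' (TEl (Str' A'))).
      { eapply eq_ty_trans; [|exact TS]. apply eq_ty_sym. eapply TSub_comp_trans; mtt. }
      assert (ER' : eq_ty Δ large R' (TEl (Str' B'))).
      { eapply eq_ty_trans; [|exact TR]. apply eq_ty_sym. eapply TSub_comp_trans; mtt. }
      assert (EZ : eq_tm Δ Z⟪swk ⊙ tau⟫ (zipWith' A' A' B' (tmod del f')) (zipTy A' A' B')).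
      { eapply zipWith'_ev; mtt. eapply tmod_ev; mtt. eapply zipFunTy_ev; mtt. }
      assert (TA : eq_ty Δ large (zipTy A' A' B') (Arrow S' (Arrow S' R'))).
      {
        apply eq_Arrow; mtt. apply eq_Arrow; mtt. }
      assert (EF' : eq_tm Δ F' (zipWith' A' A' B' (tmod del f')) (Arrow S' (Arrow S' R'))).
      { eapply eq_tm_trans; [apply eq_tm_sym; exact EF|].
        eapply eq_tm_trans; [|eapply eq_tm_conv; [exact EZ|exact TA]].
        apply eq_tm_sym.
        assert (TB : eq_ty Δ large (zipTy A A B)⟦swk ⊙ tau⟧ (Arrow S' (Arrow S' R'))).
        { eapply eq_ty_trans; [eapply zipTy_ev; mtt|exact TA]. }
        eapply eq_tm_conv; [eapply eq_tsub_comp; mtt|exact TB]. }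
      assert (wr : wf_tm Δ tvar⟪tau⟫ L⟦swk ⊙ tau⟧).
      { eapply wf_tsub_comp; mtt. }
      assert (CORE : eq_tm Δ
        (app_two (TEl (Str' A')) (TEl (Str' B')) (zipWith' A' A' B' (tmod del f')) u v)
        (app_two (TEl (Str' A')) (TEl (Str' B')) (zipWith' A' A' B' (tmod del f')) v u)
        (TEl (Str' B'))).
      { eapply zip_core with (Γ := Γ) (A := A) (B := B) (f := f) (rho := swk ⊙ tau) (r := tvar⟪tau⟫); mtt. }
      eapply eq_tm_trans; [apply eq_app_two; mtt|].
      eapply eq_tm_trans; [|apply eq_tm_sym, eq_app_two; mtt].
      eapply eq_tm_conv; [exact CORE|mtt]. }
  destruct Q as [q Wq].
  (* The restriction along the key in [L] is the one demanded by the typing rule of [tlob], so [q]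
     is the body of a guarded fixed point. *)
  assert (Wp : wf_tm Γ (tlob T (tlam L q)) T).
  { apply wf_tlob; mtt. apply wf_nlam; mtt. }
  assert (TI : forall K, wf_ty Γ large K -> eq_ty Γ large K⟦sid⟧ K)
    by (intros; apply eq_TSub_id; mtt).
  eapply commOf_elim with (Γ := Γ) (S := TEl (Str' A)) (R := TEl (Str' B)) (F := Z) (sg := sid) (p := tlob T (tlam L q)); mtt.
  - apply TI; mtt.
  - apply TI; mtt.
  - apply eq_tsub_id; mtt.
  - eapply wf_tm_conv_sym; [exact Wp|apply TI; mtt].
Qed.

(** * Streams at mode s *)

(** [gam ∘ del] and [𝟙] are related by [hle] both ways, so the composite lock can be removed. This
    is what gives meaning to data of mode s inside [Str'] and [zipWith']. *)
Lemma eq_ctx_gam_del (Γ : ctx ms) : wf_ctx Γ -> eq_ctx Γ (Γ,{gam},{del}).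
Proof.
  intros. eapply eq_ctx_trans; [apply eq_clock_id'; mtt|].
  eapply eq_ctx_trans with (Δ := Γ,{gam ∘ del}); [|apply eq_clock_comp; mtt].
  apply eq_clock; mtt. split; [apply hle_gam_del'|apply hle_gam_del].
Qed.

(** Equality of the contexts does not by itself relate the substitutions: [eq_slock_hcomp] fuses the
    two locks into that of [gam ∘ del], which [eq_slock] and [eq_slock_hid] then remove. *)
Lemma slock_gam_del (Γ Δ : ctx ms) sg :
  wf_sub Γ sg Δ -> eq_sub Γ (slock (slock sg gam) del) sg Δ.
Proof.
  intros.
  assert (K : forall Θ : ctx ms, wf_ctx Θ -> eq_ctx (Θ,{gam ∘ del}) Θ).
  { intros. eapply eq_ctx_trans; [|apply eq_clock_id; mtt].
    apply eq_clock; mtt. split; [apply hle_gam_del|apply hle_gam_del']. }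
  eapply eq_sub_trans; [|apply eq_slock_hid; mtt].
  eapply eq_sub_ctx; [|apply K; mtt|apply K; mtt].
  eapply eq_sub_trans; [apply eq_sub_sym, eq_slock_hcomp; mtt|].
  apply eq_slock; mtt. split; [apply hle_gam_del|apply hle_gam_del'].
Qed.

Lemma tm_gam_del_ev (Γ Δ : ctx ms) M M' T T' sg :
  wf_sub Δ sg Γ -> wf_tm Γ M T -> eq_ty Δ large T⟦sg⟧ T' -> eq_tm Δ M⟪sg⟫ M' T' ->
  eq_tm (Δ,{gam},{del}) M⟪slock (slock sg gam) del⟫ M' T'.
Proof.
  intros. eapply eq_tm_ctx; [|apply eq_ctx_gam_del; mtt].
  eapply eq_tm_trans; [|eassumption]. eapply eq_tm_conv; [|eassumption].
  apply eq_tm_sym. eapply eq_tsub; [apply eq_sub_sym, slock_gam_del; mtt|mtt].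
Qed.

Lemma wf_tm_gam_del (Γ : ctx ms) M T : wf_tm Γ M T -> wf_tm (Γ,{gam},{del}) M T.
Proof. intros. eapply wf_tm_ctx; [eassumption|apply eq_ctx_gam_del; mtt]. Qed.

Lemma zipWith_eq A B f x y :
  zipWith A A B f x y = ast_two gam (TEl (Str' A)) (TEl (Str' B))
    (tmod gam (zipWith' A A B (tmod del f))) x y.
Proof. reflexivity. Qed.

Lemma Str_types (Γ : ctx ms) A : wf_tm Γ A TU ->
  wf_tm (Γ,{gam}) (Str' A) TU /\ wf_tm Γ (Str A) TU /\
  eq_ty Γ large (TEl (Str A)) (TMod gam (TEl (Str' A))).
Proof.
  intros.
  assert (wf_tm (Γ,{gam},{del}) A TU) by (apply wf_tm_gam_del; mtt).
  assert (wf_tm (Γ,{gam}) (Str' A) TU) by (apply wf_Str'; mtt).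
  repeat split; mtt; [unfold Str, cmod; mtt|].
  apply eq_ty_large, eq_TEl_code; mtt.
Qed.

Lemma Str_ev (Γ Δ : ctx ms) A A' sg :
  wf_sub Δ sg Γ -> wf_tm Γ A TU -> eq_tm Δ A⟪sg⟫ A' TU -> eq_tm Δ (Str A)⟪sg⟫ (Str A') TU.
Proof.
  intros.
  destruct (Str_types (Γ := Γ) (A := A)) as (?&?&?); mtt.
  assert (wf_tm (Γ,{gam},{del}) A TU) by (apply wf_tm_gam_del; mtt).
  eapply cmod_ev; mtt. eapply Str'_ev; mtt. eapply tm_gam_del_ev; mtt. eapply TU_ev; mtt.
Qed.

Section ZipWith.
Variables (Γ : ctx ms) (A B f x y : tm ms).
Hypotheses (wA : wf_tm Γ A TU) (wB : wf_tm Γ B TU) (wf : wf_tm Γ f (zipFunTy A B))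
  (wx : wf_tm Γ x (TEl (Str A))) (wy : wf_tm Γ y (TEl (Str A))).

Lemma wf_zipWith_parts :
  wf_tm (Γ,{gam}) (zipWith' A A B (tmod del f)) (zipTy A A B) /\
  wf_tm Γ (tmod gam (zipWith' A A B (tmod del f))) (TMod gam (zipTy A A B)) /\
  wf_tm Γ x (TMod gam (TEl (Str' A))) /\ wf_tm Γ y (TMod gam (TEl (Str' A))) /\
  wf_tm (Γ,{gam}) (tmod del f) (TMod del (zipFunTy A B)).
Proof.
  destruct (Str_types (Γ := Γ) (A := A)) as (?&?&?); mtt.
  assert (wf_tm (Γ,{gam},{del}) A TU) by (apply wf_tm_gam_del; mtt).
  assert (wf_tm (Γ,{gam},{del}) B TU) by (apply wf_tm_gam_del; mtt).
  assert (wf_tm (Γ,{gam},{del}) f (zipFunTy A B)) by (apply wf_tm_gam_del; mtt).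
  assert (wf_tm (Γ,{gam}) (zipWith' A A B (tmod del f)) (zipTy A A B))
    by (apply wf_zipWith'; mtt).
  repeat split; mtt.
Qed.

Lemma wf_zipWith : wf_tm Γ (zipWith A A B f x y) (TEl (Str B)).
Proof.
  destruct wf_zipWith_parts as (?&?&?&?&?).
  destruct (Str_types (Γ := Γ) (A := A)) as (?&?&?); mtt.
  destruct (Str_types (Γ := Γ) (A := B)) as (?&?&?); mtt.
  rewrite zipWith_eq. eapply wf_tm_conv_sym; [|eassumption]. apply wf_ast_two; mtt.
Qed.

Lemma zipWith_ev (Δ : ctx ms) A' B' f' x' y' sg :
  wf_sub Δ sg Γ -> eq_tm Δ A⟪sg⟫ A' TU -> eq_tm Δ B⟪sg⟫ B' TU ->
  eq_tm Δ f⟪sg⟫ f' (zipFunTy A' B') ->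
  eq_tm Δ x⟪sg⟫ x' (TEl (Str A')) -> eq_tm Δ y⟪sg⟫ y' (TEl (Str A')) ->
  eq_tm Δ (zipWith A A B f x y)⟪sg⟫ (zipWith A' A' B' f' x' y') (TEl (Str B')).
Proof.
  intros. destruct wf_zipWith_parts as (?&?&?&?&?).
  destruct (Str_types (Γ := Γ) (A := A)) as (?&?&?); mtt.
  destruct (Str_types (Γ := Γ) (A := B)) as (?&?&?); mtt.
  destruct (Str_types (Γ := Δ) (A := A')) as (?&?&?); mtt.
  destruct (Str_types (Γ := Δ) (A := B')) as (?&?&?); mtt.
  assert (wf_tm (Γ,{gam},{del}) A TU) by (apply wf_tm_gam_del; mtt).
  assert (wf_tm (Γ,{gam},{del}) B TU) by (apply wf_tm_gam_del; mtt).
  assert (wf_tm (Γ,{gam},{del}) f (zipFunTy A B)) by (apply wf_tm_gam_del; mtt).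
  assert (EA : eq_tm (Δ,{gam},{del}) A⟪slock (slock sg gam) del⟫ A' TU).
  { eapply tm_gam_del_ev; mtt. eapply TU_ev; mtt. }
  assert (EB : eq_tm (Δ,{gam},{del}) B⟪slock (slock sg gam) del⟫ B' TU).
  { eapply tm_gam_del_ev; mtt. eapply TU_ev; mtt. }
  assert (Ef : eq_tm (Δ,{gam},{del}) f⟪slock (slock sg gam) del⟫ f' (zipFunTy A' B')).
  { eapply tm_gam_del_ev; mtt. eapply zipFunTy_ev; mtt. }
  assert (EZ : eq_tm (Δ,{gam}) (zipWith' A A B (tmod del f))⟪slock sg gam⟫
    (zipWith' A' A' B' (tmod del f')) (zipTy A' A' B')).
  { eapply zipWith'_ev; mtt. eapply tmod_ev; mtt. eapply zipFunTy_ev; mtt. }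
  assert (eq_tm Δ x⟪sg⟫ x' (TMod gam (TEl (Str' A')))) by (eapply eq_tm_conv; mtt).
  assert (eq_tm Δ y⟪sg⟫ y' (TMod gam (TEl (Str' A')))) by (eapply eq_tm_conv; mtt).
  rewrite !zipWith_eq. eapply eq_tm_conv_sym; [|eassumption].
  eapply ast_two_ev; mtt.
  - eapply El_Str'_ev; mtt.
  - eapply El_Str'_ev; mtt.
  - eapply tmod_ev; mtt. eapply zipTy_ev; mtt.
Qed.

Lemma zipWith_comm : commutes Γ (TEl A) (TEl B) f ->
  eq_tm Γ (zipWith A A B f x y) (zipWith A A B f y x) (TEl (Str B)).
Proof.
  intros HC. destruct wf_zipWith_parts as (?&?&?&?&?).
  destruct (Str_types (Γ := Γ) (A := A)) as (?&?&?); mtt.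
  destruct (Str_types (Γ := Γ) (A := B)) as (?&?&?); mtt.
  assert (wf_tm (Γ,{gam},{del}) A TU) by (apply wf_tm_gam_del; mtt).
  assert (wf_tm (Γ,{gam},{del}) B TU) by (apply wf_tm_gam_del; mtt).
  assert (wf_tm (Γ,{gam},{del}) f (zipFunTy A B)) by (apply wf_tm_gam_del; mtt).
  assert (K : eq_ctx (Γ,{gam},{del}) Γ) by (apply eq_ctx_sym, eq_ctx_gam_del; mtt).
  rewrite !zipWith_eq. eapply eq_tm_conv_sym; [|eassumption].
  apply ast_two_comm; mtt. apply zipWith'_commutes; mtt.
  (* Commutativity of [f] is given over [Γ] but required over [Γ,{gam},{del}]; a substitution into
     either context is one into the other. *)
  intros Δ sg S' R' F' u v Ws; intros. apply HC with (sg := sg); mtt.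
  eapply wf_sub_ctx; [exact Ws| |exact K]. mtt.
Qed.

End ZipWith.

(** * Transfer to the types of the statement *)

(** [commTy] weakens the codes and [commOf] the decoded types, so the two differ by a substitution
    pushed under [TEl]. *)
Lemma commTy_eq (Γ : ctx ms) A B f :
  wf_tm Γ A TU -> wf_tm Γ B TU -> wf_tm Γ f (zipFunTy A B) ->
  eq_ty Γ large (commOf (TEl A) (TEl B) f) (commTy A B f).
Proof.
  intros.
  destruct (comm_ctx (Γ := Γ) (S := TEl A) (R := TEl B) (F := f)) as (?&?&?&?&?&?&?); mtt.
  set (Γ2 := Γ,,TEl A,,(TEl A)⟦swk⟧) in *.
  assert (eq_ty Γ2 large (TEl A)⟦swk ⊙ swk⟧ (TEl A⟪swk ⊙ swk⟫)) by (eapply eq_TEl_sub; mtt).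
  assert (eq_ty Γ2 large (TEl B)⟦swk ⊙ swk⟧ (TEl B⟪swk ⊙ swk⟫)) by (eapply eq_TEl_sub; mtt).
  apply eq_TPi; mtt. apply eq_TPi; mtt. apply eq_TEq; mtt; apply eq_app_two; mtt.
Qed.

Theorem theorem9p9 (Γ : ctx ms) (A B f : tm ms)
    (hΓ : wf_ctx Γ)
    (hA : wf_tm Γ A TU)
    (hB : wf_tm Γ B TU)
    (hf : wf_tm Γ f (Arrow (TEl A) (Arrow (TEl A) (TEl B)))) :
  exists M : tm ms, wf_tm Γ M (Arrow (commTy A B f) (zipCommTy A B f)).
Proof.
  assert (wf : wf_tm Γ f (zipFunTy A B)) by exact hf.
  assert (EH : eq_ty Γ large (commOf (TEl A) (TEl B) f) (commTy A B f)) by (apply commTy_eq; mtt).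
  set (H := commTy A B f) in *.
  set (Γ1 := Γ,,H). assert (W1 : wf_sub Γ1 swk Γ) by (unfold Γ1; mtt).
  set (A1 := A⟪swk⟫). set (B1 := B⟪swk⟫). set (f1 := f⟪swk⟫).
  assert (wA1 : wf_tm Γ1 A1 TU) by (unfold A1; mtt).
  assert (wB1 : wf_tm Γ1 B1 TU) by (unfold B1; mtt).
  assert (T1 : eq_ty Γ1 large (zipFunTy A B)⟦swk⟧ (zipFunTy A1 B1)) by (eapply zipFunTy_ev; mtt).
  assert (wf1 : wf_tm Γ1 f1 (zipFunTy A1 B1)).
  { eapply wf_tm_conv; [eapply wf_tsub; mtt|exact T1]. }
  (* The assumed commutativity proof is the last variable of [Γ1]; eliminating it turns it into the
     judgmental property. *)
  assert (HC : commutes Γ1 (TEl A1) (TEl B1) f1).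
  { eapply commOf_elim with (Γ := Γ) (S := TEl A) (R := TEl B) (F := f) (sg := swk) (p := tvar); mtt.
    - eapply TEl_ev; mtt.
    - eapply TEl_ev; mtt.
    - eapply wf_tm_conv_sym; [apply wf_var0; mtt|]. eapply eq_TSub_ty; mtt. }
  destruct (Str_types (Γ := Γ) (A := A)) as (_&wSA&_); mtt.
  destruct (Str_types (Γ := Γ) (A := B)) as (_&wSB&_); mtt.
  set (S := TEl (Str A)). assert (wS : wf_ty Γ large S) by (unfold S; mtt).
  set (Γ2 := Γ,,S,,S⟦swk⟧). assert (W0 : wf_sub (Γ,,S) swk Γ) by mtt.
  assert (W0' : wf_sub Γ2 swk (Γ,,S)) by (unfold Γ2; mtt).
  assert (W2 : wf_sub Γ2 (swk ⊙ swk) Γ) by mtt.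
  set (A2 := A⟪swk ⊙ swk⟫). set (B2 := B⟪swk ⊙ swk⟫). set (f2 := f⟪swk ⊙ swk⟫).
  assert (wA2 : wf_tm Γ2 A2 TU) by (unfold A2; mtt).
  assert (wB2 : wf_tm Γ2 B2 TU) by (unfold B2; mtt).
  assert (T2 : eq_ty Γ2 large (zipFunTy A B)⟦swk ⊙ swk⟧ (zipFunTy A2 B2)) by (eapply zipFunTy_ev; mtt).
  assert (wf2 : wf_tm Γ2 f2 (zipFunTy A2 B2)).
  { eapply wf_tm_conv; [eapply wf_tsub; mtt|exact T2]. }
  assert (TS2 : eq_ty Γ2 large S⟦swk ⊙ swk⟧ (TEl (Str A2))).
  { eapply TEl_ev; mtt. eapply Str_ev; mtt. }
  assert (v1 : wf_tm Γ2 (var 1) (TEl (Str A2))).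
  { eapply wf_tm_conv; [|exact TS2]. eapply wf_tsub_comp; mtt. }
  assert (v0 : wf_tm Γ2 (var 0) (TEl (Str A2))).
  { eapply wf_tm_conv; [|exact TS2].
    eapply wf_tm_conv_sym; [apply wf_var0; mtt|eapply eq_TSub_comp; mtt]. }
  assert (wl : wf_tm Γ2 (zipWith A2 A2 B2 f2 (var 1) (var 0)) (TEl (Str B2))) by (apply wf_zipWith; mtt).
  assert (wr : wf_tm Γ2 (zipWith A2 A2 B2 f2 (var 0) (var 1)) (TEl (Str B2))) by (apply wf_zipWith; mtt).
  assert (Q : exists q, wf_tm Γ1 q (zipCommTy A B f)⟦swk⟧).
  { destruct (Pi2_Eq_sub W1 wS (wf_TSub W0 wS) wl wr) as [V E].
    eexists. eapply wf_tm_conv_sym; [|exact E].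
    destruct (@swk2_slift2 _ Γ S hΓ wS Γ1 swk W1) as (K1&_&K3).
    apply Pi2_Eq_intro; mtt.
    (* [zipCommTy A B f] is formed over [Γ] and then weakened past [H], so its two sides arrive as
       terms over [Γ2] substituted along [s2]. *)
    set (Γ3 := Γ1,,S⟦swk⟧,,S⟦swk⟧⟦slift 𝟙 swk⟧) in *. set (s2 := slift 𝟙 (slift 𝟙 swk)) in *.
    set (A3 := A1⟪swk ⊙ swk⟫). set (B3 := B1⟪swk ⊙ swk⟫). set (f3 := f1⟪swk ⊙ swk⟫).
    assert (wA3 : wf_tm Γ3 A3 TU) by (unfold A3; mtt).
    assert (wB3 : wf_tm Γ3 B3 TU) by (unfold B3; mtt).
    assert (T3 : eq_ty Γ3 large (zipFunTy A1 B1)⟦swk ⊙ swk⟧ (zipFunTy A3 B3)) by (eapply zipFunTy_ev; mtt).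
    assert (wf3 : wf_tm Γ3 f3 (zipFunTy A3 B3)).
    { eapply wf_tm_conv; [eapply wf_tsub; mtt|exact T3]. }
    (* A code over [Γ] reaches [Γ3] in two ways, through [Γ2] or through [Γ1]; [K3] says that they
       agree. *)
    assert (EU : forall M, wf_tm Γ M TU -> eq_tm Γ3 M⟪swk ⊙ swk⟫⟪s2⟫ M⟪swk⟫⟪swk ⊙ swk⟫ TU).
    { intros. eapply tm_comp_ev; [exact V|exact W2|exact K3|eassumption| |]; mtt; [eapply TU_ev; mtt|].
      eapply eq_tm_conv; [eapply eq_tsub_comp; mtt|]. eapply TU_ev; mtt. }
    assert (EA : eq_tm Γ3 A2⟪s2⟫ A3 TU) by (apply EU; mtt).
    assert (EB : eq_tm Γ3 B2⟪s2⟫ B3 TU) by (apply EU; mtt).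
    assert (T4 : eq_ty Γ3 large (zipFunTy A B)⟦swk ⊙ (swk ⊙ swk)⟧ (zipFunTy A3 B3)).
    { eapply TSub_comp_trans; mtt. }
    assert (Ef : eq_tm Γ3 f2⟪s2⟫ f3 (zipFunTy A3 B3)).
    { eapply tm_comp_ev; [exact V|exact W2|exact K3|exact wf|exact T4|].
      eapply eq_tm_conv; [eapply eq_tsub_comp; mtt|exact T4]. }
    assert (ES : eq_ty Γ3 large (TEl (Str A2))⟦s2⟧ (TEl (Str A3))).
    { eapply TEl_ev; mtt; [apply Str_types; mtt|eapply Str_ev; mtt]. }
    assert (ER : eq_ty Γ3 large (TEl (Str B2))⟦s2⟧ (TEl (Str B3))).
    { eapply TEl_ev; mtt; [apply Str_types; mtt|eapply Str_ev; mtt]. }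
    assert (u1 : wf_tm Γ3 (var 1)⟪s2⟫ (TEl (Str A3))) by (eapply wf_tm_conv; [eapply wf_tsub; mtt|exact ES]).
    assert (u0 : wf_tm Γ3 (var 0)⟪s2⟫ (TEl (Str A3))) by (eapply wf_tm_conv; [eapply wf_tsub; mtt|exact ES]).
    assert (HC3 : commutes Γ3 (TEl A3) (TEl B3) f3).
    { eapply commutes_sub with (sg := swk ⊙ swk); [| | | | | | |exact HC]; mtt; eapply TEl_ev; mtt. }
    eapply eq_tm_conv_sym; [|exact ER].
    eapply eq_tm_trans; [eapply zipWith_ev with (x' := (var 1)⟪s2⟫) (y' := (var 0)⟪s2⟫); mtt|].
    eapply eq_tm_trans; [|apply eq_tm_sym;
      eapply zipWith_ev with (x' := (var 0)⟪s2⟫) (y' := (var 1)⟪s2⟫); mtt].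
    apply zipWith_comm; mtt. }
  destruct Q as [q Wq]. exists (tlam H q).
  apply wf_tlam; mtt.
Qed.
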